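(* Let $F(\xi,x)=f(\xi)+\sum_{\langle\boldsymbol{k},\boldsymbol{w}\rangle\leq d-1}c_{\boldsymbol{k}}(x)\xi^{\boldsymbol{k}}$ be a semi-quasielliptic polynomial, with $f$ quasielliptic of degree $d$ with respect to $\boldsymbol{w}=(w_1,\ldots,w_n)$. There is a constant $M_0\in\mathbb{N}$, for which there exist $A_0,A_1>0$ with $$A_0\,\Xi(\xi)\leq|F(\xi,x)|_p\leq A_1\,\Xi(\xi)\quad\text{for all } x\in\mathbb{Q}_p^n \text{ and } \|\xi\|_p\geq p^{M_0},$$ such that for all $\alpha>0$ the operator $$\boldsymbol{F}(D;\alpha;x):\widetilde{H}_{(\infty,M_0)}\to\widetilde{H}_{(\infty,M_0)},\qquad\phi\mapsto\boldsymbol{F}(D;\alpha;x)\phi,$$ is a bicontinuous isomorphism of locally convex vector spaces.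
   Context: $p$ is a prime, $|\cdot|_p$ the $p$-adic absolute value on $\mathbb{Q}_p$, $\|\xi\|_p=\max_i|\xi_i|_p$, and $0\in\mathbb{N}$. A non-constant polynomial $f(\xi)\in\mathbb{Q}_p[\xi_1,\ldots,\xi_n]$ is called quasielliptic of degree $d$ with respect to $\boldsymbol{w}\in(\mathbb{N}\setminus\{0\})^n$ if: (Q1) $f(\lambda^{w_1}\xi_1,\ldots,\lambda^{w_n}\xi_n)=\lambda^d f(\xi)$ for all $\lambda\in\mathbb{Q}_p^\times$; and (Q2) $f(\xi)=0\Leftrightarrow \xi=0$. By convention all quasielliptic polynomials are assumed to have coefficients in $\mathbb{Z}_p$. $F(\xi,x)=f(\xi)+\sum_{\langle\boldsymbol{k},\boldsymbol{w}\rangle\leq d-1}c_{\boldsymbol{k}}(x)\xi^{\boldsymbol{k}}$ (with $\boldsymbol{k}\in\mathbb{N}^n$ and $\langle\cdot,\cdot\rangle$ the usual inner product) is semi-quasielliptic if $f$ is quasielliptic of degree $d$ with respect to $\boldsymbol{w}$ and each $c_{\boldsymbol{k}}:\mathbb{Q}_p^n\to\mathbb{Q}_p$ satisfies $\sup_{x}|c_{\boldsymbol{k}}(x)|_p<\infty$. Set $\Xi(\xi)=\sum_{i=1}^n|\xi_i|_p^{d/w_i}$. $S$ is the space of Schwartz--Bruhat functions on $\mathbb{Q}_p^n$. $\Psi:\mathbb{Q}_p\to\mathbb{C}^\times$ is the standard additive character, $(\mathcal{F}\phi)(\xi)=\int_{\mathbb{Q}_p^n}\Psi(-x\cdot\xi)\phi(x)\,d^nx$,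 with $d^nx$ the Haar measure normalized by $\mathrm{vol}(\mathbb{Z}_p^n)=1$. For a real $\beta\geq0$ and $\phi\in S$ put $\|\phi\|_{(\beta,\Xi)}^2=\int_{\mathbb{Q}_p^n}[\max(1,\Xi(\xi))]^{2\beta}|\mathcal{F}(\phi)(\xi)|^2d^n\xi$. For $M_0\in\mathbb{N}$ let $\Phi_{M_0}=\{\phi\in S:\mathcal{F}(\phi)(\xi)=0\text{ for all }\|\xi\|_p\leq p^{M_0}\}$, and let $\widetilde{H}_{(\beta,M_0)}$ be the completion of $(\Phi_{M_0},\|\cdot\|_{(\beta,\Xi)})$; since $\|\phi\|_{L^2}\leq\|\phi\|_{(\beta,\Xi)}$, its elements are regarded as (a.e.-classes of) functions in $L^2(\mathbb{Q}_p^n)$. The space $\bigcap_{\beta\in\mathbb{N}}\widetilde{H}_{(\beta,M_0)}$ carries the locally convex topology of the norms $\|\cdot\|_{(\beta,\Xi)}$, $\beta\in\mathbb{N}$, metrized by $\rho(x,y)=\max_{\beta\in\mathbb{N}}\left\{c_\beta\frac{\|x-y\|_{(\beta,\Xi)}}{1+\|x-y\|_{(\beta,\Xi)}}\right\}$ with $\{c_\beta\}$ a fixed null-sequence of positive numbers, and $\widetilde{H}_{(\infty,M_0)}$ is the completion of $(\bigcap_{\beta\in\mathbb{N}}\widetilde{H}_{(\beta,M_0)},\rho)$, which equals $\bigcap_{\beta\in\mathbb{N}}\widetilde{H}_{(\beta,M_0)}$. The operator is defined on $\Phi_{M_0}$ by $(\boldsymbol{F}(D;\alpha;x)\phi)(x)=\int_{\mathbb{Q}_p^n}\Psi(x\cdot\xi)|F(\xi,x)|_p^\alpha\mathcal{F}(\phi)(\xi)\,d^n\xi$,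 i.e. $\boldsymbol{F}(D;\alpha;x)\phi=\mathcal{F}^{-1}(|F(\xi,x)|_p^\alpha\mathcal{F}(\phi))$, and is extended by density to $\widetilde{H}_{(\gamma,M_0)}\to\widetilde{H}_{(\gamma-\alpha,M_0)}$, $\gamma\geq\alpha$, and hence to $\widetilde{H}_{(\infty,M_0)}$. *)

(* Defs.v *)
From HB Require Import structures.
From mathcomp Require Import all_boot all_order all_algebra.
From mathcomp Require Import generic_quotient ring_quotient.
From mathcomp Require Import all_classical all_reals all_analysis.
From mathcomp Require Import complex.
From mathcomp Require Import lra ring zify.
From mathcomp Require mpoly.
Import (coercions, canonicals) mpoly.
Set Implicit Arguments. Unset Strict Implicit. Unset Printing Implicit Defensive.
Import Order.TTheory GRing.Theory Num.Theory.
Import numFieldNormedType.Exports.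
Local Open Scope classical_set_scope.
Local Open Scope ring_scope.
Local Open Scope quotient_scope.

Section AbsRat.
Variables (p : nat) (p_pr : prime p).

(* p ^ (- v_p(q)), with v_p(a / b) = logn p a - logn p b *)
Definition rat_pabs (q : rat) : rat :=
  if q == 0 then 0
  else p%:Q ^ ((logn p `|denq q|)%:Z - (logn p `|numq q|)%:Z).

Let p_gt0 : 0 < p%:Q.
Proof. by rewrite ltr0n prime_gt0. Qed.

Let p_neq0 : p%:Q != 0. Proof. by rewrite gt_eqF. Qed.

Lemma rat_pabs0 : rat_pabs 0 = 0. Proof. by rewrite /rat_pabs eqxx. Qed.

Lemma rat_pabs_gt0 q : q != 0 -> 0 < rat_pabs q.
Proof. by move=> /negPf q0; rewrite /rat_pabs q0 exprz_gt0. Qed.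

Lemma rat_pabs_ge0 q : 0 <= rat_pabs q.
Proof.
have [->|/rat_pabs_gt0/ltW//] := eqVneq q 0; by rewrite rat_pabs0.
Qed.

Lemma rat_pabs_frac (a b : int) : a != 0 -> b != 0 ->
  rat_pabs (a%:~R / b%:~R) = p%:Q ^ ((logn p `|b|)%:Z - (logn p `|a|)%:Z).
Proof.
move=> a0 b0; set q := (_ / _).
have bQ : b%:~R != 0 :> rat by rewrite intr_eq0.
have q0 : q != 0 by rewrite mulf_neq0 ?invr_eq0 ?intr_eq0.
rewrite /rat_pabs (negPf q0); congr (_ ^ _).
have /eqP E : (numq q * b = a * denq q).
  apply/eqP; rewrite -(eqr_int rat) !rmorphM /= numqE mulrAC.
  by rewrite /q mulfVK.
have : logn p `|numq q * b| = logn p `|a * denq q| by move/eqP: E => ->.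
rewrite !abszM !lognM ?absz_gt0 ?numq_eq0 ?denq_neq0 // => E2.
lia.
Qed.

Lemma rat_pabsM q r : rat_pabs (q * r) = rat_pabs q * rat_pabs r.
Proof.
have [->|q0] := eqVneq q 0; first by rewrite mul0r !rat_pabs0 mul0r.
have [->|r0] := eqVneq r 0; first by rewrite mulr0 !rat_pabs0 mulr0.
rewrite -[q in LHS]divq_num_den -[r in LHS]divq_num_den.
rewrite mulrACA -invfM -!intrM.
rewrite rat_pabs_frac ?mulf_neq0 ?numq_eq0 ?denq_neq0 //.
rewrite /rat_pabs (negPf q0) (negPf r0) -expfzDr //; congr (_ ^ _).
rewrite !abszM !lognM ?absz_gt0 ?numq_eq0 ?denq_neq0 //; lia.
Qed.

Lemma rat_pabs1 : rat_pabs 1 = 1.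
Proof. by rewrite /rat_pabs oner_eq0 (numq_int 1) (denq_int 1) !logn1 expr0z. Qed.

Lemma rat_pabsN q : rat_pabs (- q) = rat_pabs q.
Proof. by rewrite /rat_pabs oppr_eq0 numqN denqN abszN. Qed.

Lemma rat_pabsV q : rat_pabs q^-1 = (rat_pabs q)^-1.
Proof.
have [->|q0] := eqVneq q 0; first by rewrite !(invr0, rat_pabs0).
have := rat_pabsM q q^-1; rewrite divff // rat_pabs1 => E.
by apply: (mulfI (lt0r_neq0 (rat_pabs_gt0 q0))); rewrite -E divff // lt0r_neq0 ?rat_pabs_gt0.
Qed.

Lemma rat_pabsD q r : rat_pabs (q + r) <= Num.max (rat_pabs q) (rat_pabs r).
Proof.
have [->|q0] := eqVneq q 0; first by rewrite add0r le_max lexx orbT.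
have [->|r0] := eqVneq r 0; first by rewrite addr0 le_max lexx.
have [->|qr0] := eqVneq (q + r) 0; first by rewrite rat_pabs0 le_max rat_pabs_ge0.
pose d := denq q * denq r; pose a := numq q * denq r; pose b := numq r * denq q.
have dq0 : (denq q)%:~R != 0 :> rat by rewrite intr_eq0 denq_neq0.
have dr0 : (denq r)%:~R != 0 :> rat by rewrite intr_eq0 denq_neq0.
have d0 : d != 0 by rewrite mulf_neq0 ?denq_neq0.
have a0 : a != 0 by rewrite mulf_neq0 ?denq_neq0 ?numq_eq0.
have b0 : b != 0 by rewrite mulf_neq0 ?denq_neq0 ?numq_eq0.
have Eq : q = a%:~R / d%:~R.
  by rewrite /a /d !intrM -mulf_div divff // mulr1 divq_num_den.
have Er : r = b%:~R / d%:~R.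
  by rewrite /b /d !intrM [(denq q)%:~R * _]mulrC -mulf_div divff // mulr1 divq_num_den.
have Eqr : q + r = (a + b)%:~R / d%:~R by rewrite intrD mulrDl -Eq -Er.
have ab0 : a + b != 0.
  by apply: contra_neq qr0 => ab; rewrite Eqr ab mul0r.
rewrite Eqr Eq Er !rat_pabs_frac //.
set m := minn (logn p `|a|) (logn p `|b|).
have dvd (c : int) : c != 0 -> (m <= logn p `|c|)%N = ((p ^ m)%N%:Z %| c)%Z.
  by move=> c0; rewrite dvdzE /= pfactor_dvdn // absz_gt0.
have mab : (m <= logn p `|(a + b)%R|)%N.
  by rewrite dvd // rpredD // -dvd // geq_min leqnn // orbT.
have mono (i j : nat) : (i <= j)%N ->
    p%:Q ^ ((logn p `|d|)%:Z - j%:Z) <= p%:Q ^ ((logn p `|d|)%:Z - i%:Z).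
  move=> ij; apply: ler_weXz2l; first by rewrite ler1n prime_gt0.
  by rewrite lerB // lez_nat.
apply: le_trans (mono _ _ mab) _; rewrite le_max /m.
by case: (leqP (logn p `|a|) (logn p `|b|)) => _; rewrite lexx ?orbT.
Qed.

Lemma rat_pabsD_lt q r e : rat_pabs q < e -> rat_pabs r < e -> rat_pabs (q + r) < e.
Proof.
by move=> qe re; apply: le_lt_trans (rat_pabsD q r) _; rewrite gt_max qe re.
Qed.

Lemma rat_pabs_dist q r : rat_pabs (q - r) = rat_pabs (r - q).
Proof. by rewrite -rat_pabsN opprB. Qed.

Lemma rat_pabs_eq q r : rat_pabs (q - r) < rat_pabs q -> rat_pabs r = rat_pabs q.
Proof.
move=> h; apply/eqP; rewrite eq_le; apply/andP; split.
  have := rat_pabsD (r - q) q; rewrite subrK rat_pabs_dist => /le_trans; apply.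
  by rewrite ge_max lexx ltW.
have := rat_pabsD (q - r) r; rewrite subrK le_max leNgt h /=; done.
Qed.

Definition rat_cauchy : {pred nat -> rat} := fun x =>
  `[< forall e : rat, 0 < e ->
      exists N, forall i j, (N <= i)%N -> (N <= j)%N -> rat_pabs (x i - x j) < e >].

Lemma rat_cauchy_bounded x : x \in rat_cauchy ->
  exists2 B, 0 < B & forall i, rat_pabs (x i) < B.
Proof.
move=> /asboolP/(_ 1 ltr01)[N xN].
have S0 k : 0 <= \sum_(i < k) rat_pabs (x i) by apply: sumr_ge0 => i _; apply: rat_pabs_ge0.
exists (1 + \sum_(i < N.+1) rat_pabs (x i)); first by rewrite ltr_wpDr.
have key i : (i <= N)%N -> rat_pabs (x i) < 1 + \sum_(i < N.+1) rat_pabs (x i).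
  rewrite -ltnS => iN; rewrite (bigD1 (Ordinal iN)) //= addrCA ltrDl ltr_wpDr //.
  by apply: sumr_ge0 => j _; apply: rat_pabs_ge0.
move=> i; have [iN|Ni] := leqP i N; first exact: key.
rewrite -[x i](subrK (x N)); apply: rat_pabsD_lt; last exact: key.
by apply: lt_le_trans (xN _ _ (ltnW Ni) (leqnn _)) _; rewrite lerDl.
Qed.

Lemma rat_cauchy_subring : subring_closed rat_cauchy.
Proof.
split.
- apply/asboolP => e e0; exists 0%N => i j _ _; by rewrite subrr rat_pabs0.
- move=> x y /asboolP cx /asboolP cy; apply/asboolP => e e0.
  have [[N xN] [M yM]] := (cx e e0, cy e e0).
  exists (maxn N M) => i j; rewrite !geq_max => /andP[Ni Mi] /andP[Nj Mj].
  have -> : (x - y) i - (x - y) j = (x i - x j) + - (y i - y j).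
    by rewrite -![(x - y) _]/(x _ - y _); ring.
  by apply: rat_pabsD_lt; rewrite ?rat_pabsN; [apply: xN|apply: yM].
- move=> x y cx cy; apply/asboolP => e e0.
  have [[B B0 xB] [C C0 yC]] := (rat_cauchy_bounded cx, rat_cauchy_bounded cy).
  move/asboolP : cx => /(_ (e / C)); rewrite divr_gt0 // => /(_ isT)[N xN].
  move/asboolP : cy => /(_ (e / B)); rewrite divr_gt0 // => /(_ isT)[M yM].
  exists (maxn N M) => i j; rewrite !geq_max => /andP[Ni Mi] /andP[Nj Mj].
  have -> : (x * y) i - (x * y) j = x i * (y i - y j) + y j * (x i - x j).
    by rewrite -![(x * y) _]/(x _ * y _); ring.
  have mul_lt (q r b c : rat) : rat_pabs q < b -> rat_pabs r < c / b ->
      rat_pabs (q * r) < c.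
    move=> qb rc; rewrite rat_pabsM.
    have b0 : 0 < b := le_lt_trans (rat_pabs_ge0 q) qb.
    rewrite -[c](divfK (lt0r_neq0 b0)) [_ * b]mulrC.
    by apply: ltr_pM; rewrite ?rat_pabs_ge0.
  by apply: rat_pabsD_lt; [exact: mul_lt (xB i) (yM _ _ Mi Mj)|exact: mul_lt (yC j) (xN _ _ Ni Nj)].
Qed.

HB.instance Definition _ := GRing.isSubringClosed.Build _ rat_cauchy rat_cauchy_subring.

Definition cauchy_seq : Type := {x : nat -> rat | rat_cauchy x}.
HB.instance Definition _ := Choice.on cauchy_seq.
HB.instance Definition _ := SubType.on cauchy_seq.
HB.instance Definition _ := [SubChoice_isSubComNzRing of cauchy_seq by <:].

Definition null_seq : {pred cauchy_seq} := fun x =>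
  `[< forall e : rat, 0 < e -> exists N, forall i, (N <= i)%N -> rat_pabs (val x i) < e >].

Lemma null_seq_ideal : idealr_closed null_seq.
Proof.
split.
- by apply/asboolP => e e0; exists 0%N => i _; rewrite rat_pabs0.
- apply/negP => /asboolP/(_ 1 ltr01)[N /(_ _ (leqnn N))].
  by rewrite -[val 1 N]/(1 : rat) rat_pabs1 ltxx.
- move=> a x y /asboolP nx /asboolP ny; apply/asboolP => e e0.
  have [B B0 aB] := rat_cauchy_bounded (valP a).
  have [N xN] := nx (e / B) (divr_gt0 e0 B0); have [M yM] := ny e e0.
  exists (maxn N M) => i; rewrite !geq_max => /andP[Ni Mi].
  rewrite -[val _ i]/(val a i * val x i + val y i).
  apply: rat_pabsD_lt; last exact: yM.
  rewrite rat_pabsM -[e](divfK (lt0r_neq0 B0)) [_ * B]mulrC.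
  by apply: ltr_pM; rewrite ?rat_pabs_ge0 ?xN.
Qed.

HB.instance Definition _ := isIdealr.Build cauchy_seq null_seq null_seq_ideal.

Definition Qp : Type := {ideal_quot null_seq}.
HB.instance Definition _ := GRing.ComNzRing.on Qp.
HB.instance Definition _ := EqQuotient.on Qp.
HB.instance Definition _ := NzRingQuotient.on Qp.

Lemma pi_null s : (\pi_Qp s == 0 :> Qp) = (s \in null_seq).
Proof. by rewrite -(rmorph0 \pi_Qp) -Quotient.idealrBE subr0. Qed.

Lemma pi_eq s t : (\pi_Qp s == \pi_Qp t :> Qp) = (s - t \in null_seq).
Proof. by rewrite -Quotient.idealrBE. Qed.

Lemma not_null_eventually (s : cauchy_seq) : s \notin null_seq ->
  exists N, 0 < rat_pabs (val s N) /\
    forall i, (N <= i)%N -> rat_pabs (val s i) = rat_pabs (val s N).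
Proof.
move=> /asboolPn /existsNP[e /not_implyP[e0 /forallNP nN]].
have [N sN] := asboolP _ (valP s) e e0.
have /existsNP[i /not_implyP[Ni /negP]] := nN N; rewrite -leNgt => ei.
have key j : (N <= j)%N -> rat_pabs (val s j) = rat_pabs (val s i).
  by move=> Nj; apply: rat_pabs_eq; apply: lt_le_trans (sN _ _ Ni Nj) ei.
exists N; rewrite key //; split; first exact: lt_le_trans e0 ei.
by move=> j /key.
Qed.

Definition Qp_inv (x : Qp) : Qp := xget 0 [set y | x * y = 1 \/ x = 0 /\ y = 0].

Lemma Qp_mulVx (x : Qp) : x != 0 -> Qp_inv x * x = 1.
Proof.
move=> x0; suff [y xy] : exists y, x * y = 1.
  rewrite /Qp_inv; case: xgetP => [z -> [|[/eqP]]|/(_ y) []].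
  - by rewrite mulrC.
  - by rewrite (negPf x0).
  - by left.
move: x0; rewrite -[x]reprK; set s := repr x; rewrite pi_null.
move=> /not_null_eventually[N [c0 sN]]; set c := rat_pabs _ in c0 sN.
have s0 i : (N <= i)%N -> val s i != 0.
  by move=> /sN sc; apply: contraTneq c0 => s0; rewrite -sc s0 rat_pabs0 ltxx.
have ct : rat_cauchy (fun i => (val s i)^-1).
  apply/asboolP => e e0; have [M sM] := asboolP _ (valP s) (e * (c * c)) (mulr_gt0 e0 (mulr_gt0 c0 c0)).
  exists (maxn N M) => i j; rewrite !geq_max => /andP[Ni Mi] /andP[Nj Mj].
  have -> : (val s i)^-1 - (val s j)^-1 = (val s j - val s i) * ((val s i) * (val s j))^-1.
    by field; rewrite !s0.
  rewrite rat_pabsM rat_pabsV rat_pabsM !sN // ltr_pdivrMr ?mulr_gt0 //.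
  exact: sM.
pose t : cauchy_seq := exist (fun y => is_true (rat_cauchy y)) _ ct.
exists (\pi t).
apply/eqP; rewrite -rmorphM -(rmorph1 (\pi_Qp)) pi_eq.
apply/asboolP => e e0; exists N => i Ni.
by rewrite -[val _ i]/(val s i * (val s i)^-1 - 1) divff ?s0 // subrr rat_pabs0.
Qed.

Lemma Qp_inv0 : Qp_inv 0 = 0.
Proof.
rewrite /Qp_inv; case: xgetP => [z -> [|[]//]|/(_ 0) []]; last by right.
by rewrite mul0r => /eqP; rewrite eq_sym oner_eq0.
Qed.

HB.instance Definition _ := GRing.ComNzRing_isField.Build Qp Qp_mulVx Qp_inv0.

(* The absolute value of the limit of a Cauchy sequence s is the limit of
   |s_i|_p; this sequence is eventually constant for some representative of
   any x (for all of them if x != 0), and it takes rational values, so that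
   pabs is rational-valued and needs no model of the reals. *)
Definition pabs (x : Qp) : rat := xget 0 [set r | exists2 s : cauchy_seq,
  \pi_Qp s = x & exists N, forall i, (N <= i)%N -> rat_pabs (val s i) = r].

Lemma pabs_pi (x : Qp) : exists2 s : cauchy_seq, \pi_Qp s = x &
  exists N, forall i, (N <= i)%N -> rat_pabs (val s i) = pabs x.
Proof.
rewrite /pabs; case: xgetP => [r -> //|]; set P := [set _ | _] => nP; exfalso.
have [x0|] := boolP (x == 0).
  apply: (nP 0); exists 0; first by rewrite (eqP x0) rmorph0.
  by exists 0%N => i _; rewrite -[val _ i]/(0 : rat) rat_pabs0.
rewrite -[x in x == 0]reprK pi_null => /not_null_eventually[N [_ sN]].
by apply: (nP (rat_pabs (val (repr x) N))); exists (repr x); [rewrite reprK|exists N].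
Qed.

Lemma pabs_le (s : cauchy_seq) M : 0 <= M ->
  (exists N, forall i, (N <= i)%N -> rat_pabs (val s i) <= M) ->
  pabs (\pi_Qp s) <= M.
Proof.
move=> M0 [N sN]; have [t /eqP] := pabs_pi (\pi s); rewrite pi_eq => /asboolP st [K tK].
rewrite leNgt; apply/negP => Mx.
have [L stL] := st _ (le_lt_trans M0 Mx).
pose i := maxn N (maxn K L).
have Ni : (N <= i)%N by rewrite leq_maxl.
have Ki : (K <= i)%N by rewrite /i maxnCA leq_maxl.
have Li : (L <= i)%N by rewrite /i maxnA leq_maxr.
have /rat_pabs_eq : rat_pabs (val t i - val s i) < rat_pabs (val t i).
  by rewrite tK //; exact: stL.
by rewrite tK // => sx; have := sN i Ni; rewrite sx leNgt Mx.
Qed.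

Lemma pabs_ge0 x : 0 <= pabs x.
Proof. by have [s _ [N /(_ _ (leqnn N)) <-]] := pabs_pi x; apply: rat_pabs_ge0. Qed.

Lemma pabs0 : pabs 0 = 0.
Proof.
apply/eqP; rewrite eq_le pabs_ge0 andbT -(rmorph0 \pi_Qp); apply: pabs_le => //.
by exists 0%N => i _; rewrite -[val _ i]/(0 : rat) rat_pabs0.
Qed.

Lemma pabs_eq0 x : pabs x = 0 -> x = 0.
Proof.
move=> x0; have [s sx [N sN]] := pabs_pi x.
apply/eqP; rewrite -sx pi_null; apply/asboolP => e e0; exists N => i /sN ->.
by rewrite x0.
Qed.

Lemma pabsD x y : pabs (x + y) <= Num.max (pabs x) (pabs y).
Proof.
have [[s sx [N sN]] [t tx [M tM]]] := (pabs_pi x, pabs_pi y).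
rewrite -{1}sx -{1}tx -rmorphD; apply: pabs_le; first by rewrite le_max pabs_ge0.
exists (maxn N M) => i; rewrite geq_max => /andP[Ni Mi].
by rewrite -(sN i Ni) -(tM i Mi); apply: rat_pabsD.
Qed.

Lemma pabsN x : pabs (- x) = pabs x.
Proof.
suff le z : pabs (- z) <= pabs z.
  by apply/eqP; rewrite eq_le le /= -{1}[x]opprK le.
have [s sz [N sN]] := pabs_pi z; rewrite -{1}sz -rmorphN.
apply: pabs_le; first exact: pabs_ge0.
by exists N => i Ni; rewrite -(sN i Ni) -[val _ i]/(- val s i) rat_pabsN.
Qed.

Definition Qp_dist (x y : Qp) : rat := pabs (x - y).

Fact Qp_distxx x : Qp_dist x x = 0.
Proof. by rewrite /Qp_dist subrr pabs0. Qed.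

Fact Qp_dist_eq0 x y : Qp_dist x y = 0 -> x = y.
Proof. by move=> /pabs_eq0/subr0_eq. Qed.

Fact Qp_dist_sym x y : Qp_dist x y = Qp_dist y x.
Proof. by rewrite /Qp_dist -pabsN opprB. Qed.

Fact Qp_dist_triangle y x z : Qp_dist x z <= Qp_dist x y + Qp_dist y z.
Proof.
rewrite /Qp_dist -[x - z](subrKA y); apply: le_trans (pabsD _ _) _.
by rewrite ge_max lerDl lerDr !pabs_ge0.
Qed.

HB.instance Definition _ := isMetric.Build rat Qp
  Qp_distxx Qp_dist_eq0 Qp_dist_sym Qp_dist_triangle.
HB.instance Definition _ := isPointed.Build Qp 0.

End AbsRat.

Section Analysis.
Variables (R : realType) (p : nat) (p_pr : prime p) (n : nat).
Local Notation K := (Qp p_pr).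
Local Notation V := 'rV[Qp p_pr]_n.
Local Notation C := R[i].

Definition Qp_abs (x : K) : R := ratr (pabs x).

Definition Qp_norm (xi : V) : R := \big[Num.max/0]_(i < n) Qp_abs (xi 0 i).

Definition dotp (x xi : V) : K := \sum_(i < n) x 0 i * xi 0 i.

(* {x}_p, the only element of Z[1/p] in [0, 1) that is congruent to x
   modulo Z_p *)
Definition frac_part (x : K) : rat := xget 0 [set q : rat |
  [/\ 0 <= q < 1, exists m, q * p%:Q ^+ m \is a Num.int & pabs (x - ratr q) <= 1]].

(* exp (2 * pi * i * {x}_p) *)
Definition add_char (x : K) : C :=
  let t := 2 * pi * ratr (frac_part x) in Complex (cos t) (sin t).

Definition BorelQp : Type := g_sigma_algebraType (@open V).
HB.instance Definition _ := Measurable.on BorelQp.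

(* On a second countable locally compact group, the translation invariant Borel
   measure giving mass 1 to a fixed compact open subgroup is unique. *)
Definition haar_measure (mu : {measure set BorelQp -> \bar R}) : Prop :=
  (forall (A : set V) (a : V), measurable (A : set BorelQp) ->
     mu [set a + x | x in A] = mu A) /\
  mu [set x : V | forall i, pabs (x 0 i) <= 1] = 1%E.

Definition schwartz_bruhat (phi : V -> C) : Prop :=
  (forall x, \forall y \near x, phi y = phi x) /\
  compact (closure [set x | phi x != 0]).

Record quasielliptic (f : mpoly.mpoly n K) (d : nat) (w : 'I_n -> nat) : Prop := {
  qe_nonconst : forall a, f <> mpoly.mpolyC n a;
  qe_weights : forall i, (0 < w i)%N;
  qe_homog : forall (l : K) (xi : 'I_n -> K), l != 0 ->
    mpoly.meval (fun i => l ^+ w i * xi i) f = l ^+ d * mpoly.meval xi f;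
  qe_zero : forall xi : 'I_n -> K, mpoly.meval xi f = 0 <-> xi = (fun=> 0);
  qe_integral : forall m, pabs (mpoly.mcoeff m f) <= 1 }.

Definition wdeg (w : 'I_n -> nat) (k : mpoly.multinom n) : nat :=
  \sum_(i < n) (k i * w i)%N.

Definition bounded_coefs (d : nat) (w : 'I_n -> nat)
    (c : mpoly.multinom n -> V -> K) : Prop :=
  forall k, (wdeg w k <= d - 1)%N -> exists B : R, forall x, Qp_abs (c k x) <= B.

(* As the weights are positive, wdeg w k <= d - 1 implies mdeg k < d: the sum
   ranges over all the k with wdeg w k <= d - 1. The subtraction is harmless,
   since d > 0 for every quasielliptic polynomial. *)
Definition symbol (f : mpoly.mpoly n K) (d : nat) (w : 'I_n -> nat)
    (c : mpoly.multinom n -> V -> K) (xi x : V) : K :=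
  mpoly.meval (xi 0) f +
  \sum_(k : mpoly.bmultinom n d | (wdeg w (mpoly.bmnm k) <= d - 1)%N)
    c (mpoly.bmnm k) x * \prod_(i < n) xi 0 i ^+ mpoly.bmnm k i.

Definition Xi (d : nat) (w : 'I_n -> nat) (xi : V) : R :=
  \sum_(i < n) Qp_abs (xi 0 i) `^ (d%:R / (w i)%:R).

Section Spaces.
Variable mu : {measure set BorelQp -> \bar R}.

Definition cintegral (f : V -> C) : C :=
  Complex (\int[mu]_x complex.Re (f x)) (\int[mu]_x complex.Im (f x)).

Definition fourier (phi : V -> C) (xi : V) : C :=
  cintegral (fun x => add_char (- dotp x xi) * phi x).

Definition ae_zero : {pred V -> C} :=
  fun f => `[< {ae mu, forall x : BorelQp, f x = 0} >].
Lemma ae_zero_zmod : zmod_closed ae_zero.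
Proof.
split; first by apply/asboolP; apply: aeW.
move=> f g /asboolP f0 /asboolP g0; apply/asboolP.
by apply: filterS2 f0 g0 => x fx gx; rewrite -[(f - g) x]/(f x - g x) fx gx subr0.
Qed.
HB.instance Definition _ := GRing.isZmodClosed.Build _ ae_zero ae_zero_zmod.

(* a.e.-classes of functions *)
Definition aefun : Type := Quotient.quot ae_zero.
HB.instance Definition _ := GRing.Zmodule.on aefun.
HB.instance Definition _ := EqQuotient.on aefun.
HB.instance Definition _ := ZmodQuotient.on aefun.

Definition aeclass (f : V -> C) : aefun := \pi_aefun f.

Lemma aeclassP f g : aeclass f = aeclass g <-> {ae mu, forall x : BorelQp, f x = g x}.
Proof.
have E : (aeclass f == aeclass g) = (f - g \in ae_zero) by rewrite -Quotient.idealrBE.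
split=> [/eqP|h].
  rewrite E => /asboolP; apply: filterS => x; rewrite -[(f - g) x]/(f x - g x).
  by move/subr0_eq.
apply/eqP; rewrite E; apply/asboolP; apply: filterS h => x.
by rewrite -[(f - g) x]/(f x - g x) => ->; rewrite subrr.
Qed.

Lemma aeclass_repr (x : aefun) : aeclass (repr x) = x.
Proof. exact: reprK. Qed.

Definition aescale (a : C) (x : aefun) : aefun := aeclass (a *: repr x).

Lemma aescale_class a (f : V -> C) : aescale a (aeclass f) = aeclass (a *: f).
Proof.
apply/aeclassP; have /aeclassP : aeclass (repr (aeclass f)) = aeclass f by exact: aeclass_repr.
by apply: filterS => x; rewrite -![(_ *: _) x]/(_ *: (_ x)) => ->.
Qed.

Lemma aeclassD (f g : V -> C) : aeclass (f + g) = aeclass f + aeclass g.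
Proof. exact: (raddfD \pi_aefun). Qed.

Fact aescaleA a b x : aescale a (aescale b x) = aescale (a * b) x.
Proof. by rewrite -(aeclass_repr x) !aescale_class scalerA. Qed.
Fact aescale1 : left_id 1 aescale.
Proof. by move=> x; rewrite -(aeclass_repr x) aescale_class scale1r. Qed.
Fact aescaleDr : right_distributive aescale +%R.
Proof.
by move=> a x y; rewrite -(aeclass_repr x) -(aeclass_repr y) -(aeclassD (repr x) (repr y)) !aescale_class -(aeclassD (a *: repr x)) scalerDr.
Qed.
Fact aescaleDl x : {morph aescale^~ x : a b / a + b}.
Proof. by move=> a b; rewrite -(aeclass_repr x) !aescale_class -(aeclassD (a *: repr x)) scalerDl. Qed.
HB.instance Definition _ := GRing.Zmodule_isLmodule.Build C aefun
  aescaleA aescale1 aescaleDr aescaleDl.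

Definition sq_integrable (f : V -> C) : Prop :=
  [/\ measurable_fun setT ((fun x => complex.Re (f x)) : BorelQp -> R),
      measurable_fun setT ((fun x => complex.Im (f x)) : BorelQp -> R) &
      (\int[mu]_x (ComplexField.Normc.normc (f x) ^+ 2)%:E < +oo)%E].

Definition L2_cvg (u : nat -> V -> C) (f : V -> C) : Prop :=
  (fun k => (\int[mu]_x (ComplexField.Normc.normc (u k x - f x) ^+ 2)%:E)%E)
    @ \oo --> 0%E.

Variables (d : nat) (w : 'I_n -> nat).

Definition sobolev_norm (beta : R) (phi : V -> C) : R :=
  Num.sqrt (\int[mu]_xi (Num.max 1 (Xi d w xi) `^ (2 * beta) *
                          ComplexField.Normc.normc (fourier phi xi) ^+ 2)).

Variable M0 : nat.

Definition Phi (phi : V -> C) : Prop :=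
  schwartz_bruhat phi /\
  forall xi, Qp_norm xi <= p%:R ^+ M0 -> fourier phi xi = 0.

Definition approximates (beta : R) (u : nat -> V -> C) (f : V -> C) : Prop :=
  [/\ forall k, Phi (u k),
      forall e, 0 < e -> exists N, forall i j, (N <= i)%N -> (N <= j)%N ->
        sobolev_norm beta (u i - u j) < e &
      L2_cvg u f].

(* The completion of Phi for sobolev_norm beta, realized in L^2: a Cauchy
   sequence of Phi is identified with its L^2 limit. *)
Definition Htilde (beta : R) : set aefun :=
  [set x | exists f u, [/\ x = aeclass f, sq_integrable f & approximates beta u f]].

(* The norm of the completion: the limit of the norms of an approximating
   sequence. *)
Definition Hnorm (beta : R) (x : aefun) : R :=
  xget 0 [set l | exists f u, [/\ x = aeclass f, sq_integrable f,
    approximates beta u f & (fun k => sobolev_norm beta (u k)) @ \oo --> l]].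

Definition Htilde_oo : set aefun := [set x | forall beta : nat, Htilde beta%:R x].

Definition psdo (F : V -> V -> K) (alpha : R) (phi : V -> C) (x : V) : C :=
  cintegral (fun xi => add_char (dotp x xi) *
    Complex (Qp_abs (F xi x) `^ alpha) 0 * fourier phi xi).

Definition linear_on (H : set aefun) (T : aefun -> aefun) : Prop :=
  forall (a : C) x y, H x -> H y -> T (a *: x + y) = a *: T x + T y.

(* T is the extension by density of psdo F alpha, as a continuous linear map
   from Htilde gamma to Htilde (gamma - alpha) for all gamma >= alpha; these
   domains are all included in Htilde alpha, where T is thus determined, and
   the values of T outside of Htilde alpha are irrelevant. *)
Record is_extension (F : V -> V -> K) (alpha : R) (T : aefun -> aefun) : Prop := {
  ext_psdo : forall phi, Phi phi -> T (aeclass phi) = aeclass (psdo F alpha phi);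
  ext_linear : linear_on (Htilde alpha) T;
  ext_bounded : forall gamma, alpha <= gamma ->
    (forall x, Htilde gamma x -> Htilde (gamma - alpha) (T x)) /\
    exists B : R, forall x, Htilde gamma x ->
      Hnorm (gamma - alpha) (T x) <= B * Hnorm gamma x }.

(* continuity on Htilde_oo for the locally convex topology defined by the norms
   Hnorm beta, beta in nat *)
Definition continuous_on_Htilde_oo (T : aefun -> aefun) : Prop :=
  forall x, Htilde_oo x -> forall (beta : nat) (e : R), 0 < e ->
    exists (J : seq nat) (r : R), 0 < r /\
      forall y, Htilde_oo y -> (forall j, j \in J -> Hnorm j%:R (y - x) < r) ->
        Hnorm beta%:R (T y - T x) < e.

Definition bicontinuous_isomorphism (T : aefun -> aefun) : Prop :=
  [/\ forall x, Htilde_oo x -> Htilde_oo (T x),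
      linear_on Htilde_oo T,
      continuous_on_Htilde_oo T &
      exists S : aefun -> aefun,
        [/\ forall x, Htilde_oo x -> Htilde_oo (S x),
            forall x, Htilde_oo x -> S (T x) = x,
            forall x, Htilde_oo x -> T (S x) = x &
            continuous_on_Htilde_oo S]].

End Spaces.
End Analysis.

(* Main.v *)
Require Import Defs.
From mathcomp Require Import all_boot all_order all_algebra.
From mathcomp Require Import generic_quotient ring_quotient.
From mathcomp Require Import all_classical all_reals all_analysis measurable_realfun.
From mathcomp Require Import complex.
From mathcomp Require Import lra ring zify.
From mathcomp Require mpoly.
Set Implicit Arguments. Unset Strict Implicit. Unset Printing Implicit Defensive.
Import Order.TTheory GRing.Theory Num.Theory.
Import numFieldNormedType.Exports.
Local Open Scope classical_set_scope.
Local Open Scope ring_scope.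
Local Open Scope quotient_scope.

(* By the ultrametric inequality, |F(xi, x)| = |f(xi)| as soon as ||xi|| is large,
   because f dominates the terms of lower weighted degree: homogeneity reduces the
   bounds on |f| to a compact set on which f does not vanish. With such an M0, the
   operator is the Fourier multiplier |f|^alpha on functions whose Fourier transform
   lives in the region where |f| is comparable to Xi >= 1, so it maps Phi
   bijectively onto itself with inverse the multiplier |f|^(-alpha), and both are
   bounded up to a shift by alpha of the Sobolev index. Functions of Phi are locally
   constant with compact support, so that their Fourier theory is that of
   finite groups p^-N Z^n / p^N Z^n. The extension to the completions uses that
   the Sobolev norms are closable in L^2. *)

(** * The p-adic absolute value *)

(** An element of a completion is a class of L^2 functions, represented by many Sobolev-Cauchy
    sequences of [Phi]. The norm or the image of a class is computed along one sequence, so it is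
    well defined only if two sequences with the same L^2 limit are asymptotic for the Sobolev norm
    as well. This is what closability provides, and it is the obstacle that shapes the passage to
    the completions. The conclusion concerns every extension [T]. One extension is built from the
    multiplier, and any other one agrees with it on the domain of index alpha by density. The
    inverse is the multiplier of exponent -alpha, so multipliers are treated for an exponent s of
    either sign, from index gamma to index gamma - s, both nonnegative. The topology uses natural
    indices whereas alpha is real, hence indices are rounded up. In the bounds on |f|, the compact
    set is a fundamental region for the scalings of xi_i by p^(j w_i): there |f| lies between p^-N
    and 1, and the number j of scalings needed to reach it measures both |f| and [Xi]. *)

Section PadicAbs.
Variables (p : nat) (p_pr : prime p).
Local Notation K := (Qp p_pr).
Local Notation pabs := (@pabs p p_pr).
Implicit Types (x y z : K) (q r : rat).

(** [pabs] reads the value off some representative with eventually constant absolute value. Another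
    such representative gives the same value: were it larger, the null difference would eventually
    be smaller than it, and the ultrametric equality case would make the two values agree. *)
Lemma pabs_eventually (s : cauchy_seq p) r :
  (exists N, forall i, (N <= i)%N -> rat_pabs p (val s i) = r) ->
  pabs (\pi_K s) = r.
Proof.
move=> [N sN]; have r0 : 0 <= r by rewrite -(sN N) // rat_pabs_ge0.
apply/eqP; rewrite eq_le pabs_le //=; last by exists N => i /sN ->.
rewrite leNgt; apply/negP => ltr.
have [t /eqP] := pabs_pi (\pi_K s); rewrite pi_eq => /asboolP st [M tM].
have [L stL] := st _ (le_lt_trans (pabs_ge0 _) ltr).
pose i := maxn N (maxn M L).
have Ni : (N <= i)%N by rewrite leq_maxl.
have Mi : (M <= i)%N by rewrite /i maxnCA leq_maxl.
have Li : (L <= i)%N by rewrite /i maxnA leq_maxr.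
have /(rat_pabs_eq p_pr) : rat_pabs p (val s i - val t i) < rat_pabs p (val s i).
  by rewrite sN // rat_pabs_dist //; exact: stL.
by rewrite sN // tM // => E; rewrite E ltxx in ltr.
Qed.

Lemma pabsM x y : pabs (x * y) = pabs x * pabs y.
Proof.
have [[s sx [N sN]] [t tx [M tM]]] := (pabs_pi x, pabs_pi y).
rewrite -{1}sx -{1}tx -rmorphM; apply: pabs_eventually.
exists (maxn N M) => i; rewrite geq_max => /andP[Ni Mi].
by rewrite -[val _ i]/(val s i * val t i) rat_pabsM // sN // tM.
Qed.

Lemma rat_cauchy_cst q : rat_cauchy p (fun=> q).
Proof. by apply/asboolP => e e0; exists 0%N => i j _ _; rewrite subrr rat_pabs0. Qed.

Definition cst_seq q : cauchy_seq p := exist (fun u : nat -> rat =>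
  is_true (rat_cauchy p u)) _ (rat_cauchy_cst q).

Lemma pi_cst_nat (k : nat) : \pi_K (cst_seq k%:R) = k%:R :> K.
Proof.
elim: k => [|k IH].
  by rewrite -[0%:R in RHS](rmorph0 \pi_K); congr (\pi_K _); apply/val_inj.
rewrite -[in RHS]addn1 natrD -IH -(rmorph1 \pi_K) -rmorphD; congr (\pi_K _).
by apply/val_inj/funext => i; rewrite -addn1 natrD.
Qed.

Lemma pi_cstM q r : \pi_K (cst_seq (q * r)) = \pi_K (cst_seq q) * \pi_K (cst_seq r) :> K.
Proof. by rewrite -rmorphM; congr (\pi_K _); apply/val_inj. Qed.

Lemma pi_cstN q : \pi_K (cst_seq (- q)) = - \pi_K (cst_seq q) :> K.
Proof. by rewrite -rmorphN; congr (\pi_K _); apply/val_inj. Qed.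

Lemma pabs_cst q : pabs (\pi_K (cst_seq q)) = rat_pabs p q.
Proof. by apply: pabs_eventually; exists 0%N. Qed.

(** Constant sequences transport the arithmetic and the absolute value of the rationals to Q_p. This
    identifies them with [ratr], the form in which rationals occur in [frac_part]. *)
Lemma pi_cst q : \pi_K (cst_seq q) = ratr q :> K.
Proof.
have intE (m : int) : \pi_K (cst_seq m%:~R) = m%:~R :> K.
  by case: m => k; rewrite ?NegzE ?rmorphN /= ?pi_cstN pi_cst_nat.
have dq0 : (denq q)%:~R != 0 :> K.
  rewrite -intE; apply/eqP => /(congr1 pabs); rewrite pabs0 pabs_cst => /eqP.
  by rewrite gt_eqF // rat_pabs_gt0 // intr_eq0 denq_neq0.
rewrite /ratr; apply: (mulIf dq0); rewrite divfK // -!intE -pi_cstM.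
by rewrite numqE.
Qed.

Lemma pabs_ratr q : pabs (ratr q) = rat_pabs p q.
Proof. by rewrite -pi_cst pabs_cst. Qed.

Lemma Qp_dense x (e : rat) : 0 < e -> exists q, pabs (x - ratr q) < e.
Proof.
move=> e0; pose s := repr x; have e2 : 0 < e / 2 by rewrite divr_gt0.
have [N sN] := asboolP _ (valP s) (e / 2) e2; exists (val s N).
rewrite -[x]reprK -/s -pi_cst -rmorphB; apply: (@le_lt_trans _ _ (e / 2)); last lra.
apply: pabs_le; first exact: ltW.
by exists N => i Ni; rewrite -[val _ i]/(val s i - val s N) ltW // sN.
Qed.

Lemma pabs1 : pabs 1 = 1.
Proof. by rewrite -[1 in LHS](@pi_cst_nat 1) pabs_cst rat_pabs1. Qed.

Lemma pabs_gt0 x : (0 < pabs x) = (x != 0).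
Proof.
rewrite lt_def pabs_ge0 andbT; congr (~~ _).
by apply/eqP/eqP => [/pabs_eq0//|->]; rewrite pabs0.
Qed.

Lemma pabsV x : pabs x^-1 = (pabs x)^-1.
Proof.
have [->|x0] := eqVneq x 0; first by rewrite !(invr0, pabs0).
have px : pabs x != 0 by rewrite gt_eqF // pabs_gt0.
by apply: (mulfI px); rewrite -pabsM !divff // pabs1.
Qed.

Lemma pabsX x k : pabs (x ^+ k) = pabs x ^+ k.
Proof. by elim: k => [|k IH]; rewrite ?expr0 ?pabs1 // !exprS pabsM IH. Qed.

Lemma pabs_dist x y : pabs (x - y) = pabs (y - x).
Proof. by rewrite -pabsN opprB. Qed.

Lemma pabsD_le x y r : pabs x <= r -> pabs y <= r -> pabs (x + y) <= r.
Proof. by move=> xr yr; apply: le_trans (pabsD _ _) _; rewrite ge_max xr yr. Qed.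

Lemma pabsB_le x y r : pabs x <= r -> pabs y <= r -> pabs (x - y) <= r.
Proof. by move=> xr yr; apply: pabsD_le; rewrite ?pabsN. Qed.

Lemma pabsD_eq x y : pabs y < pabs x -> pabs (x + y) = pabs x.
Proof.
move=> yx; apply/eqP; rewrite eq_le (pabsD_le (lexx _) (ltW yx)) /= leNgt.
apply/negP => xyx.
have := pabsD (x + y) (- y); rewrite addrK pabsN le_max => /orP[] /le_lt_trans;
  by [move=> /(_ _ xyx); rewrite ltxx | move=> /(_ _ yx); rewrite ltxx].
Qed.

Lemma pabsDB_le x y a b r : pabs (x - a) <= r -> pabs (y - b) <= r ->
  pabs (x + y - (a + b)) <= r.
Proof. by rewrite opprD addrACA; exact: pabsD_le. Qed.

Lemma pabs_sum_le (I : Type) (r : seq I) (P : pred I) (F : I -> K) b : 0 <= b ->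
  (forall i, P i -> pabs (F i) <= b) -> pabs (\sum_(i <- r | P i) F i) <= b.
Proof.
move=> b0 Fb; elim/big_ind : _ => [|y z|i /Fb//]; first by rewrite pabs0.
exact: pabsD_le.
Qed.

Lemma pabs_prod (I : Type) (r : seq I) (P : pred I) (F : I -> K) :
  pabs (\prod_(i <- r | P i) F i) = \prod_(i <- r | P i) pabs (F i).
Proof. by elim/big_rec2 : _ => [|i y z _ <-]; rewrite ?pabs1 // pabsM. Qed.

Lemma pQ_gt0 : 0 < p%:Q. Proof. by rewrite ltr0n prime_gt0. Qed.
Lemma pQ_gt1 : 1 < p%:Q. Proof. by rewrite ltr1n prime_gt1. Qed.

Lemma pabs_natp : pabs p%:R = p%:Q^-1.
Proof.
rewrite -(pi_cst_nat p) pabs_cst /rat_pabs pnatr_eq0 gtn_eqF ?prime_gt0 //.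
by rewrite -[p%:R]/((p%:Z)%:~R) numq_int denq_int /= logn1 logn_prime // eqxx.
Qed.

Lemma natp_neq0 : p%:R != 0 :> K.
Proof. by rewrite -pabs_gt0 pabs_natp invr_gt0 pQ_gt0. Qed.

Lemma pabs_nat_le1 (k : nat) : pabs k%:R <= 1.
Proof. by elim: k => [|k IH]; rewrite ?pabs0 // -addn1 natrD pabsD_le // pabs1. Qed.

Lemma pabs_int_le1 (k : int) : pabs k%:~R <= 1.
Proof. by case: k => k; rewrite ?NegzE ?rmorphN /= ?pabsN pabs_nat_le1. Qed.

Lemma pabs_expz x : x != 0 -> exists m : int, pabs x = p%:Q ^ m.
Proof.
move=> x0; have [s _ [N /(_ _ (leqnn N)) sN]] := pabs_pi x.
move: sN; rewrite /rat_pabs; case: eqP => [_ E|_ <-]; last by eexists.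
by move: x0; rewrite -pabs_gt0 -E ltxx.
Qed.

(* The value group is discrete. *)
Lemma pabs_lt_le x (m : int) : p%:Q ^ m < pabs x -> p%:Q ^ (m + 1) <= pabs x.
Proof.
move=> mx; have x0 : x != 0 by rewrite -pabs_gt0 (lt_trans _ mx) // exprz_gt0 // pQ_gt0.
move: mx; have [k ->] := pabs_expz x0.
by rewrite ltr_eXz2l ?pQ_gt1 // ler_eXz2l ?pQ_gt1 // lezD1.
Qed.

Lemma pabs_nat_dvd (k a : nat) : (pabs a%:R <= p%:Q ^- k) = (p ^ k %| a)%N.
Proof.
have [->|a0] := eqVneq a 0%N.
  by rewrite pabs0 dvdn0 invr_ge0 exprn_ge0 // ltW // pQ_gt0.
rewrite -(pi_cst_nat a) pabs_cst /rat_pabs pnatr_eq0 (negPf a0).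
rewrite -[a%:R]/((a%:Z)%:~R) numq_int denq_int /= logn1 sub0r.
by rewrite exprnN ler_eXz2l ?pQ_gt1 // lerN2 lez_nat pfactor_dvdn // lt0n.
Qed.

Lemma pabs_natB_le (k a b : nat) : (a < p ^ k)%N -> (b < p ^ k)%N ->
  pabs (a%:R - b%:R) <= p%:Q ^- k -> a = b.
Proof.
wlog : a b / (b <= a)%N => [H ak bk|].
  have /orP[ba|ab] := leq_total b a; first exact: H.
  by rewrite pabs_dist => ?; apply/esym/H.
move=> ba ak _; rewrite -natrB // pabs_nat_dvd => dv; apply/eqP.
rewrite eqn_leq ba andbT -subn_eq0 -leqn0 leqNgt; apply/negP => h.
have := dvdn_leq h dv; lia.
Qed.

(** A rational q close to x satisfies |q| <= 1, so its denominator is prime to p. A Bezout relation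
    inverts the denominator modulo p^k, and a is the remainder modulo p^k of the numerator times
    this inverse. *)
Lemma Zp_approx x (k : nat) : pabs x <= 1 ->
  exists a : 'I_(p ^ k), pabs (x - a%:R) <= p%:Q ^- k.
Proof.
move=> x1; have pk0 : 0 < p%:Q ^- k by rewrite invr_gt0 exprn_gt0 // pQ_gt0.
have pk1 : p%:Q ^- k <= 1 by rewrite invf_le1 ?exprn_gt0 ?exprn_ege1 ?pQ_gt0 // ltW // pQ_gt1.
have [q xq] := Qp_dense x pk0.
have q1 : pabs (ratr q) <= 1.
  by rewrite -[ratr q](subKr x) pabsB_le // (le_trans (ltW xq)).
have pp : (0 < p ^ k)%N by rewrite expn_gt0 prime_gt0.
have qd : ~~ (p %| `|denq q|)%N.
  apply/negP => pq; move: q1; rewrite pabs_ratr /rat_pabs.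
  case: eqP => [q0|_]; first by move: pq; rewrite q0 /= dvdn1 => /eqP p1; move: p_pr; rewrite p1.
  rewrite leNgt => /negP; apply; rewrite -(expr0z p%:Q) ltr_eXz2l ?pQ_gt1 //.
  rewrite subr_gt0 ltz_nat.
  have -> : logn p `|numq q| = 0%N.
    apply: logn_coprime; rewrite prime_coprime //; apply/negP => pn.
    have : (p %| gcdn `|numq q| `|denq q|)%N by rewrite dvdn_gcd pn pq.
    have /eqP -> := coprime_num_den q.
    by rewrite dvdn1 => /eqP p1; move: p_pr; rewrite p1.
  by rewrite logn_gt0 mem_primes p_pr pq andbT absz_gt0 denq_neq0.
have pkd : coprime (p ^ k)%N `|denq q| by rewrite coprimeXl // prime_coprime.
have [u [v uv]] := Bezoutz (p ^ k)%N%:Z (denq q).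
move: uv; rewrite /gcdz /= (eqP pkd) => uv.
pose a := (numq q * v %% (p ^ k)%N%:Z)%Z.
have pkz : (p ^ k)%N%:Z != 0 by rewrite eqz_nat -lt0n.
have a0 : 0 <= a by rewrite modz_ge0.
have ap : (`|a| < p ^ k)%N by rewrite -ltz_nat gez0_abs // ltz_pmod // ltz_nat.
exists (Ordinal ap) => /=.
rewrite -[x](subrK (ratr q)) -addrA pabsD_le ?(ltW xq) //.
have -> : (`|a|%N)%:R = a%:~R :> K by rewrite -[in RHS](gez0_abs a0).
pose m := (numq q * v %/ (p ^ k)%N%:Z)%Z.
have am : a = numq q * v - m * (p ^ k)%N%:Z.
  by rewrite [X in _ = X - _](divz_eq _ (p ^ k)%N%:Z) addrC addrA addNr add0r.
have dq1 : pabs (denq q)%:~R = 1.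
  have -> : (denq q)%:~R = (`|denq q|%N)%:R :> K.
    by rewrite -[in LHS](gez0_abs (denq_ge0 q)).
  apply/eqP; rewrite eq_le pabs_nat_le1 /= leNgt; apply/negP => d1.
  have d0 : (`|denq q|%N)%:R != 0 :> K.
    rewrite -pabs_gt0 -(pi_cst_nat _) pabs_cst rat_pabs_gt0 // pnatr_eq0.
    by rewrite -lt0n absz_gt0 denq_neq0.
  move: d1; have [e de] := pabs_expz d0; rewrite de -(expr0z p%:Q) ltr_eXz2l ?pQ_gt1 // => e1.
  have : pabs (`|denq q|%N)%:R <= p%:Q ^- 1.
    by rewrite de exprnN ler_eXz2l ?pQ_gt1 //; lia.
  by rewrite pabs_nat_dvd expn1 (negPf qd).
have dq0 : (denq q)%:~R != 0 :> K by rewrite -pabs_gt0 dq1.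
(* Once multiplied by the denominator, which is a p-adic unit, the error is a multiple of p^k by the
   Bezout relation. *)
have key : (ratr q - a%:~R) * (denq q)%:~R = (p ^ k)%N%:R * (numq q * u + m * denq q)%:~R :> K.
  rewrite mulrBl /ratr divfK // -intrM -intrB -[(p ^ k)%N%:R]/(((p ^ k)%N%:Z)%:~R) -intrM.
  congr (_%:~R); rewrite am.
  transitivity (numq q * (u * (p ^ k)%N%:Z + v * denq q) - (numq q * v - m * (p ^ k)%N%:Z) *
    denq q).
    by rewrite uv mulr1.
  ring.
have -> : pabs (ratr q - a%:~R) = pabs (p ^ k)%:R * pabs (numq q * u + m * denq q)%:~R.
  by rewrite -pabsM -key pabsM dq1 mulr1.
rewrite -[leRHS]mulr1; apply: ler_pM; rewrite ?pabs_ge0 ?pabs_int_le1 //.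
by rewrite pabs_nat_dvd.
Qed.

(** * Limits and compactness in Q_p *)

Lemma ratrB_Qp q r : ratr (q - r) = ratr q - ratr r :> K.
Proof. by rewrite -!pi_cst -rmorphB; congr (\pi_K _); apply/val_inj. Qed.

Lemma pexp_large (e : rat) : exists k, e < p%:Q ^+ k.
Proof.
have [k ke] : exists k : nat, e < k%:R.
  by exists (Num.bound `|e|); apply: le_lt_trans (ler_norm _) (archi_boundP (normr_ge0 e)).
exists k; apply: lt_le_trans ke _; rewrite -natrX ler_nat.
by apply: ltnW; rewrite ltn_expl // prime_gt1.
Qed.

Lemma pexp_small (e : rat) : 0 < e -> exists k, p%:Q ^- k < e.
Proof.
move=> e0; have [k ke] := pexp_large e^-1.
by exists k; rewrite -[e]invrK ltf_pV2 ?posrE ?exprn_gt0 ?pQ_gt0 ?invr_gt0.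
Qed.

(** Completeness by a diagonal argument: the rationals s_i, within p^-i of u_i, form a Cauchy
    sequence, and its class is the limit. *)
Lemma Qp_cauchy_lim (u : nat -> K) :
  (forall k i j, (k <= i)%N -> (k <= j)%N -> pabs (u i - u j) <= p%:Q ^- k) ->
  exists l, forall k, pabs (u k - l) <= p%:Q ^- k.
Proof.
move=> uc; have pk0 k : 0 < p%:Q ^- k by rewrite invr_gt0 exprn_gt0 // pQ_gt0.
pose s i := sval (cid (Qp_dense (u i) (pk0 i))).
have us i : pabs (u i - ratr (s i)) < p%:Q ^- i by exact: (svalP (cid (Qp_dense (u i) (pk0 i)))).
have pmono k i : (k <= i)%N -> p%:Q ^- i <= p%:Q ^- k.
  by move=> ki; rewrite lef_pV2 ?posrE ?exprn_gt0 ?pQ_gt0 // ler_weXn2l // ltW // pQ_gt1.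
have sc k i j : (k <= i)%N -> (k <= j)%N -> rat_pabs p (s i - s j) <= p%:Q ^- k.
  move=> ki kj; rewrite -pabs_ratr ratrB_Qp.
  have key (a b c e : K) : a - b = (c - e) + (e - b) - (c - a) by ring.
  rewrite (key _ _ (u i) (u j)).
  apply: pabsB_le; first apply: pabsD_le; first exact: uc.
    by rewrite (le_trans (ltW (us _))) // pmono.
  by rewrite (le_trans (ltW (us _))) // pmono.
have cs : rat_cauchy p s.
  apply/asboolP => e /pexp_small[k ke]; exists k => i j ki kj.
  exact: le_lt_trans (sc _ _ _ ki kj) ke.
pose t : cauchy_seq p := exist (fun y : nat -> rat => is_true (rat_cauchy p y)) _ cs.
exists (\pi_K t) => k; rewrite -[u k](subrK (ratr (s k))) -addrA.
apply: pabsD_le; first exact: ltW.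
rewrite -pi_cst -rmorphB; apply: pabs_le; first exact: ltW.
by exists k => i ki; rewrite -[val _ i]/(s k - s i) sc.
Qed.

Lemma ball_approx (c x : K) (k : nat) : pabs x <= pabs c ->
  exists a : 'I_(p ^ k), pabs (x - c * a%:R) <= pabs c * p%:Q ^- k.
Proof.
have [->|c0] := eqVneq c 0.
  rewrite pabs0 => x0; have pp : (0 < p ^ k)%N by rewrite expn_gt0 prime_gt0.
  by exists (Ordinal pp); rewrite !mul0r subr0.
move=> xc; have [|a xa] := @Zp_approx (c^-1 * x) k.
  by rewrite pabsM pabsV mulrC ler_pdivrMr ?pabs_gt0 // mul1r.
exists a; have -> : x - c * a%:R = c * (c^-1 * x - a%:R) by rewrite mulrBr mulVKf.
by rewrite pabsM ler_pM2l // pabs_gt0.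
Qed.

Lemma pexpV_le (k i : nat) : (k <= i)%N -> p%:Q ^- i <= p%:Q ^- k.
Proof.
by move=> ki; rewrite lef_pV2 ?posrE ?exprn_gt0 ?pQ_gt0 // ler_weXn2l // ltW // pQ_gt1.
Qed.

Lemma nbhs_Qp x (P : set K) :
  nbhs x P <-> exists k, forall h, pabs h <= p%:Q ^- k -> P (x + h).
Proof.
split=> [/nbhs_ballP[e /= /pexp_small[k ke] eP]|[k kP]].
  exists k => h hk; apply: eP; rewrite ballEmdist /= /mdist /= /Qp_dist.
  by rewrite opprD addNKr pabsN (le_lt_trans hk).
apply/nbhs_ballP; exists (p%:Q ^- k) => /=; first by rewrite invr_gt0 exprn_gt0 // pQ_gt0.
move=> y; rewrite ballEmdist /= /mdist /= /Qp_dist => xy.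
by rewrite -[y](subrKC x); apply: kP; rewrite pabs_dist ltW.
Qed.

(** The ball is covered by p^(N + i) balls of radius p^-i, one of which belongs to the given
    ultrafilter. The centres chosen for the successive i form a Cauchy sequence, to whose limit the
    ultrafilter converges. *)
Lemma Qp_ball_compact (N : nat) : compact [set x : K | pabs x <= p%:Q ^+ N].
Proof.
rewrite compact_ultra => F FU FB.
pose c : K := p%:R ^- N.
have cN : pabs c = p%:Q ^+ N by rewrite pabsV pabsX pabs_natp exprVn invrK.
have pk i : exists y, F [set x | pabs (x - y) <= p%:Q ^- i].
  apply: contrapT => /forallNP nF.
  have : \forall x \near F, forall a : 'I_(p ^ (N + i)), ~ pabs (x - c * a%:R) <= p%:Q ^- i.
    apply: filter_forall => a; have := nF (c * a%:R).
    by have [] := in_ultra_setVsetC [set x | pabs (x - c * a%:R) <= p%:Q ^- i] FU.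
  move=> /(filterI FB) /filter_ex[x [/=]]; rewrite -cN => /(@ball_approx _ _ (N + i)).
  move=> [a xa] /(_ a); apply; apply: le_trans xa _; rewrite cN exprD invfM mulrA.
  by rewrite divff ?mul1r // expf_neq0 // gt_eqF // pQ_gt0.
pose y i := sval (cid (pk i)).
have Fy i : F [set x | pabs (x - y i) <= p%:Q ^- i] := svalP (cid (pk i)).
have yc k i j : (k <= i)%N -> (k <= j)%N -> pabs (y i - y j) <= p%:Q ^- k.
  move=> ki kj; have /filter_ex[x [/= xi xj]] : F ([set x | pabs (x - y i) <= p%:Q ^- i] `&`
    [set x | pabs (x - y j) <= p%:Q ^- j]).
    exact: filterI.
  have -> : y i - y j = (x - y j) - (x - y i) by ring.
  by apply: pabsB_le; [apply: le_trans xj _|apply: le_trans xi _]; exact: pexpV_le.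
have [l yl] := Qp_cauchy_lim yc.
have Fl k : F [set x | pabs (x - l) <= p%:Q ^- k].
  apply: filterS (Fy k) => x /= xy; rewrite -[x](subrK (y k)) -addrA.
  exact: pabsD_le.
exists l; split => /=.
  have /filter_ex[x [/= xN xl]] : F ([set x | pabs x <= p%:Q ^+ N] `&` [set x | pabs (x - l) <=
    p%:Q ^- 0]).
    exact: filterI.
  rewrite -[l](subKr x); apply: pabsB_le => //; apply: le_trans xl _.
  by rewrite expr0 invr1 exprn_ege1 // ltW // pQ_gt1.
move=> P /nbhs_Qp[k kP]; apply: filterS (Fl k) => x xk.
by rewrite -[x](subrKC l); exact: kP.
Qed.

End PadicAbs.

(** * The additive character *)

Section Character.
Variables (R : realType) (p : nat) (p_pr : prime p).
Local Notation K := (Qp p_pr).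
Local Notation pabs := (@pabs p p_pr).
Local Notation C := R[i].
Implicit Types (x y z : K) (q r : rat).

Lemma pabs_bound x : exists N, pabs x <= p%:Q ^+ N.
Proof. by have [N xN] := pexp_large p_pr (pabs x); exists N; apply: ltW. Qed.

(** Membership in Z[1/p], in the form used by [frac_part]. *)
Definition pfrac q := exists m, q * p%:Q ^+ m \is a Num.int.

Lemma pfracB q r : pfrac q -> pfrac r -> pfrac (q - r).
Proof.
move=> [m qm] [k rk]; exists (m + k)%N.
have -> : (q - r) * p%:Q ^+ (m + k) = (q * p%:Q ^+ m) * p%:Q ^+ k - (r * p%:Q ^+ k) * p%:Q ^+ m.
  by rewrite exprD; ring.
by rewrite rpredB // rpredM // rpredX // intr_int.
Qed.

Lemma pfracD q r : pfrac q -> pfrac r -> pfrac (q + r).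
Proof.
move=> dq dr; rewrite -[r]opprK; apply: pfracB => //; rewrite -sub0r.
by apply: pfracB => //; exists 0%N; rewrite mul0r; exact: rpred0.
Qed.

Lemma ratrD_Qp q r : ratr (q + r) = ratr q + ratr r :> K.
Proof. by rewrite -!pi_cst -rmorphD; congr (\pi_K _); apply/val_inj. Qed.

(** If z = q p^m is an integer and |q| <= 1, then |z| <= p^-m, which says that p^m divides z. *)
Lemma pfrac_int q : pfrac q -> pabs (ratr q) <= 1 -> q \is a Num.int.
Proof.
move=> [m /intrP[z qz]] q1.
have pm0 : p%:Q ^+ m != 0 by rewrite expf_neq0 // gt_eqF // pQ_gt0.
have : pabs (`|z|%N)%:R <= p%:Q ^- m.
  have -> : pabs (`|z|%N)%:R = pabs (ratr (q * p%:Q ^+ m)).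
    rewrite qz ratr_int; case: (ltrP z 0) => z0; last by rewrite -[in RHS](gez0_abs z0).
    by rewrite -[in RHS](opprK z) -[- z]gtz0_abs ?oppr_gt0 // abszN rmorphN /= pabsN.
  rewrite -pi_cst pi_cstM pabsM !pi_cst -[leRHS]mul1r.
  apply: ler_pM; rewrite ?pabs_ge0 //.
  have -> : ratr (p%:Q ^+ m) = (p ^ m)%:R :> K by rewrite -natrX ratr_nat.
  by rewrite pabs_nat_dvd.
rewrite pabs_nat_dvd => dz.
have /dvdzP[y zy] : ((p ^ m)%N%:Z %| z)%Z by rewrite dvdzE.
apply/intrP; exists y; apply: (mulIf pm0); rewrite qz zy intrM; congr (_ * _).
by rewrite -[p%:Q ^+ m]natrX.
Qed.

(** The witness is a / p^N with a < p^N, hence in [0, 1): it comes from approximating x, in the ball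
    of radius p^N, to within 1. *)
Lemma frac_partP x : [/\ 0 <= frac_part x < 1, pfrac (frac_part x) &
  pabs (x - ratr (frac_part x)) <= 1].
Proof.
have [N xN] := pabs_bound x; pose c : K := p%:R ^- N.
have cN : pabs c = p%:Q ^+ N by rewrite pabsV pabsX pabs_natp exprVn invrK.
have [|a] := @ball_approx _ p_pr c x N; first by rewrite cN.
have pN0 : 0 < p%:Q ^+ N by rewrite exprn_gt0 // pQ_gt0.
rewrite cN divff ?gt_eqF // => xa.
rewrite /frac_part; case: xgetP => [q -> []|/(_ (a%:R / p%:Q ^+ N)) []].
  by split.
split.
- by rewrite divr_ge0 ?ler0n ?ltW //= ltr_pdivrMr // mul1r -natrX ltr_nat.
- by exists N; rewrite divfK ?gt_eqF // -[a%:R]/((a%:Z)%:~R) intr_int.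
- apply: le_trans xa; rewrite -pi_cst pi_cstM pi_cst_nat mulrC.
  suff -> : \pi_K (cst_seq p (p%:Q ^- N)) = c by [].
  apply: (mulIf (expf_neq0 N (natp_neq0 p_pr))).
  rewrite mulVf ?expf_neq0 ?natp_neq0 //.
  have <- : \pi_K (cst_seq p (p ^ N)%:R) = p%:R ^+ N by rewrite pi_cst_nat natrX.
  rewrite -pi_cstM natrX mulVf ?gt_eqF //; exact: (pi_cst_nat _ 1).
Qed.

Definition cis (t : R) : C := Complex (cos (2 * pi * t)) (sin (2 * pi * t)).

Lemma cisD s t : cis (s + t) = cis s * cis t.
Proof.
by apply/eqP; rewrite eq_complex /= mulrDr cosD sinD eqxx /=; apply/eqP; ring.
Qed.

Lemma cis0 : cis 0 = 1.
Proof. by rewrite /cis mulr0 cos0 sin0. Qed.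

Lemma cis1 : cis 1 = 1.
Proof. by rewrite /cis mulr1 -[2 * pi]mulrC mulr_natr cos2pi sin2pi. Qed.

Lemma cisN t : cis t * cis (- t) = 1.
Proof. by rewrite -cisD subrr cis0. Qed.

Lemma cis_int (z : int) : cis z%:~R = 1.
Proof.
have nat1 (k : nat) : cis k%:R = 1.
  by elim: k => [|k IH]; rewrite ?cis0 // -addn1 natrD cisD IH cis1 mul1r.
by case: z => k; rewrite ?NegzE ?nat1 // rmorphN /= -[LHS]mul1r -(nat1 k.+1) cisN nat1.
Qed.

(** The duplication formula turns cos (2 pi t) = 1 into sin (pi t) = 0, whereas sin is positive
    strictly between 0 and pi. *)
Lemma cis_eq1 t : 0 <= t < 1 -> cis t = 1 -> t = 0.
Proof.
move=> /andP[t0 t1] [ct _]; apply/eqP; rewrite eq_le t0 andbT leNgt; apply/negP => tp.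
have : 0 < sin (pi * t).
  by rewrite sin_gt0_pi // mulr_gt0 ?pi_gt0 // gtr_pMr ?pi_gt0.
have st : sin (pi * t) ^+ 2 = 0.
  have := cos_mulr2n (pi * t); rewrite -[in LHS]mulr_natl mulrA ct.
  have := cos2Dsin2 (pi * t); move=> /(congr1 (fun u => u - sin (pi * t) ^+ 2)).
  rewrite addrK => ->; lra.
by move/eqP: st; rewrite expf_eq0 /= => /eqP ->; rewrite ltxx.
Qed.

Local Notation Psi := (@add_char R p p_pr).

Lemma add_charE x : Psi x = cis (ratr (frac_part x)).
Proof. by []. Qed.

(** Any element of Z[1/p] congruent to x modulo Z_p can replace the fractional part, as the two
    differ by an integer. Additivity of the character needs this freedom, since the sum of two
    fractional parts may leave [0, 1). *)
Lemma add_char_frac x q : pfrac q -> pabs (x - ratr q) <= 1 -> Psi x = cis (ratr q).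
Proof.
move=> dq xq; rewrite add_charE; have [_ df xf] := frac_partP x.
have /intrP[z Ez] : q - frac_part x \is a Num.int.
  apply: pfrac_int; first exact: pfracB.
  rewrite ratrB_Qp.
  have -> : ratr q - ratr (frac_part x) = (x - ratr (frac_part x)) - (x - ratr q) by ring.
  exact: pabsB_le.
have -> : q = frac_part x + z%:~R by rewrite -Ez addrC subrK.
by rewrite rmorphD /= ratr_int cisD cis_int mulr1.
Qed.

Lemma add_charD x y : Psi (x + y) = Psi x * Psi y.
Proof.
have [_ dx fx] := frac_partP x; have [_ dy fy] := frac_partP y.
rewrite (@add_char_frac _ (frac_part x + frac_part y)).
- by rewrite rmorphD /= cisD.
- exact: pfracD.
- by move: (pabsDB_le fx fy); rewrite -ratrD_Qp.
Qed.

Lemma add_char1P x : Psi x = 1 <-> pabs x <= 1.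
Proof.
split=> [|x1].
  rewrite add_charE; have [f01 df xf] := frac_partP x => /cis_eq1.
  rewrite ler0q -[X in _ < X](rmorph1 (@ratr R)) ltr_rat => /(_ f01) /eqP;
    rewrite fmorph_eq0 => /eqP f0.
  by move: xf; rewrite f0 -pi_cst (pi_cst_nat _ 0) subr0.
rewrite (@add_char_frac _ 0) ?rmorph0 ?cis0 //; first by exists 0%N; rewrite mul0r; exact: rpred0.
by rewrite -pi_cst (pi_cst_nat _ 0) subr0.
Qed.

Lemma add_char0 : Psi 0 = 1.
Proof. by apply/add_char1P; rewrite pabs0. Qed.

Lemma add_charN x : Psi x * Psi (- x) = 1.
Proof. by rewrite -add_charD subrr add_char0. Qed.

Lemma conj_add_char x : (Psi x)^* = Psi (- x).
Proof.
have px0 : Psi x != 0.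
  by apply/eqP => x0; have := add_charN x; rewrite x0 mul0r => /eqP; rewrite eq_sym oner_eq0.
apply: (mulfI px0); rewrite add_charN add_charE /cis.
apply/eqP; rewrite eq_complex /=; apply/andP; split; apply/eqP.
  by rewrite mulrN opprK -!expr2 cos2Dsin2.
by rewrite mulrN mulrC addNr.
Qed.

End Character.

(** * Balls and functions of finite level *)

Section Levels.
Variables (p : nat) (p_pr : prime p) (n : nat).
Local Notation K := (Qp p_pr).
Local Notation V := 'rV[Qp p_pr]_n.
Local Notation pabs := (@pabs p p_pr).

Definition cball (r : rat) : set V := [set x | forall i, pabs (x 0 i) <= r].

Lemma cballD r x y : cball r x -> cball r y -> cball r (x + y).
Proof. by move=> xr yr i; rewrite mxE pabsD_le. Qed.

Lemma cballN r x : cball r x -> cball r (- x).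
Proof. by move=> xr i; rewrite mxE pabsN. Qed.

Lemma cballB r x y : cball r x -> cball r y -> cball r (x - y).
Proof. by move=> xr yr; apply: cballD => //; exact: cballN. Qed.

Lemma cballDr r x h : cball r h -> cball r (x + h) <-> cball r x.
Proof.
move=> hr; split => [xh|xr]; last exact: cballD.
by rewrite -[x](addrK h); exact: cballB.
Qed.

Lemma cball_mono r s : r <= s -> cball r `<=` cball s.
Proof. by move=> rs x xr i; apply: le_trans (xr i) rs. Qed.

Lemma pexp_le (k i : nat) : (k <= i)%N -> p%:Q ^+ k <= p%:Q ^+ i.
Proof. by move=> ki; rewrite ler_weXn2l // ltW // (pQ_gt1 p_pr). Qed.

Lemma pexpV_gt0 k : 0 < p%:Q ^- k.
Proof. by rewrite invr_gt0 exprn_gt0 // (pQ_gt0 p_pr). Qed.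

Lemma pexpV_le_pexp k i : p%:Q ^- k <= p%:Q ^+ i.
Proof.
apply: (@le_trans _ _ 1); last by rewrite exprn_ege1 // ltW // (pQ_gt1 p_pr).
by rewrite invf_le1 ?exprn_gt0 ?exprn_ege1 ?(pQ_gt0 p_pr) // ltW // (pQ_gt1 p_pr).
Qed.

Lemma nbhs_QpV (x : V) (P : set V) :
  nbhs x P <-> exists k, forall h, cball (p%:Q ^- k) h -> P (x + h).
Proof.
split=> [/nbhs_ballP[e /= /(pexp_small p_pr)[k ke] eP]|[k kP]].
  exists k => h hk; apply: eP; split => [|i j]; first exact: lt_trans (pexpV_gt0 k) ke.
  rewrite ballEmdist /= /mdist /= /Qp_dist mxE opprD addNKr pabsN.
  by rewrite (ord1 i); apply: le_lt_trans (hk j) ke.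
apply/nbhs_ballP; exists (p%:Q ^- k) => /=; first exact: pexpV_gt0.
move=> y [_ xy]; rewrite -[y](subrKC x); apply: kP => i; rewrite !mxE pabs_dist.
by move: (xy 0 i); rewrite ballEmdist /= /mdist /= /Qp_dist => /ltW.
Qed.

Lemma open_QpV (A : set V) :
  (forall x, A x -> exists k, forall h, cball (p%:Q ^- k) h -> A (x + h)) -> open A.
Proof. by move=> HA; rewrite openE => x /HA/nbhs_QpV. Qed.

Lemma cball_compact (N : nat) : compact (cball (p%:Q ^+ N)).
Proof.
have -> : cball (p%:Q ^+ N) = [set v : V | forall i,
  [set x : K | pabs x <= p%:Q ^+ N] (v ord0 i)].
  by apply/seteqP; split => x /= xN i; [have := xN i|have := xN i].
apply: (@rV_compact _ n (fun=> [set x : K | pabs x <= p%:Q ^+ N])) => i.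
exact: Qp_ball_compact.
Qed.

Lemma cball_bound (x : V) : exists N, cball (p%:Q ^+ N) x.
Proof.
have bx i : exists N, pabs (x 0 i) <= p%:Q ^+ N by exact: pabs_bound.
pose N i := sval (cid (bx i)).
have Nx i : pabs (x 0 i) <= p%:Q ^+ N i := svalP (cid (bx i)).
exists (\max_(i < n) N i) => i; apply: le_trans (Nx i) _.
by apply: pexp_le; exact: leq_bigmax.
Qed.

Lemma compact_cball (A : set V) : compact A -> exists N, A `<=` cball (p%:Q ^+ N).
Proof.
rewrite compact_near_coveringP => /(_ _ \oo (fun N => cball (p%:Q ^+ N))) H.
have [x Ax|N _ /(_ N (leqnn N))] := H _; last by exists N.
have [N xN] := cball_bound x.
exists ([set y | cball (p%:Q ^+ N) y], [set M | (N <= M)%N]) => /=.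
  split; last by exists N.
  apply/nbhs_QpV; exists 0%N => h h0 /=; apply: cballD => //.
  apply: cball_mono h0; exact: pexpV_le_pexp.
by move=> [y M] /= [yN NM]; apply: cball_mono yN; exact: pexp_le.
Qed.

(* The points of a system of representatives of a ball of radius |c| modulo the
   ball of radius |c| p^-k. *)
Definition gridpt (c : K) (k : nat) (a : {ffun 'I_n -> 'I_(p ^ k)}) : V :=
  \row_i (c * (a i)%:R).

Lemma gridpt_ball c k a : cball (pabs c) (@gridpt c k a).
Proof. by move=> i; rewrite mxE pabsM ler_piMr ?pabs_ge0 ?pabs_nat_le1. Qed.

Lemma gridpt_approx c k x : cball (pabs c) x ->
  exists a, cball (pabs c * p%:Q ^- k) (x - @gridpt c k a).
Proof.
move=> xc; have /boolp.choice[a xa] : forall i, exists a : 'I_(p ^ k),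
    pabs (x 0 i - c * a%:R) <= pabs c * p%:Q ^- k.
  by move=> i; exact: ball_approx.
by exists [ffun i => a i] => i; rewrite !mxE ffunE.
Qed.

Lemma gridpt_inj c k a b : c != 0 ->
  cball (pabs c * p%:Q ^- k) (@gridpt c k a - @gridpt c k b) -> a = b.
Proof.
move=> c0 ab; apply/ffunP => i; apply/val_inj.
apply: (@pabs_natB_le _ p_pr k); [exact: ltn_ord|exact: ltn_ord|].
have cp : 0 < pabs c by rewrite pabs_gt0.
by have := ab i; rewrite !mxE -mulrBr pabsM (ler_pM2l cp).
Qed.

(** The functions on the finite group p^-N Z_p^n / p^N Z_p^n. One N bounds both the support and the
    scale of constancy, so that the Fourier transform preserves the level. *)
Definition level (T : nmodType) N (g : V -> T) :=
  (forall x, ~ cball (p%:Q ^+ N) x -> g x = 0) /\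
  (forall x h, cball (p%:Q ^- N) h -> g (x + h) = g x).

Lemma level_mono (T : nmodType) N M (g : V -> T) : (N <= M)%N -> level N g -> level M g.
Proof.
move=> NM [gN hN]; split=> [x xM|x h hM].
  by apply: gN => xN; apply: xM; apply: cball_mono xN; exact: pexp_le.
by apply: hN; apply: cball_mono hM; exact: pexpV_le.
Qed.

(** The scalar p^-N, named after its absolute value p^N. *)
Definition pN N : K := p%:R ^- N.

Lemma pabs_pN N : pabs (pN N) = p%:Q ^+ N.
Proof. by rewrite pabsV pabsX pabs_natp exprVn invrK. Qed.

Lemma pN_neq0 N : pN N != 0.
Proof. by rewrite invr_eq0 expf_neq0 // natp_neq0. Qed.

(** Representatives of the ball of radius p^N modulo the ball of radius p^-N: 2N base-p digits per
    coordinate. *)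
Definition grid N (a : {ffun 'I_n -> 'I_(p ^ (N + N))}) : V := gridpt (pN N) a.

Lemma grid_radius N : pabs (pN N) * p%:Q ^- (N + N) = p%:Q ^- N.
Proof.
by rewrite pabs_pN exprD invfM mulrA divff ?mul1r // expf_neq0 // gt_eqF // (pQ_gt0 p_pr).
Qed.

Lemma grid_ball N a : cball (p%:Q ^+ N) (@grid N a).
Proof. by have := @gridpt_ball (pN N) _ a; rewrite pabs_pN. Qed.

Lemma grid_approx N x : cball (p%:Q ^+ N) x -> exists a, cball (p%:Q ^- N) (x - @grid N a).
Proof.
move=> xN; have xN' : cball (pabs (pN N)) x by rewrite pabs_pN.
by have [a] := gridpt_approx (N + N) xN'; rewrite grid_radius => xa; exists a.
Qed.

Lemma grid_inj N a b : cball (p%:Q ^- N) (@grid N a - grid b) -> a = b.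
Proof. by rewrite -grid_radius; apply: gridpt_inj; exact: pN_neq0. Qed.

(** A translated grid point need not be a grid point, but it is in the class of exactly one, and g
    depends only on classes. Distinct points go to distinct classes, so translation permutes the
    terms. *)
Lemma level_sum_shift (T : nmodType) N (g : V -> T) h : level N g -> cball (p%:Q ^+ N) h ->
  \sum_a g (@grid N a + h) = \sum_a g (@grid N a).
Proof.
move=> [_ gN] hN.
have /boolp.choice[s sP] : forall a, exists b, cball (p%:Q ^- N) (@grid N a + h - @grid N b).
  by move=> a; apply: grid_approx; apply: cballD => //; exact: grid_ball.
have s_inj : injective s.
  move=> a b sab; apply: (@grid_inj N).
  have -> : grid a - grid b = (grid a + h - grid (s a)) - (grid b + h - grid (s b)).
    by rewrite sab; apply/matrixP => i j; rewrite !mxE; ring.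
  exact: cballB.
rewrite [RHS](reindex_inj s_inj) /=; apply: eq_bigr => a _.
by rewrite -[in LHS](subrK (grid (s a)) (grid a + h)) addrC gN.
Qed.

End Levels.

(** * Haar integrals of functions of finite level *)

Section HaarIntegral.
Variables (R : realType) (p : nat) (p_pr : prime p) (n : nat).
Variable mu : {measure set (BorelQp p_pr n) -> \bar R}.
Hypothesis haar_mu : haar_measure mu.
Local Notation K := (Qp p_pr).
Local Notation V := 'rV[Qp p_pr]_n.
Local Notation VB := (BorelQp p_pr n).
Local Notation pabs := (@pabs p p_pr).
Local Notation C := R[i].

Lemma open_measurable_QpV (A : set V) : open A -> measurable (A : set VB).
Proof. by move=> oA; apply: sub_sigma_algebra. Qed.

Lemma loc_const_measurable (T : Type) (g : V -> T) (A : set T) :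
  (forall x, exists k, forall h, cball (p%:Q ^- k) h -> g (x + h) = g x) ->
  measurable (g @^-1` A : set VB).
Proof.
move=> gl; apply: open_measurable_QpV; apply: open_QpV => x Ax.
by have [k kg] := gl x; exists k => h /kg gx; rewrite /preimage /= gx.
Qed.

Lemma level_measurable (g : V -> R) N : level N g -> measurable_fun setT (g : VB -> R).
Proof.
move=> [_ gN] _ B _; rewrite setTI; apply: (loc_const_measurable (g := g)) => x.
by exists N => h; exact: gN.
Qed.

Lemma measurable_coset r (a : V) : 0 < r -> measurable ([set x | cball r (x - a)] : set VB).
Proof.
move=> r0; apply: open_measurable_QpV; apply: open_QpV => x xa.
have [k kr] := pexp_small p_pr r0; exists k => h hk /=.
by rewrite addrAC; apply: cballD => //; apply: cball_mono hk; exact: ltW.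
Qed.

Lemma measurable_cball r : 0 < r -> measurable (cball r : set VB).
Proof.
move=> r0; have -> : cball r = [set x : V | cball r (x - 0)].
  by apply/seteqP; split => x /=; rewrite subr0.
exact: measurable_coset.
Qed.

Lemma haar_coset r (a : V) : 0 < r -> mu [set x | cball r (x - a)] = mu (cball r).
Proof.
move=> r0; rewrite -(haar_mu.1 _ a (measurable_cball r0)); congr (mu _).
apply/seteqP; split => x /= => [xa|[y yr <-]]; last by rewrite addrAC subrr add0r.
by exists (x - a) => //; rewrite subrKC.
Qed.

(** g is a finite combination of indicators of cosets of the small ball, which all have the same
    measure by translation invariance. That measure is left unevaluated, because the case of the
    indicator of the unit ball serves to compute it. *)
Lemma ge0_grid_integral (c : K) k (g : V -> R) : c != 0 ->
  (forall x, 0 <= g x) ->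
  (forall x, ~ cball (pabs c) x -> g x = 0) ->
  (forall x h, cball (pabs c * p%:Q ^- k) h -> g (x + h) = g x) ->
  (\int[mu]_x (g x)%:E = \sum_a (g (@gridpt _ p_pr n c k a))%:E * mu (cball (pabs c * p%:Q ^-
    k)))%E.
Proof.
move=> c0 g0 gc gk; set r := pabs c * _.
have r0 : 0 < r by rewrite mulr_gt0 ?pabs_gt0 ?pexpV_gt0.
pose D a : set VB := [set x | cball r (x - @gridpt _ p_pr n c k a)].
have mD a : measurable (D a) by exact: measurable_coset.
have gE x : (g x)%:E = (\sum_a (g (@gridpt _ p_pr n c k a))%:E * (\1_(D a) x)%:E)%E.
  have [xc|xc] := pselect (cball (pabs c) x); last first.
    rewrite gc // big1 // => a _; rewrite indicE memNset ?mule0 // => xa; apply: xc.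
    rewrite -[x](subrK (@gridpt _ p_pr n c k a)); apply: cballD; last exact: gridpt_ball.
    apply: cball_mono xa; rewrite ler_piMr ?pabs_ge0 // invf_le1 ?exprn_gt0 ?(pQ_gt0 p_pr) //.
    by rewrite exprn_ege1 // ltW // (pQ_gt1 p_pr).
  have [a xa] := gridpt_approx k xc.
  rewrite (bigD1 a) //= big1 ?adde0 => [|b ba]; last first.
    rewrite indicE memNset ?mule0 // => xb; move/eqP: ba; apply.
    apply/esym/(gridpt_inj c0); set u := gridpt c a; set v := gridpt c b.
    have -> : u - v = (x - v) - (x - u) by apply/matrixP => i j; rewrite !mxE; ring.
    exact: cballB.
  rewrite indicE mem_set // mule1 -[in LHS](subrK (gridpt c a) x) addrC gk //.
rewrite (eq_integral (fun x : VB =>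
  (\sum_a (g (@gridpt _ p_pr n c k a))%:E * (\1_(D a) x)%:E)%E)); last by move=> x _; exact: gE.
rewrite ge0_integral_sum //.
- apply: eq_bigr => a _; rewrite ge0_integralZl_EFin //.
    by rewrite integral_indic // setIT haar_coset.
  by apply/measurable_EFinP; exact: measurable_indic.
- move=> a; apply: measurable_funeM; apply/measurable_EFinP; exact: measurable_indic.
- by move=> a x _; rewrite -EFinM lee_fin mulr_ge0.
Qed.

Lemma sume_const (I : finType) (x : \bar R) : (\sum_(i : I) x = #|I|%:R%:E * x)%E.
Proof.
rewrite big_const; elim: #|I| => [|k IH] /=; first by rewrite mul0e.
by rewrite IH -natr1 addrC EFinD ge0_muleDl ?mul1e ?lee_fin.
Qed.

(** The Haar measure of p^N Z_p^n, as [haar_cballV] shows. *)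
Definition vol N : R := (p ^ (n * N))%:R^-1.

Lemma vol_gt0 N : 0 < vol N.
Proof. by rewrite invr_gt0 ltr0n expn_gt0 prime_gt0. Qed.

Lemma haar_cball1 : mu (cball 1) = 1%E.
Proof. by rewrite -haar_mu.2. Qed.

(** Z_p^n has measure 1 and is the disjoint union of p^(n N) translates of p^N Z_p^n. *)
Lemma haar_cballV N : mu (cball (p%:Q ^- N)) = (vol N)%:E.
Proof.
have c0 : (1 : K) != 0 by exact: oner_neq0.
have := @ge0_grid_integral 1 N (\1_(cball 1)) c0; rewrite pabs1 mul1r.
move=> H; have {H} : (1 = \sum_(a : {ffun 'I_n -> 'I_(p ^ N)}) mu (cball (p%:Q ^- N)))%E.
  rewrite -[LHS]haar_cball1 -[cball 1]setIT -integral_indic //; last exact: measurable_cball.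
  rewrite H //.
  - apply: eq_bigr => a _; rewrite indicE mem_set ?mul1e //.
    by have := @gridpt_ball _ p_pr n 1 N a; rewrite pabs1.
  - by move=> x x1; rewrite indicE memNset.
  - move=> x h hN; rewrite !indicE; congr ((nat_of_bool _)%:R).
    have h1 : cball 1 h by apply: cball_mono hN; rewrite -[leRHS]invr1 -(expr0 p%:Q) pexpV_le.
    by apply/idP/idP; rewrite !inE => /(cballDr _ h1).
rewrite sume_const card_ffun !card_ord -expnM mulnC /vol.
have : 0 < (p ^ (n * N))%:R :> R by rewrite ltr0n expn_gt0 prime_gt0.
(* An infinite mass of the small ball would contradict the total mass 1. *)
set m := _%:R; case: (mu _) => [r|m0|m0] /=.
- by move=> m0 [E]; congr _%:E; apply: (mulfI (lt0r_neq0 m0)); rewrite divff ?lt0r_neq0 // -E.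
- by rewrite gt0_muley ?lte_fin.
- by rewrite gt0_muleNy ?lte_fin.
Qed.

Lemma ge0_level_integral N (g : V -> R) : level N g -> (forall x, 0 <= g x) ->
  (\int[mu]_x (g x)%:E)%E = (vol N * \sum_a g (@grid _ p_pr n N a))%:E.
Proof.
move=> [gN hN] g0.
have := @ge0_grid_integral (pN p_pr N) (N + N) g (pN_neq0 _ _) g0.
rewrite grid_radius pabs_pN => -> //.
rewrite haar_cballV mulr_sumr -sumEFin; apply: eq_bigr => a _.
by rewrite EFinM muleC.
Qed.

Lemma level_integral N (g : V -> R) : level N g ->
  \int[mu]_x g x = vol N * \sum_a g (@grid _ p_pr n N a).
Proof.
move=> gl; pose gp x := Num.max (g x) 0; pose gm x := Num.max (- g x) 0.
have lp : level N gp by split=> [x /gl.1|x h /gl.2] E; rewrite /gp E ?maxxx.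
have lm : level N gm by split=> [x /gl.1|x h /gl.2] E; rewrite /gm E ?oppr0 ?maxxx.
rewrite /Rintegral integralE.
rewrite (eq_integral (fun x : VB => (gp x)%:E)); last by move=> x _; rewrite funeposE -EFin_max.
rewrite [X in (_ - X)%E](eq_integral (fun x : VB => (gm x)%:E)); last first.
  by move=> x _; rewrite funenegE -EFinN -EFin_max.
rewrite !(@ge0_level_integral N) //; first last.
- by move=> x; rewrite le_max lexx orbT.
- by move=> x; rewrite le_max lexx orbT.
rewrite -EFinB /= -mulrBr -sumrB; congr (_ * _); apply: eq_bigr => a _.
rewrite /gp /gm; set t := g _; have [t0|t0] := leP t 0.
  by rewrite max_l ?oppr_ge0 // sub0r opprK.
by rewrite max_r ?subr0 // oppr_le0 ltW.
Qed.

Lemma level_cintegral N (g : V -> C) : level N g ->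
  cintegral mu g = (vol N)%:C%C * \sum_a g (@grid _ p_pr n N a).
Proof.
move=> [gN hN]; rewrite /cintegral.
rewrite (@level_integral N (fun x => complex.Re (g x))); last first.
  by split=> [x /gN ->//|x h /hN ->].
rewrite (@level_integral N (fun x => complex.Im (g x))); last first.
  by split=> [x /gN ->//|x h /hN ->].
apply/eqP; rewrite eq_complex /=.
have -> : \sum_a complex.Re (g (@grid _ p_pr n N a)) = complex.Re (\sum_a g (@grid _ p_pr n N a)).
  by rewrite raddf_sum.
have -> : \sum_a complex.Im (g (@grid _ p_pr n N a)) = complex.Im (\sum_a g (@grid _ p_pr n N a)).
  by rewrite raddf_sum.
by case: (\sum_a _) => u v /=; rewrite !mul0r subr0 addr0 !eqxx.
Qed.

End HaarIntegral.

(** * The Fourier transform *)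

Section Fourier.
Variables (R : realType) (p : nat) (p_pr : prime p) (n : nat).
Variable mu : {measure set (BorelQp p_pr n) -> \bar R}.
Hypothesis haar_mu : haar_measure mu.
Local Notation K := (Qp p_pr).
Local Notation V := 'rV[Qp p_pr]_n.
Local Notation pabs := (@pabs p p_pr).
Local Notation C := R[i].
Local Notation Psi := (@add_char R p p_pr).
Local Notation grid N a := (@grid p p_pr n N a).
Local Notation vol := (@vol R p n).
Local Notation fourier := (fourier mu).
Implicit Types (x y h xi : V) (g : V -> C).

Lemma dotpC x y : dotp x y = dotp y x.
Proof. by apply: eq_bigr => i _; rewrite mulrC. Qed.

Lemma dotpDl x y z : dotp (x + y) z = dotp x z + dotp y z.
Proof. by rewrite -big_split; apply: eq_bigr => i _; rewrite mxE mulrDl. Qed.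

Lemma dotpNl x y : dotp (- x) y = - dotp x y.
Proof. by rewrite -sumrN; apply: eq_bigr => i _; rewrite mxE mulNr. Qed.

Lemma dotpDr x y z : dotp z (x + y) = dotp z x + dotp z y.
Proof. by rewrite dotpC dotpDl !(dotpC z). Qed.

Lemma dotpNr x y : dotp x (- y) = - dotp x y.
Proof. by rewrite dotpC dotpNl dotpC. Qed.

Lemma pabs_dotp r s x y : 0 <= r -> 0 <= s -> cball r x -> cball s y -> pabs (dotp x y) <= r * s.
Proof.
move=> r0 s0 xr ys; apply: pabs_sum_le => [|i _]; first exact: mulr_ge0.
by rewrite pabsM ler_pM ?pabs_ge0.
Qed.

Lemma add_char_dotp1 N x y : cball (p%:Q ^+ N) x -> cball (p%:Q ^- N) y -> Psi (dotp x y) = 1.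
Proof.
move=> xN yN; apply/add_char1P; have pN0 : 0 < p%:Q ^+ N by rewrite exprn_gt0 // (pQ_gt0 p_pr).
have := pabs_dotp (ltW pN0) (ltW (pexpV_gt0 p_pr N)) xN yN.
by rewrite divff ?gt_eqF.
Qed.

Lemma add_char_dotp1N N x y : cball (p%:Q ^+ N) x -> cball (p%:Q ^- N) y ->
  Psi (- dotp y x) = 1.
Proof.
by move=> xN yN; rewrite -dotpNl dotpC (add_char_dotp1 xN) //; exact: cballN.
Qed.

(** A coordinate with |y_i| > p^m has |y_i| >= p^(m + 1), the value group being discrete. Hence t =
    1 / (p y_i) satisfies |t| <= p^-m, while t y_i = 1 / p is not integral. *)
Lemma add_char_separates (m : int) y : ~ cball (p%:Q ^ m) y ->
  exists h, cball (p%:Q ^ (- m)) h /\ Psi (dotp h y) != 1.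
Proof.
move=> /existsNP[i /negP]; rewrite -ltNge => yi.
have pm0 k : 0 < p%:Q ^ k by rewrite exprz_gt0 // (pQ_gt0 p_pr).
have y0 : y 0 i != 0 by rewrite -pabs_gt0 (lt_trans _ yi).
pose t : K := (p%:R * y 0 i)^-1.
have ht : pabs t <= p%:Q ^ (- m).
  rewrite pabsV pabsM pabs_natp -invr_expz lef_pV2 ?posrE ?mulr_gt0 ?invr_gt0 ?(pQ_gt0 p_pr)
    ?pabs_gt0 //.
  have := pabs_lt_le yi; rewrite expfzDr ?gt_eqF ?(pQ_gt0 p_pr) // expr1z => ym.
  by rewrite mulrC ler_pdivlMr ?(pQ_gt0 p_pr).
exists (t *: delta_mx 0 i); split.
  move=> j; rewrite !mxE eqxx /=; case: eqP => _; rewrite ?mulr1 // mulr0 pabs0 ltW //.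
apply/eqP => /add_char1P; rewrite /dotp (bigD1 i) //= big1 => [|j ji].
  rewrite addr0 !mxE !eqxx mulr1 /t invfM mulfVK // pabsV pabs_natp invrK.
  by rewrite leNgt (pQ_gt1 p_pr).
by rewrite !mxE eqxx (negPf ji) mulr0 mul0r.
Qed.

(** The bound on xi makes the character constant on the cosets of the ball of radius p^-N, so that
    the whole integrand is of level N. *)
Lemma fourier_in N g xi : level N g -> cball (p%:Q ^+ N) xi ->
  fourier g xi = (vol N)%:C%C * \sum_a Psi (- dotp (grid N a) xi) * g (grid N a).
Proof.
move=> [gN hN] xiN; rewrite /fourier (level_cintegral haar_mu (N := N)) //; split.
  by move=> x /gN ->; rewrite mulr0.
move=> x h hh; rewrite hN // dotpDl opprD add_charD.
by rewrite (add_char_dotp1N xiN hh) mulr1.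
Qed.

(** Translating by an h of size at most p^-N leaves g unchanged and multiplies the transform by Psi
    (h . xi), which is not 1 for a suitable h. The sums are taken at a larger level M, whose ball
    contains xi. *)
Lemma level_fourier_out N g xi : level N g -> ~ cball (p%:Q ^+ N) xi -> fourier g xi = 0.
Proof.
move=> gl xiN; have [M0 xiM0] := cball_bound xi; pose M := maxn N M0.
have gM : level M g by apply: level_mono gl; rewrite leq_maxl.
have xiM : cball (p%:Q ^+ M) xi by apply: cball_mono xiM0; apply: (pexp_le p_pr);
  rewrite leq_maxr.
have [h [hN Ph]] := @add_char_separates N%:Z xi xiN.
rewrite (fourier_in gM xiM).
have uM : level M (fun x => Psi (- dotp x xi) * g x).
  split=> [x /gM.1 ->|x k kM]; first by rewrite mulr0.
  rewrite gM.2 // dotpDl opprD add_charD.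
  by rewrite (add_char_dotp1N xiM kM) mulr1.
have hM : cball (p%:Q ^+ M) (- h).
  by apply/cballN; apply: cball_mono hN; rewrite -exprnN pexpV_le_pexp.
have := level_sum_shift uM hM; set S := \sum_a Psi (- dotp (grid M a) xi) * g (grid M a).
have uE a : Psi (- dotp (grid M a - h) xi) * g (grid M a - h) =
    Psi (dotp h xi) * (Psi (- dotp (grid M a) xi) * g (grid M a)).
  rewrite gl.2; last by apply: cballN; rewrite exprnN.
  by rewrite dotpDl opprD add_charD dotpNl opprK mulrA [X in X * _]mulrC.
under eq_bigr => a _ do rewrite uE.
rewrite -mulr_sumr -/S => /eqP; rewrite -subr_eq0 -[X in _ - X]mul1r -mulrBl mulf_eq0.
by rewrite subr_eq0 (negPf Ph) => /eqP ->; rewrite mulr0.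
Qed.

Lemma level_fourier N g : level N g -> level N (fourier g).
Proof.
move=> gl; split=> [xi|xi h hN]; first exact: level_fourier_out.
have hN' : cball (p%:Q ^+ N) h by apply: cball_mono hN; exact: pexpV_le_pexp.
have [xiN|xiN] := pselect (cball (p%:Q ^+ N) xi); last first.
  by rewrite !(level_fourier_out gl) // => /(cballDr _ hN').
rewrite !(fourier_in gl) //; last exact: cballD.
congr (_ * _); apply: eq_bigr => a _; congr (_ * _).
rewrite dotpDr opprD add_charD -[- dotp _ h]dotpNr (add_char_dotp1 (@grid_ball _ p_pr n N a))
  ?mulr1 //.
exact: cballN.
Qed.

(** Orthogonality of the characters of a finite group: translating by an h with Psi (h . y)
    different from 1 multiplies the sum by this factor. The value [vol N ^- 2] is the number p^(2 n
    N) of grid points. *)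
Lemma grid_orthogonal N y : cball (p%:Q ^+ N) y ->
  \sum_a Psi (dotp (grid N a) y) = if `[< cball (p%:Q ^- N) y >] then (vol N ^- 2)%:C%C else 0.
Proof.
move=> yN; case: asboolP => yN'.
  under eq_bigr => a _ do rewrite (add_char_dotp1 (@grid_ball _ p_pr n N a) yN').
  rewrite sumr_const card_ffun !card_ord /vol -exprVn invrK.
  rewrite -natrX -mulr_natr mul1r; have -> : ((p ^ (N + N)) ^ n = (p ^ (n * N)) ^ 2)%N.
    by rewrite -!expnM; congr (_ ^ _)%N; lia.
  by rewrite rmorph_nat.
have [h [hN Ph]] := @add_char_separates (- N%:Z) y (fun H => yN' (eq_ind _ (fun r =>
  cball r y) H _ (esym (exprnN _ _)))).
rewrite opprK in hN.
(* The character is cut off outside the ball of radius p^N, so as to be a function of level N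
   without changing on the grid. *)
pose u x : C := if `[< cball (p%:Q ^+ N) x >] then Psi (dotp x y) else 0.
have ul : level N u.
  split=> [x xN|x k kN]; first by rewrite /u; case: asboolP.
  have kN' : cball (p%:Q ^+ N) k by apply: cball_mono kN; exact: pexpV_le_pexp.
  rewrite /u dotpDl add_charD [dotp k _]dotpC (add_char_dotp1 yN kN) mulr1.
  by case: asboolP; case: asboolP => // a b; exfalso; [apply: a|apply: b]; apply/(cballDr _ kN').
have := level_sum_shift ul hN.
have uE a : u (grid N a) = Psi (dotp (grid N a) y).
  by rewrite /u asboolT //; exact: grid_ball.
have uhE a : u (grid N a + h) = Psi (dotp h y) * Psi (dotp (grid N a) y).
  rewrite /u asboolT; last by apply/(cballDr _ hN); exact: grid_ball.
  by rewrite dotpDl add_charD mulrC.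
under eq_bigr => a _ do rewrite uhE.
under [in RHS]eq_bigr => a _ do rewrite uE.
rewrite -mulr_sumr => /eqP; rewrite -subr_eq0 -[X in _ - X]mul1r -mulrBl mulf_eq0.
by rewrite subr_eq0 (negPf Ph) => /eqP.
Qed.

(** After exchanging the two sums, orthogonality selects the only grid point in the class of -x, and
    the factor vol^2 cancels the number of grid points. *)
Lemma fourier_inversion N g x : level N g -> fourier (fourier g) x = g (- x).
Proof.
move=> gl; have fl := level_fourier gl.
have [xN|xN] := pselect (cball (p%:Q ^+ N) x); last first.
  rewrite (level_fourier_out fl) // gl.1 // => xN'; apply: xN.
  by rewrite -[x]opprK; exact: cballN.
have [a0 xa0] := grid_approx (cballN xN).
rewrite (fourier_in fl) //.
transitivity ((vol N ^+ 2)%:C%C * \sum_a g (grid N a) * \sum_b Psi (dotp (grid N b) (- x - grid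
  N a))).
  rewrite rmorphXn /= expr2 -mulrA; congr (_ * _).
  under [in RHS]eq_bigr => a _ do rewrite mulr_sumr.
  rewrite exchange_big /= mulr_sumr; apply: eq_bigr => b _.
  rewrite (fourier_in gl); last exact: grid_ball.
  rewrite mulrCA; congr (_ * _); rewrite mulr_sumr; apply: eq_bigr => a _.
  rewrite dotpDr !dotpNr add_charD [dotp (grid N a) _]dotpC; ring.
rewrite (bigD1 a0) //= [X in _ + X]big1 => [|a aa0].
  rewrite addr0 grid_orthogonal; last by apply: cballB; [exact: cballN|exact: grid_ball].
  rewrite asboolT // mulrCA -rmorphM /= divff ?expf_neq0 ?gt_eqF ?vol_gt0 // mulr1.
  by rewrite -[in RHS](subrK (grid N a0) (- x)) addrC gl.2.
rewrite grid_orthogonal; last by apply: cballB; [exact: cballN|exact: grid_ball].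
rewrite asboolF ?mulr0 // => xa; move/eqP: aa0; apply; apply: (@grid_inj _ p_pr n N).
set u := grid N a; set v := grid N a0; have -> : u - v = (- x - v) - (- x - u).
  by apply/matrixP => i j; rewrite !mxE; ring.
exact: cballB.
Qed.

Lemma normc2E (z : C) : (ComplexField.Normc.normc z ^+ 2)%:C%C = z * z^*.
Proof.
case: z => a b; rewrite /= sqr_sqrtr ?addr_ge0 ?sqr_ge0 //.
by apply/eqP; rewrite eq_complex /=; apply/andP; split; apply/eqP; ring.
Qed.

(** One factor is expanded on each side: the conjugate of the transform on the left, and on the
    right g itself, written as a double transform by inversion. Both sides become the same double
    sum. *)
Lemma plancherel_grid N g : level N g ->
  \sum_a ComplexField.Normc.normc (fourier g (grid N a)) ^+ 2 =
  \sum_a ComplexField.Normc.normc (g (grid N a)) ^+ 2.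
Proof.
move=> gl; have fl := level_fourier gl.
apply: (fmorph_inj (real_complex R)); rewrite !rmorph_sum /=.
rewrite (eq_bigr (fun b => fourier g (grid N b) * (fourier g (grid N b))^*)); last first.
  by move=> b _; exact: (normc2E (fourier g (grid N b))).
rewrite [RHS](eq_bigr (fun a => fourier (fourier g) (- grid N a) * (g (grid N a))^*)); last first.
  by move=> a _; rewrite (fourier_inversion _ gl) opprK; exact: (normc2E (g (grid N a))).
have cf b : (fourier g (grid N b))^* = (vol N)%:C%C * \sum_a Psi (dotp (grid N a) (grid N b)) *
  (g (grid N a))^*.
  rewrite (fourier_in gl); last exact: grid_ball.
  have cr : ((vol N)%:C%C)^* = (vol N)%:C%C :> C.
    by apply/eqP; rewrite eq_complex /= oppr0 !eqxx.
  rewrite rmorphM /= [X in X * _ = _]cr rmorph_sum /=; congr (_ * _); apply: eq_bigr => a _.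
  by rewrite rmorphM /= conj_add_char opprK.
have ff a : fourier (fourier g) (- grid N a) = (vol N)%:C%C * \sum_b Psi (dotp (grid N a) (grid
  N b)) * fourier g (grid N b).
  rewrite (fourier_in fl); last by apply: cballN; exact: grid_ball.
  by congr (_ * _); apply: eq_bigr => b _; rewrite dotpNr opprK dotpC.
under eq_bigr => b _ do rewrite cf mulrCA mulr_sumr mulr_sumr.
under [in RHS]eq_bigr => a _ do rewrite ff -mulrA mulr_suml mulr_sumr.
rewrite exchange_big /=; apply: eq_bigr => a _; apply: eq_bigr => b _; ring.
Qed.

End Fourier.

(** * Weighted square integrals of complex functions *)

Section ComplexL2.
Local Notation normc := ComplexField.Normc.normc.

(** The bound is optimal at t = sqrt b / sqrt a, where it equals (sqrt a + sqrt b)^2. Since a or b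
    may vanish, e / 2 is added to both roots before taking the quotient. *)
Lemma sqrt_le_of_split (R : rcfType) (a b c : R) : 0 <= a -> 0 <= b ->
  (forall t, 0 < t -> c <= (1 + t) * a + (1 + t^-1) * b) ->
  Num.sqrt c <= Num.sqrt a + Num.sqrt b.
Proof.
move=> a0 b0 H; apply/ler_addgt0Pr => e e0.
set x := Num.sqrt a; set y := Num.sqrt b.
have [x0 y0] : 0 <= x /\ 0 <= y by rewrite !sqrtr_ge0.
have xe : 0 < x + e / 2 by rewrite ltr_wpDl // divr_gt0.
have ye : 0 < y + e / 2 by rewrite ltr_wpDl // divr_gt0.
have s0 : 0 <= x + y + e by rewrite !addr_ge0 // ltW.
have cs : c <= (x + y + e) ^+ 2.
  apply: le_trans (H ((y + e / 2) / (x + e / 2)) _) _; first exact: divr_gt0.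
  rewrite -[a]sqr_sqrtr // -[b]sqr_sqrtr // -/x -/y.
  set u := x + e / 2 in xe *; set v := y + e / 2 in ye *.
  have -> : x + y + e = u + v by rewrite /u /v addrACA -splitr.
  have ux : v / u * x ^+ 2 <= v * u.
    rewrite mulrAC ler_pdivrMr // -mulrA -expr2 ler_pM2l // ler_sqr ?nnegrE // ?ltW //.
    by rewrite ltrDl divr_gt0.
  have vy : (v / u)^-1 * y ^+ 2 <= v * u.
    rewrite invf_div mulrAC ler_pdivrMr // mulrAC -expr2 [leRHS]mulrC ler_pM2l //
      ler_sqr ?nnegrE // ?ltW //.
    by rewrite ltrDl divr_gt0.
  have xu : x ^+ 2 <= u ^+ 2 by rewrite ler_sqr ?nnegrE // ?(ltW xe) // lerDl divr_ge0 // ltW.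
  have yv : y ^+ 2 <= v ^+ 2 by rewrite ler_sqr ?nnegrE // ?(ltW ye) // lerDl divr_ge0 // ltW.
  set A := v / u * x ^+ 2 in ux; set B := (v / u)^-1 * y ^+ 2 in vy.
  have -> : (1 + v / u) * x ^+ 2 = x ^+ 2 + A by rewrite mulrDl mul1r.
  have -> : (1 + (v / u)^-1) * y ^+ 2 = y ^+ 2 + B by rewrite mulrDl mul1r.
  by rewrite sqrrD; lra.
by apply: le_trans (ler_wsqrtr cs) _; rewrite sqrtr_sqr ger0_norm.
Qed.

Lemma normc2_ReIm (R : rcfType) (z : R[i]) : normc z ^+ 2 = complex.Re z ^+ 2 + complex.Im z ^+ 2.
Proof. by case: z => a b; rewrite /= sqr_sqrtr // addr_ge0 ?sqr_ge0. Qed.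

(** A triangle inequality that is linear in the squared moduli, so that it can be integrated with t
    fixed; t is optimised only after integration. For reals, the difference of the two sides is (t a
    - b)^2 / t. *)
Lemma normc2_split (R : rcfType) (t : R) (z w : R[i]) : 0 < t ->
  normc (z + w) ^+ 2 <= (1 + t) * normc z ^+ 2 + (1 + t^-1) * normc w ^+ 2.
Proof.
move=> t0; have key (a b : R) : (a + b) ^+ 2 <= (1 + t) * a ^+ 2 + (1 + t^-1) * b ^+ 2.
  rewrite -subr_ge0.
  have -> : (1 + t) * a ^+ 2 + (1 + t^-1) * b ^+ 2 - (a + b) ^+ 2 = t^-1 * (t * a - b) ^+ 2.
    by field; rewrite gt_eqF.
  by rewrite mulr_ge0 ?invr_ge0 ?sqr_ge0 // ltW.
case: z w => [a b] [c d]; rewrite !normc2_ReIm /=.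
have := lerD (key a c) (key b d); lra.
Qed.

Lemma normc_Re (R : rcfType) (z : R[i]) : `|complex.Re z| <= normc z.
Proof. by rewrite -[leRHS]ger0_norm ?sqrtr_ge0; last (case: z => a b; exact: sqrtr_ge0);
  rewrite -ler_sqr ?nnegrE ?normr_ge0 // !real_normK ?num_real // normc2_ReIm lerDl sqr_ge0. Qed.

Lemma normc_Im (R : rcfType) (z : R[i]) : `|complex.Im z| <= normc z.
Proof. by rewrite -[leRHS]ger0_norm ?sqrtr_ge0; last (case: z => a b; exact: sqrtr_ge0);
  rewrite -ler_sqr ?nnegrE ?normr_ge0 // !real_normK ?num_real // normc2_ReIm lerDr sqr_ge0. Qed.

Variables (d : measure_display) (T : measurableType d) (R : realType).
Variable mu : {measure set T -> \bar R}.
Local Notation C := R[i].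
Implicit Types (f g : T -> C) (W : T -> R).

Definition cmeasurable f :=
  measurable_fun setT (fun x => complex.Re (f x)) /\ measurable_fun setT (fun x =>
    complex.Im (f x)).

Lemma cmeasurableD f g : cmeasurable f -> cmeasurable g -> cmeasurable (fun x => f x + g x).
Proof.
move=> [rf jf] [rg ig]; split.
  have -> : (fun x => complex.Re (f x + g x)) = (fun x => complex.Re (f x) + complex.Re (g x)).
    by apply/funext => x; case: (f x) (g x) => ? ? [].
  exact: measurable_funD.
have -> : (fun x => complex.Im (f x + g x)) = (fun x => complex.Im (f x) + complex.Im (g x)).
  by apply/funext => x; case: (f x) (g x) => ? ? [].
exact: measurable_funD.
Qed.

Lemma cmeasurableZ a f : cmeasurable f -> cmeasurable (fun x => a * f x).
Proof.
case: a => u v [rf jf]; split.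
  have -> : (fun x => complex.Re (Complex u v * f x)) = (fun x =>
    u * complex.Re (f x) - v * complex.Im (f x)).
    by apply/funext => x; case: (f x).
  by apply: measurable_funB; apply: measurable_funM => //; exact: measurable_cst.
have -> : (fun x => complex.Im (Complex u v * f x)) = (fun x =>
  u * complex.Im (f x) + v * complex.Re (f x)).
  by apply/funext => x; case: (f x).
by apply: measurable_funD; apply: measurable_funM => //; exact: measurable_cst.
Qed.

Lemma cmeasurableB f g : cmeasurable f -> cmeasurable g -> cmeasurable (fun x => f x - g x).
Proof.
move=> mf mg; have -> : (fun x => f x - g x) = (fun x => f x + -1 * g x).
  by apply/funext => x; rewrite mulN1r.
by apply: cmeasurableD => //; exact: cmeasurableZ.
Qed.

Definition wsq_int W f := (\int[mu]_x (W x * normc (f x) ^+ 2)%:E)%E.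

Lemma measurable_wsq W f : measurable_fun setT W -> cmeasurable f ->
  measurable_fun setT (fun x => (W x * normc (f x) ^+ 2)%:E).
Proof.
move=> mW [rf jf]; apply/measurable_EFinP; apply: measurable_funM => //.
under eq_fun do rewrite normc2_ReIm.
by apply: measurable_funD; apply: measurable_funX.
Qed.

Lemma wint_ge0 W f : (forall x, 0 <= W x) -> (0 <= wsq_int W f)%E.
Proof. by move=> W0; apply: integral_ge0 => x _; rewrite lee_fin mulr_ge0 ?sqr_ge0. Qed.

Lemma le_wint W W' f g : (forall x, 0 <= W x) -> measurable_fun setT W ->
  measurable_fun setT W' ->
  cmeasurable f -> cmeasurable g ->
  (forall x, W x * normc (f x) ^+ 2 <= W' x * normc (g x) ^+ 2) ->
  (wsq_int W f <= wsq_int W' g)%E.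
Proof.
move=> W0 mW mW' mf mg fg; apply: ge0_le_integral => //.
- by move=> x _; rewrite lee_fin mulr_ge0 ?sqr_ge0.
- exact: measurable_wsq.
- exact: measurable_wsq.
- by move=> x _; rewrite lee_fin.
Qed.

Lemma wintM W W' f : (forall x, 0 <= W x) -> measurable_fun setT W -> cmeasurable f ->
  forall c, 0 <= c -> (forall x, W' x = c * W x) -> wsq_int W' f = (c%:E * wsq_int W f)%E.
Proof.
move=> W0 mW mf c c0 WE; rewrite -ge0_integralZl_EFin //.
- by apply: eq_integral => x _; rewrite WE -mulrA EFinM.
- by move=> x _; rewrite lee_fin mulr_ge0 ?sqr_ge0.
- exact: measurable_wsq.
Qed.

Lemma wint_split W f g t : (forall x, 0 <= W x) -> measurable_fun setT W ->
  cmeasurable f -> cmeasurable g -> 0 < t ->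
  (wsq_int W (fun x => (f x + g x)%R) <= (1 + t)%:E * wsq_int W f + (1 + t^-1)%:E * wsq_int W
    g)%E.
Proof.
move=> W0 mW mf mg t0.
have t1 : 0 <= 1 + t by rewrite addr_ge0 // ltW.
have t2 : 0 <= 1 + t^-1 by rewrite addr_ge0 // invr_ge0 ltW.
rewrite -(wintM W0 mW mf t1 (fun=> erefl)) -(wintM W0 mW mg t2 (fun=> erefl)).
have mW1 c : measurable_fun setT (fun x => c * W x).
  by apply: measurable_funM => //; exact: measurable_cst.
rewrite /wsq_int -ge0_integralD //.
- apply: ge0_le_integral => //.
  + by move=> x _; rewrite lee_fin mulr_ge0 ?sqr_ge0.
  + by apply: measurable_wsq => //; exact: cmeasurableD.
  + by apply: emeasurable_funD; apply: measurable_wsq.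
  + move=> x _; rewrite -EFinD lee_fin -!mulrA ![_ * (W x * _)]mulrCA -mulrDr.
    by rewrite ler_wpM2l // normc2_split.
- by move=> x _; rewrite lee_fin; apply: mulr_ge0; [exact: mulr_ge0|exact: sqr_ge0].
- exact: measurable_wsq.
- by move=> x _; rewrite lee_fin; apply: mulr_ge0; [exact: mulr_ge0|exact: sqr_ge0].
- exact: measurable_wsq.
Qed.

Lemma wint_triangle W f g : (forall x, 0 <= W x) -> measurable_fun setT W ->
  cmeasurable f -> cmeasurable g -> (wsq_int W f < +oo)%E -> (wsq_int W g < +oo)%E ->
  Num.sqrt (fine (wsq_int W (fun x => f x + g x))) <=
  Num.sqrt (fine (wsq_int W f)) + Num.sqrt (fine (wsq_int W g)).
Proof.
move=> W0 mW mf mg ff fg.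
have If : wsq_int W f \is a fin_num by rewrite ge0_fin_numE ?wint_ge0.
have Ig : wsq_int W g \is a fin_num by rewrite ge0_fin_numE ?wint_ge0.
apply: sqrt_le_of_split; rewrite ?fine_ge0 ?wint_ge0 // => t t0.
have := wint_split W0 mW mf mg t0.
rewrite -[wsq_int W f]fineK // -[wsq_int W g]fineK // -!EFinM -EFinD => le.
have Ifg : wsq_int W (fun x => f x + g x) \is a fin_num.
  by rewrite ge0_fin_numE ?wint_ge0 //; apply: le_lt_trans le _; exact: ltry.
by rewrite -lee_fin (fineK Ifg).
Qed.

Lemma wint_eq0 f : cmeasurable f -> wsq_int (fun=> 1) f = 0%E -> {ae mu, forall x, f x = 0}.
Proof.
move=> mf f0; have m1 : measurable_fun [set: T] (fun=> 1 : R) by exact: measurable_cst.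
have : ae_eq mu setT (fun x => (1 * normc (f x) ^+ 2)%:E) (cst 0%E).
  apply/ae_eq_integral_abs => //; first exact: measurable_wsq.
  rewrite -[RHS]f0; apply: eq_integral => x _.
  by rewrite gee0_abs // lee_fin mul1r sqr_ge0.
apply: filterS => x /(_ I) [] /eqP; rewrite mul1r expf_eq0 /= => /eqP.
exact: ComplexField.Normc.eq0_normc.
Qed.

(** * Completeness of L^2 *)

Lemma cvg_of_geometric_increments (u : R^nat) (c : R) :
  (forall k, `|u k.+1 - u k| <= c * 2^-1 ^+ k) -> cvgn u.
Proof.
move=> uc; have c0 : 0 <= c by have := le_trans (normr_ge0 _) (uc 0%N); rewrite expr0 mulr1.
have cv : cvgn (series (telescope u)).
  apply: normed_cvg; apply: (@series_le_cvg _ _ (geometric c 2^-1)) => [k|k|k|].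
  - exact: normr_ge0.
  - by rewrite /geometric /= mulr_ge0 // exprn_ge0.
  - exact: uc.
  - by apply: is_cvg_geometric_series; rewrite ger0_norm // invf_lt1 // ltr1n.
have -> : u = (fun k => series (telescope u) k + u 0%N).
  by apply/funext => k; rewrite telescopeK /= subrK.
by apply: is_cvgD => //; exact: is_cvg_cst.
Qed.

Local Notation N2 := (wsq_int (fun=> 1%R)).

(** The rate 8^-k suits [wint_cauchy_ae_cvg]: weighted by 4^k, the squared increments still have
    integrals at most 2^-k, which are summable. *)
Lemma fast_subsequence (u : nat -> T -> C) :
  (forall e : R, 0 < e -> exists N, forall i j, (N <= i)%N -> (N <= j)%N ->
    (N2 (fun x => (u i x - u j x)%R) < e%:E)%E) ->
  exists m : nat -> nat, (forall k, (k <= m k)%N) /\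
    forall k, (N2 (fun x => (u (m k.+1) x - u (m k) x)%R) <= (8^-1 ^+ k)%:E)%E.
Proof.
move=> uc; have /boolp.choice[N NP] : forall k : nat, exists N, forall i j, (N <= i)%N ->
  (N <= j)%N ->
    (N2 (fun x => (u i x - u j x)%R) < (8^-1 ^+ k)%:E)%E.
  by move=> k; apply: uc; rewrite exprn_gt0.
(* The maximum runs over all j <= k, so that both m k and m (k + 1) exceed the threshold N k; the
   summand k ensures k <= m k. *)
pose m k := (k + \max_(j < k.+1) N j)%N.
have Nm k i : (i <= k)%N -> (N i <= m k)%N.
  move=> ik; rewrite -ltnS in ik; apply: leq_trans (leq_addl _ _).
  exact: (leq_bigmax (F := fun j : 'I_k.+1 => N j) (Ordinal ik)).
exists m; split=> k; first exact: leq_addr.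
by apply: ltW; apply: NP; apply: Nm.
Qed.

(** The sum h of 4^k |v_(k+1) - v_k|^2 has a finite integral, hence is finite almost everywhere, and
    there sqrt h is the constant c. A measurable set E is produced, rather than an almost everywhere
    statement, because its indicator later truncates the sequence. *)
Lemma wint_cauchy_ae_cvg (v : nat -> T -> C) : (forall k, cmeasurable (v k)) ->
  (forall k, (N2 (fun x => (v k.+1 x - v k x)%R) <= (8^-1 ^+ k)%:E)%E) ->
  exists E : set T, [/\ measurable E, mu (~` E) = 0 &
    forall x, E x -> exists c, forall k, normc (v k.+1 x - v k x) <= c * 2^-1 ^+ k].
Proof.
move=> mv vc.
have mW c : measurable_fun [set: T] (fun=> c : R) by exact: measurable_cst.
pose D k x := v k.+1 x - v k x.
have mD k : cmeasurable (D k) by exact: cmeasurableB.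
pose q k x := (4 ^+ k * normc (D k x) ^+ 2)%:E.
have mq k : measurable_fun setT (q k) by exact: measurable_wsq.
have q0 k x : (0 <= q k x)%E by rewrite lee_fin mulr_ge0 ?sqr_ge0 // exprn_ge0.
pose h x := (\sum_(0 <= k <oo) q k x)%E.
have mh : measurable_fun setT h.
  exact: (@ge0_emeasurable_sum _ _ _ setT q xpredT).
have h0 x : (0 <= h x)%E by exact: nneseries_ge0.
have hint : (\int[mu]_x h x <= 2%:E)%E.
  rewrite integral_nneseries //.
  have -> : (2%:E : \bar R) = (\sum_(0 <= k <oo) (2 ^-1 ^+ k)%:E)%E.
    apply/esym; have := @cvg_geometric_eseries_half R 4 1 => /cvg_lim; rewrite expr1.
    have -> : (4 / 2 : R) = 2 by field.
    move=> <- //; apply: congr_lim; apply/funext => j; apply: eq_bigr => k _; congr _%:E.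
    by rewrite natrX exprD exprVn; field; rewrite expf_neq0.
  apply: lee_nneseries => [k _ _|k _].
    by apply: integral_ge0.
  rewrite (_ : (\int[mu]_x q k x)%E = ((4 ^+ k)%:E * N2 (D k))%E); last first.
    have one0 (x : T) : 0 <= 1 :> R by [].
    by rewrite -(wintM (W' := fun=> 4 ^+ k) one0) // => x; rewrite mulr1.
  apply: le_trans (lee_wpmul2l _ (vc k)) _; first by rewrite lee_fin exprn_ge0.
  rewrite -EFinM lee_fin -exprMn.
  suff -> : 4 * 8^-1 = 2^-1 :> R by [].
  by field.
pose E := [set x | (h x < +oo)%E].
have mE : measurable E.
  by rewrite -[E]setTI; exact: emeasurable_fun_infty_o.
exists E; split => //.
  have : mu.-integrable setT h.
    apply/integrableP; split => //.
    rewrite (eq_integral h) => [|x _]; last by rewrite gee0_abs.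
    by apply: le_lt_trans hint _; exact: ltry.
  move=> /(integrable_ae measurableT) hae.
  apply: measure_negligible; first exact: measurableC.
  apply: negligibleS hae => x /= xE hx; apply: xE.
  by rewrite /E /= -ge0_fin_numE //; exact: hx.
move=> x Ex; exists (Num.sqrt (fine (h x))) => k.
have hf : h x \is a fin_num by rewrite ge0_fin_numE.
have qh : (q k x <= h x)%E.
  apply: le_trans (nneseries_lim_ge k.+1 (fun i _ _ => q0 i x)).
  by rewrite big_nat_recr //= leeDr // sume_ge0.
have : (normc (D k x)) ^+ 2 <= (Num.sqrt (fine (h x)) * 2^-1 ^+ k) ^+ 2.
  rewrite exprMn sqr_sqrtr ?fine_ge0 // -exprM mulnC exprM exprVn.
  rewrite exprVn ler_pdivlMr ?exprn_gt0 // mulrC.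
  rewrite -lee_fin fineK //; apply: le_trans qh; rewrite lee_fin /q.
  by have -> : (2 ^+ 2 : R) = 4 by ring.
rewrite ler_sqr // nnegrE ?mulr_ge0 ?sqrtr_ge0 ?exprn_ge0 ?invr_ge0 //.
by case: (D k x) => ? ?; exact: sqrtr_ge0.
Qed.

Lemma normc_ge0 (z : C) : 0 <= normc z.
Proof. by case: z => a b; exact: sqrtr_ge0. Qed.

(** Riesz-Fischer. Multiplied by the indicator of E, the fast subsequence converges everywhere, so
    that its limit f is measurable; Fatou's lemma then bounds the norm of u_i - f by those of u_i
    minus the subsequence. *)
Lemma wint_complete (u : nat -> T -> C) : (forall k, cmeasurable (u k)) ->
  (forall e : R, 0 < e -> exists N, forall i j, (N <= i)%N -> (N <= j)%N ->
    (N2 (fun x => (u i x - u j x)%R) < e%:E)%E) ->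
  exists2 f, cmeasurable f &
    forall e : R, 0 < e -> exists N, forall i, (N <= i)%N ->
      (N2 (fun x => (u i x - f x)%R) <= e%:E)%E.
Proof.
move=> mu_ uc; have [m [mk mc]] := fast_subsequence uc.
have [E [mE E0 Ecv]] := wint_cauchy_ae_cvg (fun k => mu_ (m k)) mc.
have m1 : measurable_fun [set: T] (fun=> 1 : R) by exact: measurable_cst.
pose w k x : C := (\1_E x)%:C%C * u (m k) x.
have wRe k : (fun x => complex.Re (w k x)) = (fun x => \1_E x * complex.Re (u (m k) x)).
  by apply/funext => x; rewrite /w; case: (u (m k) x) => a b /=; rewrite mul0r subr0.
have wIm k : (fun x => complex.Im (w k x)) = (fun x => \1_E x * complex.Im (u (m k) x)).
  by apply/funext => x; rewrite /w; case: (u (m k) x) => a b /=; rewrite mul0r addr0.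
have mw k : cmeasurable (w k).
  split; [rewrite wRe|rewrite wIm]; apply: measurable_funM; try exact: measurable_indic;
    by have [] := mu_ (m k).
have wcv x : exists c, forall k, normc (w k.+1 x - w k x) <= c * 2^-1 ^+ k.
  have [Ex|Ex] := pselect (E x).
    have [c cP] := Ecv x Ex; exists c => k; rewrite /w indicE mem_set //.
    by rewrite !mul1r.
  have w0 j : w j x = 0 by rewrite /w indicE memNset //= mulr0n rmorph0 mul0r.
  exists 0 => k; rewrite !w0 subrr mul0r.
  by rewrite /= expr0n /= addr0 sqrtr0.
have cRe x : cvgn (fun k => complex.Re (w k x)).
  have [c cP] := wcv x; apply: (@cvg_of_geometric_increments (fun k =>
    complex.Re (w k x)) c) => k.
  apply: le_trans (cP k); apply: le_trans (normc_Re _).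
  by case: (w k.+1 x) (w k x) => ? ? [].
have cIm x : cvgn (fun k => complex.Im (w k x)).
  have [c cP] := wcv x; apply: (@cvg_of_geometric_increments (fun k =>
    complex.Im (w k x)) c) => k.
  apply: le_trans (cP k); apply: le_trans (normc_Im _).
  by case: (w k.+1 x) (w k x) => ? ? [].
pose f x := Complex (limn (fun k => complex.Re (w k x))) (limn (fun k => complex.Im (w k x))).
have mf : cmeasurable f.
  split; [apply: (@measurable_fun_cvg _ _ _ _ (fun k x => complex.Re (w k x)))
         |apply: (@measurable_fun_cvg _ _ _ _ (fun k x => complex.Im (w k x)))].
  - by move=> k; have [] := mw k.
  - by move=> x _; exact: cRe.
  - by move=> k; have [] := mw k.
  - by move=> x _; exact: cIm.
exists f => // e e0; have [N uN] := uc e e0; exists N => i Ni.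
pose g k x := (1 * normc (u i x - w k x) ^+ 2)%:E.
have mg k : measurable_fun setT (g k) by apply: measurable_wsq => //; exact: cmeasurableB.
have g0 k x : (0 <= g k x)%E by rewrite lee_fin mulr_ge0 ?sqr_ge0.
have gE k : (\int[mu]_x g k x = N2 (fun x => (u i x - u (m k) x)%R))%E.
  apply: ae_eq_integral => //; first by apply: measurable_wsq => //; exact: cmeasurableB.
  exists (~` E); split=> //; first exact: measurableC.
  move=> x /= xn Ex; apply: xn => _; rewrite /g /w indicE mem_set //.
  by rewrite [_%:C%C * _]mul1r.
have gf x : limn_einf (g^~ x) = (1 * normc (u i x - f x) ^+ 2)%:E.
  have gl : g^~ x @ \oo --> (1 * normc (u i x - f x) ^+ 2)%:E.
    apply: cvg_EFin; first by near=> k.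
    rewrite /= !mul1r.
    have -> : fine \o g^~ x = (fun k => (complex.Re (u i x) - complex.Re (w k x)) ^+ 2 +
        (complex.Im (u i x) - complex.Im (w k x)) ^+ 2).
      apply/funext => k; rewrite /g /= mul1r normc2_ReIm.
      by case: (u i x) (w k x) => ? ? [].
    rewrite normc2_ReIm; have -> : u i x - f x = Complex (complex.Re (u i x) - complex.Re (f x))
      (complex.Im (u i x) - complex.Im (f x)).
      by case: (u i x) (f x) => ? ? [].
    rewrite /=; apply: cvgD; rewrite expr2; under eq_fun do rewrite expr2;
      apply: cvgM; apply: cvgB => //; try exact: cvg_cst; by [exact: cRe|exact: cIm].
  by rewrite (is_cvg_limn_einfE (cvgP _ gl)); exact: cvg_lim.
have -> : N2 (fun x => (u i x - f x)%R) = (\int[mu]_x limn_einf (g^~ x))%E.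
  by apply: eq_integral => x _; rewrite gf.
apply: le_trans (fatou _ measurableT mg (fun k x _ => g0 k x)) _.
rewrite limn_einf_lim; apply: lime_le; first exact: is_cvg_einfs.
apply: nearW => k; apply: le_trans (ltW (uN i (m (maxn k N)) Ni _)).
  rewrite -gE; apply: ereal_inf_lbound; exists (maxn k N) => //=.
  by rewrite leq_maxl.
by apply: leq_trans (mk _); rewrite leq_maxr.
Unshelve. all: by end_near. Qed.

End ComplexL2.

(** * Schwartz-Bruhat functions and Sobolev weights *)

Section Sobolev.
Variables (R : realType) (p : nat) (p_pr : prime p) (n : nat).
Variable mu : {measure set (BorelQp p_pr n) -> \bar R}.
Hypothesis haar_mu : haar_measure mu.
Variables (d : nat) (w : 'I_n -> nat).
Local Notation K := (Qp p_pr).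
Local Notation V := 'rV[Qp p_pr]_n.
Local Notation VB := (BorelQp p_pr n).
Local Notation pabs := (@pabs p p_pr).
Local Notation C := R[i].
Local Notation grid N a := (@grid p p_pr n N a).
Local Notation vol := (@vol R p n).
Local Notation fourier := (fourier mu).
Local Notation normc := ComplexField.Normc.normc.
Local Notation wint := (@wsq_int _ (BorelQp p_pr n) R mu).
Local Notation N2 := (wint (fun=> 1%R)).
Implicit Types (x y h xi : V) (f g : V -> C).

Lemma closed_cball N : closed (cball (p%:Q ^+ N) : set V).
Proof.
rewrite -openC; apply: open_QpV => x xN; exists 0%N => h h0 /(cballDr x) xhN.
apply: xN; apply/xhN; apply: cball_mono h0; exact: (pexpV_le_pexp p_pr).
Qed.

Lemma compact_support N g : (forall x, ~ cball (p%:Q ^+ N) x -> g x = 0) ->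
  compact (closure [set x | g x != 0]).
Proof.
move=> gN; apply: (@subclosed_compact _ _ (cball (p%:Q ^+ N))).
- exact: closed_closure.
- exact: cball_compact.
- rewrite [X in _ `<=` X]((closure_id _).1 (@closed_cball N)).
  apply: closure_subset => x /= gx; apply: contrapT => /gN g0.
  by move: gx; rewrite g0 eqxx.
Qed.

Lemma level_schwartz_bruhat N g : level N g -> schwartz_bruhat g.
Proof.
move=> [gN hN]; split=> [x|]; last exact: compact_support gN.
by apply/nbhs_QpV; exists N => h /hN.
Qed.

(** Compactness of a ball containing the support makes the scale of local constancy uniform on it;
    outside this ball, small translations stay outside and g vanishes. *)
Lemma schwartz_bruhat_level g : schwartz_bruhat g -> exists N, level N g.
Proof.
move=> [gl gc]; have [M gM] := compact_cball gc.
have g0 x : ~ cball (p%:Q ^+ M) x -> g x = 0.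
  move=> xM; apply: contrapT => /eqP gx; apply: xM; apply: gM.
  exact: subset_closure.
have := @cball_compact p p_pr n M; rewrite compact_near_coveringP.
move=> /(_ nat \oo (fun N x => forall h, cball (p%:Q ^- N) h -> g (x + h) = g x)) [].
  move=> x _; have /nbhs_QpV[k kx] := gl x.
  exists ([set y : V | cball (p%:Q ^- k) (y - x)], [set N | (k <= N)%N]) => /=.
    split; last by exists k.
    by apply/nbhs_QpV; exists k => h hk /=; rewrite addrAC subrr add0r.
  move=> [y N] /= [yx kN] h hN.
  have yE z : cball (p%:Q ^- k) (z - x) -> g z = g x.
    by move=> /kx; rewrite subrKC.
  rewrite !yE // addrAC; apply: cballD => //.
  by apply: cball_mono hN; exact: (pexpV_le p_pr).
move=> N _ /(_ N (leqnn N)) /= HN; exists (maxn N M); split.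
  move=> x xNM; apply: g0 => xM; apply: xNM; apply: cball_mono xM.
  by apply: (pexp_le p_pr); rewrite leq_maxr.
move=> x h hh; have hN : cball (p%:Q ^- N) h.
  by apply: cball_mono hh; apply: (pexpV_le p_pr); rewrite leq_maxl.
have [xM|xM] := pselect (cball (p%:Q ^+ M) x); first exact: HN.
rewrite !g0 // => /(cballDr x) H; apply: xM; apply/H.
by apply: cball_mono hh; exact: (pexpV_le_pexp p_pr).
Qed.

Lemma Qp_abs_ge0 (x : K) : 0 <= Qp_abs R x.
Proof. by rewrite /Qp_abs ler0q pabs_ge0. Qed.

(** The preimage of an open half-line ]r, +oo[ is open: it is everything if r < 0, and otherwise it
    avoids the zeros of the coordinate, near whose other values the absolute value is locally
    constant. *)
Lemma measurable_Qp_abs i : measurable_fun setT (fun x : VB => Qp_abs R (x 0 i)).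
Proof.
apply: (measurability _ (RGenOInfty.measurableE R)) => //.
move=> /= _ [_ [r ->] <-]; rewrite setTI; apply: open_measurable_QpV; apply: open_QpV => x /=.
rewrite in_itv /= andbT => rx.
have [r0|r0] := ltP r 0.
  by exists 0%N => h _; rewrite /preimage /= in_itv /= andbT (lt_le_trans r0) // Qp_abs_ge0.
have x0 : 0 < pabs (x 0 i) by rewrite -(ltr0q R) (le_lt_trans r0).
have [k kx] := pexp_small p_pr x0; exists k => h hk.
rewrite /preimage /= in_itv /= andbT /Qp_abs mxE pabsD_eq //.
by apply: le_lt_trans kx; exact: hk.
Qed.

Lemma measurable_Xi : measurable_fun setT (Xi R d w : VB -> R).
Proof.
apply: measurable_sum => i.
exact: (measurableT_comp (measurable_powR _) (measurable_Qp_abs i)).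
Qed.

Definition sweight (beta : R) (xi : V) : R := Num.max 1 (Xi R d w xi) `^ (2 * beta).

Lemma sweight_ge0 beta xi : 0 <= sweight beta xi.
Proof. exact: powR_ge0. Qed.

Lemma measurable_sweight beta : measurable_fun setT (sweight beta : VB -> R).
Proof.
apply: (measurableT_comp (measurable_powR _)); apply: measurable_maxr.
  exact: measurable_cst.
exact: measurable_Xi.
Qed.

Lemma sweight_ge1 beta xi : 0 <= beta -> 1 <= sweight beta xi.
Proof.
move=> b0; rewrite -[leLHS](powRr0 (Num.max 1 (Xi R d w xi))).
by apply: ler_powR; rewrite ?le_max ?lexx // mulr_ge0.
Qed.

Lemma le_sweight beta beta' xi : beta <= beta' -> sweight beta xi <= sweight beta' xi.
Proof. by move=> bb; apply: ler_powR; rewrite ?le_max ?lexx // ler_pM2l. Qed.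

Lemma sweight_bounded beta N : 0 <= beta ->
  exists2 B, 0 <= B & forall xi, cball (p%:Q ^+ N) xi -> sweight beta xi <= B.
Proof.
move=> b0; pose X := \sum_(i < n) (p%:R ^+ N : R) `^ (d%:R / (w i)%:R).
exists (Num.max 1 X `^ (2 * beta)); first exact: powR_ge0.
move=> xi xiN.
have XX : Xi R d w xi <= X.
  apply: ler_sum => i _; apply: ge0_ler_powR;
    rewrite ?nnegrE ?Qp_abs_ge0 ?divr_ge0 ?exprn_ge0 ?ler0n //.
  by have := xiN i; rewrite -(ler_rat R) rmorphXn /= ratr_int.
have m0 (z : R) : 0 <= Num.max 1 z by rewrite le_max ler01.
apply: ge0_ler_powR; rewrite ?nnegrE ?m0 ?mulr_ge0 //.
by rewrite ge_max; apply/andP; split; rewrite le_max ?lexx ?XX ?orbT.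
Qed.

Lemma level_cmeasurable N g : level N g -> cmeasurable (g : VB -> C).
Proof.
move=> [gN hN]; split; apply: (@level_measurable _ _ _ _ _ N).
  by split=> [x /gN ->|x h /hN ->].
by split=> [x /gN ->|x h /hN ->].
Qed.

Lemma level_N2 N g : level N g -> N2 g = (vol N * \sum_a normc (g (grid N a)) ^+ 2)%:E.
Proof.
move=> [gN hN]; rewrite -(@ge0_level_integral _ _ _ _ _ haar_mu N (fun x => normc (g x) ^+ 2)).
- by apply: eq_integral => x _; rewrite mul1r.
- split=> [x /gN ->|x h /hN -> //]; first by rewrite /= expr0n /= addr0 sqrtr0 expr0n.
- by move=> x; exact: sqr_ge0.
Qed.

Lemma level_wint_lty N g beta : 0 <= beta -> level N g -> (wint (sweight beta) g < +oo)%E.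
Proof.
move=> b0 gl; have [B B0 HB] := sweight_bounded N b0.
have mg := level_cmeasurable gl.
have mB c : measurable_fun [set: VB] (fun=> c : R) by exact: measurable_cst.
apply: (@le_lt_trans _ _ (wint (fun=> B) g)).
  apply: le_wint => //; [exact: sweight_ge0|exact: measurable_sweight|].
  move=> x; have [xN|xN] := pselect (cball (p%:Q ^+ N) x).
    by rewrite ler_wpM2r ?sqr_ge0 // HB.
  by rewrite gl.1 // /= expr0n /= addr0 sqrtr0 expr0n /= !mulr0.
rewrite (wintM (W := fun=> 1) mu _ (mB 1) mg B0); last by move=> x; rewrite mulr1.
  by rewrite (level_N2 gl) -EFinM ltry.
by move=> x; exact: ler01.
Qed.

Lemma sobolevE beta phi : sobolev_norm mu d w beta phi = Num.sqrt (fine (wint (sweight beta)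
  (fourier phi))).
Proof. by []. Qed.

Lemma levelD N f g : level N f -> level N g -> level N (f + g).
Proof.
move=> fl gl; split=> [x xN|x h hN]; rewrite -![(f + g) _]/(f _ + g _).
  by rewrite fl.1 // gl.1 // addr0.
by rewrite fl.2 // gl.2.
Qed.

Lemma levelZ N (a : C) f : level N f -> level N (a *: f).
Proof.
move=> fl; split=> [x xN|x h hN]; rewrite -![(a *: f) _]/(a * f _).
  by rewrite fl.1 // mulr0.
by rewrite fl.2.
Qed.

Lemma fourierD N f g : level N f -> level N g -> fourier (f + g) = fourier f + fourier g.
Proof.
move=> fl gl; apply/funext => xi; rewrite -[(fourier f + _) _]/(fourier f xi + fourier g xi).
have [xiN|xiN] := pselect (cball (p%:Q ^+ N) xi); last first.
  by rewrite !(level_fourier_out haar_mu (N := N)) ?addr0 //; exact: levelD.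
rewrite !(fourier_in haar_mu (N := N)) //; last exact: levelD.
rewrite -mulrDr -big_split /=; congr (_ * _); apply: eq_bigr => a _.
by rewrite -mulrDr.
Qed.

Lemma fourierZ N (a : C) f : level N f -> fourier (a *: f) = a *: fourier f.
Proof.
move=> fl; apply/funext => xi; rewrite -[(a *: fourier f) _]/(a * fourier f xi).
have [xiN|xiN] := pselect (cball (p%:Q ^+ N) xi); last first.
  by rewrite !(level_fourier_out haar_mu (N := N)) ?mulr0 //; exact: levelZ.
rewrite !(fourier_in haar_mu (N := N)) //; last exact: levelZ.
rewrite [RHS]mulrCA [X in _ = _ * X]mulr_sumr; congr (_ * _); apply: eq_bigr => b _.
by rewrite mulrCA.
Qed.

Lemma plancherel N g : level N g -> N2 (fourier g) = N2 g.
Proof.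
move=> gl; rewrite (level_N2 (level_fourier haar_mu gl)) (level_N2 gl).
by rewrite (plancherel_grid haar_mu gl).
Qed.

End Sobolev.

(** * Completions *)

Section Completion.
Variables (R : realType) (p : nat) (p_pr : prime p) (n : nat).
Variable mu : {measure set (BorelQp p_pr n) -> \bar R}.
Hypothesis haar_mu : haar_measure mu.
Variables (d : nat) (w : 'I_n -> nat) (M0 : nat).
Local Notation V := 'rV[Qp p_pr]_n.
Local Notation VB := (BorelQp p_pr n).
Local Notation C := R[i].
Local Notation fourier := (fourier mu).
Local Notation normc := ComplexField.Normc.normc.
Local Notation wint := (@wsq_int _ (BorelQp p_pr n) R mu).
Local Notation N2 f := (wint (fun=> 1%R) f).
Local Notation sn := (sobolev_norm mu d w).
Local Notation sw := (@sweight R p p_pr n d w).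
Local Notation Phi := (Phi mu M0).
Implicit Types (f g phi psi : V -> C) (u v : nat -> V -> C) (beta : R).

Lemma N2E f : N2 f = (\int[mu]_x (normc (f x) ^+ 2)%:E)%E.
Proof. by apply: eq_integral => x _; rewrite mul1r. Qed.

Lemma L2_cvgP u f : L2_cvg mu u f <->
  forall e : R, 0 < e -> exists N, forall k, (N <= k)%N -> (N2 (fun x =>
    (u k x - f x)%R) <= e%:E)%E.
Proof.
split=> [uf e e0|H].
  have : nbhs (0%E : \bar R) [set z | (z < e%:E)%E].
    by apply: open_nbhs_nbhs; split; [exact: open_ereal_lt_ereal|rewrite /= lte_fin].
  by move=> /uf [N _ NP]; exists N => k /NP /= /ltW; rewrite N2E.
apply: limn_esup_le_cvg => [|k]; last by apply: integral_ge0 => x _; rewrite lee_fin sqr_ge0.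
apply/lee_addgt0Pr => e e0; rewrite add0e limn_esup_lim.
have [N NP] := H e e0; apply: lime_le; first exact: is_cvg_esups.
exists N => // k /= Nk; apply: ub_ereal_sup => _ [j /= kj <-].
by rewrite -N2E NP // (leq_trans Nk).
Qed.

Lemma Phi_level phi : Phi phi -> exists N, level N phi.
Proof. by move=> [/schwartz_bruhat_level]. Qed.

Lemma level_common f g : (exists N, level N f) -> (exists N, level N g) ->
  exists N, level N f /\ level N g.
Proof.
move=> [N fN] [M gM]; exists (maxn N M); split.
  by apply: level_mono fN; rewrite leq_maxl.
by apply: level_mono gM; rewrite leq_maxr.
Qed.

Lemma PhiZD a phi psi : Phi phi -> Phi psi -> Phi (a *: phi + psi).
Proof.
move=> Pf Pg; have [N [fl gl]] := level_common (Phi_level Pf) (Phi_level Pg).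
have afl := levelZ a fl.
split; first by apply: (level_schwartz_bruhat (N := N)); exact: levelD.
move=> xi xiM; rewrite (fourierD haar_mu afl gl) (fourierZ haar_mu _ fl).
by rewrite -[LHS]/(a * fourier phi xi + fourier psi xi) Pf.2 // Pg.2 // mulr0 addr0.
Qed.

Lemma PhiB phi psi : Phi phi -> Phi psi -> Phi (phi - psi).
Proof.
move=> Pf Pg; have -> : phi - psi = -1 *: psi + phi by rewrite scaleN1r addrC.
exact: PhiZD.
Qed.

Lemma Phi_cmeasurable phi : Phi phi -> cmeasurable (phi : VB -> C).
Proof. by move=> /Phi_level[N]; exact: level_cmeasurable. Qed.

Lemma Phi_fourier_level phi : Phi phi -> exists N, level N (fourier phi).
Proof. by move=> /Phi_level[N /(level_fourier haar_mu)]; exists N. Qed.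

Lemma Phi_fourierB phi psi : Phi phi -> Phi psi ->
  fourier (phi - psi) = fourier phi - fourier psi.
Proof.
move=> Pf Pg; have [N [fl gl]] := level_common (Phi_level Pf) (Phi_level Pg).
have -> : phi - psi = -1 *: psi + phi by rewrite scaleN1r addrC.
by rewrite (fourierD haar_mu (levelZ _ gl) fl) (fourierZ haar_mu _ gl) scaleN1r addrC.
Qed.

Lemma Phi_wint_lty beta phi : 0 <= beta -> Phi phi -> (wint (sw beta) (fourier phi) < +oo)%E.
Proof. by move=> b0 /Phi_fourier_level[N]; exact: level_wint_lty. Qed.

Lemma Phi_fourier_cmeasurable phi : Phi phi -> cmeasurable (fourier phi : VB -> C).
Proof. by move=> /Phi_fourier_level[N]; exact: level_cmeasurable. Qed.

Lemma sn_ge0 beta phi : 0 <= sn beta phi.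
Proof. exact: sqrtr_ge0. Qed.

Lemma wint_fin_num W f : (forall x, 0 <= W x) -> (wint W f < +oo)%E -> wint W f \is a fin_num.
Proof. by move=> W0 fin; rewrite ge0_fin_numE // wint_ge0. Qed.

Lemma sn_sqr beta phi : 0 <= beta -> Phi phi ->
  wint (sw beta) (fourier phi) = (sn beta phi ^+ 2)%:E.
Proof.
move=> b0 Pf; rewrite sobolevE sqr_sqrtr ?fine_ge0 ?wint_ge0 //; try exact: sweight_ge0.
by rewrite fineK // wint_fin_num ?Phi_wint_lty //; exact: sweight_ge0.
Qed.

Lemma snZ beta a phi : 0 <= beta -> Phi phi -> sn beta (a *: phi) = normc a * sn beta phi.
Proof.
move=> b0 Pf; have [N fl] := Phi_level Pf.
rewrite sobolevE (fourierZ haar_mu a fl) /wsq_int.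
have -> : (\int[mu]_x (sw beta x * normc ((a *: fourier phi) x) ^+ 2)%:E =
           wint (fun x => normc a ^+ 2 * sw beta x)%R (fourier phi))%E.
  apply: eq_integral => x _; congr _%:E; rewrite -[(a *: _) x]/(a * fourier phi x).
  by rewrite ComplexField.Normc.normcM exprMn; ring.
rewrite (wintM mu (@sweight_ge0 _ _ _ _ _ _ _) (measurable_sweight _ _ _)
  (Phi_fourier_cmeasurable Pf) (sqr_ge0 (normc a)) (fun=> erefl)).
rewrite sn_sqr // -EFinM /= -exprMn sqrtr_sqr ger0_norm // mulr_ge0 ?sn_ge0 //.
exact: normc_ge0.
Qed.

Lemma snD beta phi psi : 0 <= beta -> Phi phi -> Phi psi ->
  sn beta (phi + psi) <= sn beta phi + sn beta psi.
Proof.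
move=> b0 Pf Pg; have [N [fl gl]] := level_common (Phi_level Pf) (Phi_level Pg).
rewrite !sobolevE (fourierD haar_mu fl gl).
apply: wint_triangle.
- exact: sweight_ge0.
- exact: measurable_sweight.
- exact: Phi_fourier_cmeasurable.
- exact: Phi_fourier_cmeasurable.
- exact: Phi_wint_lty.
- exact: Phi_wint_lty.
Qed.

Lemma sn_sym beta phi psi : 0 <= beta -> Phi phi -> Phi psi ->
  sn beta (phi - psi) = sn beta (psi - phi).
Proof.
move=> b0 Pf Pg; rewrite -opprB -scaleN1r snZ //; last exact: PhiB.
by rewrite /= oppr0 expr0n /= addr0 sqrtr_sqr normrN normr1 mul1r.
Qed.

Lemma sn_dist beta phi psi : 0 <= beta -> Phi phi -> Phi psi ->
  `|sn beta phi - sn beta psi| <= sn beta (phi - psi).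
Proof.
move=> b0 Pf Pg; rewrite ler_norml; apply/andP; split.
  rewrite lerNl opprB lerBlDr sn_sym //.
  by rewrite -{1}[psi](subrK phi); apply: snD => //; exact: PhiB.
rewrite lerBlDr; rewrite -{1}[phi](subrK psi); apply: snD => //; exact: PhiB.
Qed.

Lemma sn_mono beta beta' phi : 0 <= beta -> beta <= beta' -> Phi phi ->
  sn beta phi <= sn beta' phi.
Proof.
move=> b0 bb Pf; have b0' := le_trans b0 bb.
rewrite !sobolevE; apply: ler_wsqrtr; apply: fine_le.
- by rewrite wint_fin_num ?Phi_wint_lty //; exact: sweight_ge0.
- by rewrite wint_fin_num ?Phi_wint_lty //; exact: sweight_ge0.
apply: le_wint.
- exact: sweight_ge0.
- exact: measurable_sweight.
- exact: measurable_sweight.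
- exact: Phi_fourier_cmeasurable.
- exact: Phi_fourier_cmeasurable.
- by move=> x; rewrite ler_wpM2r ?sqr_ge0 // le_sweight.
Qed.

Lemma N2_le_sn beta phi : 0 <= beta -> Phi phi -> (N2 phi <= (sn beta phi ^+ 2)%:E)%E.
Proof.
move=> b0 Pf; have [N fl] := Phi_level Pf.
rewrite -(plancherel haar_mu fl) -sn_sqr //; apply: le_wint.
- by move=> x; exact: ler01.
- exact: measurable_cst.
- exact: measurable_sweight.
- exact: Phi_fourier_cmeasurable.
- exact: Phi_fourier_cmeasurable.
- by move=> x; rewrite ler_wpM2r ?sqr_ge0 // sweight_ge1.
Qed.

Lemma N2_addl f g : cmeasurable (f : VB -> C) -> cmeasurable (g : VB -> C) ->
  (N2 (fun x => (f x + g x)%R) <= 2%:E * N2 f + 2%:E * N2 g)%E.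
Proof.
move=> mf mg; have := @wint_split _ _ _ mu (fun=> 1) f g 1 (fun=> ler01) _ mf mg ltr01.
rewrite invr1 => H; exact: H (measurable_cst _).
Qed.

Lemma N2_sym f g : N2 (fun x => (f x - g x)%R) = N2 (fun x => (g x - f x)%R).
Proof.
apply: eq_integral => x _; congr (_ * _)%:E; rewrite -opprB.
by case: (g x - f x) => a b; rewrite !normc2_ReIm /= !sqrrN.
Qed.

Lemma N2_zero f : (forall e : R, 0 < e -> (N2 f <= e%:E)%E) -> N2 f = 0%E.
Proof.
move=> H; apply/eqP; rewrite eq_le wint_ge0 ?andbT //.
by apply/lee_addgt0Pr => e /H; rewrite add0e.
Qed.

Lemma L2_cvg_unique u f g : (forall k, cmeasurable (u k : VB -> C)) ->
  cmeasurable (f : VB -> C) -> cmeasurable (g : VB -> C) ->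
  L2_cvg mu u f -> L2_cvg mu u g -> aeclass mu f = aeclass mu g.
Proof.
move=> mu_ mf mg /L2_cvgP uf /L2_cvgP ug; apply/aeclassP.
have mfg := cmeasurableB mf mg.
have : N2 (fun x => (f x - g x)%R) = 0%E.
  apply: N2_zero => e e0; have e4 : 0 < e / 4 by rewrite divr_gt0.
  have [[N NP] [M MP]] := (uf _ e4, ug _ e4).
  pose k := maxn N M; have -> : (fun x => (f x - g x)%R) = (fun x =>
    (f x - u k x) + (u k x - g x)).
    by apply/funext => x; rewrite addrA subrK.
  apply: le_trans (N2_addl (cmeasurableB mf (mu_ k)) (cmeasurableB (mu_ k) mg)) _.
  have -> : e%:E = (2%:E * (e / 4)%:E + 2%:E * (e / 4)%:E)%E by rewrite -!EFinM -EFinD;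
    congr _%:E; field.
  have Nk : (N <= k)%N by rewrite leq_maxl.
  have Mk : (M <= k)%N by rewrite leq_maxr.
  apply: leeD; apply: lee_wpmul2l; rewrite ?lee_fin //; last exact: MP.
  by rewrite N2_sym; exact: NP.
move=> /(wint_eq0 mfg); apply: filterS => x; exact: subr0_eq.
Qed.

(** Makes explicit the approximating sequence hidden in [Htilde], so that norms and operators can be
    computed along it. *)
Definition hconv beta u (x : aefun mu) := exists f, [/\ x = aeclass mu f,
  sq_integrable mu f & approximates mu d w M0 beta u f].

Lemma HtildeP beta x : Htilde d w M0 beta x <-> exists u, hconv beta u x.
Proof.
by split=> [[f [u H]]|[u [f H]]]; [exists u, f|exists f, u].
Qed.

Lemma hconv_Phi beta u x k : hconv beta u x -> Phi (u k).
Proof. by move=> [f [_ _ []]]. Qed.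

(** The L^2 limit alone determines the class, so one sequence has the same limit at two different
    indices. *)
Lemma hconv_unique beta beta' u x y : hconv beta u x -> hconv beta' u y -> x = y.
Proof.
move=> [f [-> [mrf mif _] [Pu _ uf]]] [g [-> [mrg mig _] [_ _ ug]]].
by apply: L2_cvg_unique uf ug => // k; exact: Phi_cmeasurable.
Qed.

Lemma hconv_mono beta beta' u x : 0 <= beta -> beta <= beta' -> hconv beta' u x -> hconv beta u x.
Proof.
move=> b0 bb [f [xf sf [Pu uc uf]]]; exists f; split; [exact: xf|exact: sf|].
split; [exact: Pu| |exact: uf] => e /uc[N NP].
exists N => i j Ni Nj; apply: le_lt_trans (NP i j Ni Nj).
by apply: sn_mono => //; exact: PhiB.
Qed.

Definition sn_cauchy beta u := forall e, 0 < e -> exists N, forall i j, (N <= i)%N ->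
  (N <= j)%N ->
  sn beta (u i - u j) < e.

(** For beta >= 0 the weight is at least 1, so by Plancherel the Sobolev norm dominates the L^2
    norm, and completeness of L^2 provides the limit. *)
Lemma sn_cauchy_cvg beta u : 0 <= beta -> (forall k, Phi (u k)) -> sn_cauchy beta u ->
  exists x, hconv beta u x.
Proof.
move=> b0 Pu uc; have mu_ k : cmeasurable (u k : VB -> C) by exact: Phi_cmeasurable.
have [|f mf fP] := @wint_complete _ _ _ mu u mu_.
  move=> e e0; have [|N NP] := uc (Num.sqrt e); first by rewrite sqrtr_gt0.
  exists N => i j Ni Nj; apply: le_lt_trans (N2_le_sn b0 (PhiB (Pu i) (Pu j))) _.
  rewrite lte_fin -[ltRHS]sqr_sqrtr ?ltW // ltr_sqr ?nnegrE ?sn_ge0 ?sqrtr_ge0 //.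
  exact: NP.
exists (aeclass mu f), f; split => //; last first.
  split => //; apply/L2_cvgP => e /fP[N NP]; exists N => k; exact: NP.
have [N NP] := fP 1 ltr01; case: (mf) => rf jf; split => //; rewrite -N2E.
have -> : f = (fun x => (f x - u N x) + u N x) by apply/funext => x; rewrite subrK.
apply: le_lt_trans (N2_addl (cmeasurableB mf (mu_ N)) (mu_ N)) _.
apply: (@le_lt_trans _ _ (2%:E * 1%:E + 2%:E * (sn beta (u N) ^+ 2)%:E)%E).
  apply: leeD; apply: lee_wpmul2l; rewrite ?lee_fin // ?N2_le_sn //.
  by rewrite N2_sym NP.
by rewrite -!EFinM -EFinD ltry.
Qed.

(* On a ball containing the support of the Fourier transform of u_k, the weight is
   bounded, so that the weighted norm of u_l restricted to this ball tends to 0 with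
   the L^2 norm of u_l. *)
Lemma sn_closable beta u : 0 <= beta -> (forall k, Phi (u k)) -> sn_cauchy beta u ->
  (forall e : R, 0 < e -> exists N, forall k, (N <= k)%N -> (N2 (u k) <= e%:E)%E) ->
  forall e, 0 < e -> exists N, forall k, (N <= k)%N -> sn beta (u k) <= e.
Proof.
move=> b0 Pu uc u0 e e0; have e2 : 0 < e / 2 by rewrite divr_gt0.
have [N NP] := uc _ e2; exists N => k Nk.
have [M kM] := Phi_fourier_level (Pu k).
have [B B0 HB] := sweight_bounded p_pr d w M b0.
(* With k fixed, the weight is cut off outside a ball that carries the transform of u_k: this leaves
   the norm of u_k unchanged and bounds the weight. *)
pose W (x : V) := sw beta x * \1_(cball (p%:Q ^+ M)) x.
have mcb : measurable (cball (p%:Q ^+ M) : set VB).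
  by apply: measurable_cball; rewrite exprn_gt0 // (pQ_gt0 p_pr).
have W0 x : 0 <= W x by rewrite mulr_ge0 ?sweight_ge0.
have mW : measurable_fun setT (W : VB -> R).
  by apply: measurable_funM; [exact: measurable_sweight|exact: measurable_indic].
have Wsw x : W x <= sw beta x.
  by rewrite ler_piMr ?sweight_ge0 // indicE; case: (_ \in _).
have WB x : W x <= B.
  rewrite /W indicE; have [xM|xM] := pselect (cball (p%:Q ^+ M) x).
    by rewrite mem_set // mulr1 HB.
  by rewrite memNset // mulr0.
have mfu i : cmeasurable (fourier (u i) : VB -> C) by exact: Phi_fourier_cmeasurable.
have kW : wint W (fourier (u k)) = wint (sw beta) (fourier (u k)).
  apply: eq_integral => x _; congr _%:E; have [xM|xM] := pselect (cball (p%:Q ^+ M) x).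
    by rewrite /W indicE mem_set // mulr1.
  by rewrite kM.1 // /= expr0n /= addr0 sqrtr0 expr0n /= !mulr0.
have Wfin (g : V -> C) : cmeasurable (g : VB -> C) -> (wint (sw beta) g < +oo)%E ->
  (wint W g < +oo)%E.
  move=> mg; apply: le_lt_trans; apply: le_wint => //; first exact: measurable_sweight.
  by move=> x; rewrite ler_wpM2r ?sqr_ge0.
apply/ler_addgt0Pr => h h0.
have hB' : 0 < (e / 2) ^+ 2 / (B + 1) by rewrite divr_gt0 ?exprn_gt0 // ltr_wpDl.
(* The index l depends on k through the bound B, but the resulting bound e on the norm of u_k does
   not. *)
have [L LP] := u0 _ hB'; pose l := maxn N L.
have Nl : (N <= l)%N by rewrite leq_maxl.
have Ll : (L <= l)%N by rewrite leq_maxr.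
have splitk : fourier (u k) = (fun x => fourier (u k - u l) x + fourier (u l) x).
  by apply/funext => x; rewrite Phi_fourierB //
    -[(_ - _) x]/(fourier (u k) x - fourier (u l) x) subrK.
rewrite sobolevE -kW splitk.
have Pkl := PhiB (Pu k) (Pu l).
apply: (@le_trans _ _ (Num.sqrt (fine (wint W (fourier (u k - u l)))) +
    Num.sqrt (fine (wint W (fourier (u l)))))).
  apply: wint_triangle; [exact: W0|exact: mW|exact: Phi_fourier_cmeasurable|exact: mfu| |].
    by apply: Wfin; [exact: Phi_fourier_cmeasurable|exact: Phi_wint_lty].
  by apply: Wfin; [exact: mfu|exact: Phi_wint_lty].
apply: (@le_trans _ _ (e / 2 + e / 2)); last first.
  by rewrite -splitr lerDl ltW.
apply: lerD.
  apply: le_trans (ltW (NP k l Nk Nl)); rewrite sobolevE; apply: ler_wsqrtr.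
  have mkl := Phi_fourier_cmeasurable Pkl.
  have fkl := Phi_wint_lty b0 Pkl.
  apply: fine_le.
  - apply: wint_fin_num; [exact: W0|exact: Wfin].
  - apply: wint_fin_num; [exact: sweight_ge0|exact: fkl].
  - apply: le_wint; [exact: W0|exact: mW|exact: measurable_sweight|exact: mkl|exact: mkl|].
    by move=> x; rewrite ler_wpM2r ?sqr_ge0.
have -> : e / 2 = Num.sqrt ((e / 2) ^+ 2) by rewrite sqrtr_sqr ger0_norm // ltW.
apply: ler_wsqrtr.
rewrite -lee_fin fineK; last by rewrite wint_fin_num // Wfin // Phi_wint_lty.
have [N1 l1] := Phi_level (Pu l).
apply: (@le_trans _ _ (wint (fun=> B + 1) (fourier (u l)))).
  apply: le_wint; [exact: W0|exact: mW|exact: measurable_cst|exact: mfu|exact: mfu|].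
  by move=> x; rewrite ler_wpM2r ?sqr_ge0 // (le_trans (WB x)) // lerDl.
have m1 : measurable_fun [set: VB] (fun=> 1 : R) by exact: measurable_cst.
rewrite (wintM (W := fun=> 1) mu _ m1 (mfu l) (c := B + 1)).
- rewrite (plancherel haar_mu l1); apply: le_trans (lee_wpmul2l _ (LP l Ll)) _.
    by rewrite lee_fin addr_ge0.
  by rewrite -EFinM mulrC divfK // gt_eqF // ltr_wpDl.
- by move=> x; exact: ler01.
- by rewrite addr_ge0.
- by move=> x; rewrite mulr1.
Qed.

End Completion.

(** * Norm and linear structure of the completions *)

Section CompletionNorm.
Variables (R : realType) (p : nat) (p_pr : prime p) (n : nat).
Variable mu : {measure set (BorelQp p_pr n) -> \bar R}.
Hypothesis haar_mu : haar_measure mu.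
Variables (d : nat) (w : 'I_n -> nat) (M0 : nat).
Local Notation V := 'rV[Qp p_pr]_n.
Local Notation VB := (BorelQp p_pr n).
Local Notation C := R[i].
Local Notation normc := ComplexField.Normc.normc.
Local Notation wint := (@wsq_int _ (BorelQp p_pr n) R mu).
Local Notation N2 f := (wint (fun=> 1%R) f).
Local Notation sn := (sobolev_norm mu d w).
Local Notation Phi := (Phi mu M0).
Local Notation hconv := (hconv d w M0).
Local Notation Hnorm := (@Hnorm _ _ _ _ mu d w M0).
Implicit Types (f g phi psi : V -> C) (u v : nat -> V -> C) (beta : R).

Lemma sq_integrableP f : sq_integrable mu f <-> cmeasurable (f : VB -> C) /\ (N2 f < +oo)%E.
Proof.
by rewrite N2E; split=> [[mr mi fi]|[[mr mi] fi]]; split => //; split.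
Qed.

Lemma N2_ae f g : cmeasurable (f : VB -> C) -> cmeasurable (g : VB -> C) ->
  {ae mu, forall x : VB, f x = g x} -> N2 f = N2 g.
Proof.
move=> mf mg fg; have m1 : measurable_fun [set: VB] (fun=> 1 : R) by exact: measurable_cst.
apply: ae_eq_integral; [exact: measurableT|exact: measurable_wsq|exact: measurable_wsq|].
by apply: filterS fg => x -> _.
Qed.

Lemma N2Z a f : cmeasurable (f : VB -> C) -> N2 (fun x =>
  (a * f x)%R) = ((normc a ^+ 2)%:E * N2 f)%E.
Proof.
move=> mf; have m1 : measurable_fun [set: VB] (fun=> 1 : R) by exact: measurable_cst.
rewrite -(wintM (W' := fun=> normc a ^+ 2) mu (fun=> ler01) m1 mf (sqr_ge0 _)); last first.
  by move=> x; rewrite mulr1.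
by apply: eq_integral => x _; rewrite mul1r ComplexField.Normc.normcM exprMn.
Qed.

(** The sequence u - v is Cauchy and tends to 0 in L^2, since both sequences have the limit x there;
    closability applies to it. *)
Lemma hconv_null beta u v (x : aefun mu) : 0 <= beta -> hconv beta u x -> hconv beta v x ->
  forall e, 0 < e -> exists N, forall k, (N <= k)%N -> sn beta (u k - v k) <= e.
Proof.
move=> b0 [f [xf /sq_integrableP[mf ff] [Pu uc uf]]] [g [xg /sq_integrableP[mg gf] [Pv vc vg]]].
have fg : {ae mu, forall y : VB, f y = g y} by apply/aeclassP; rewrite -xf.
apply: (sn_closable (M0 := M0) haar_mu b0).
- by move=> k; exact: PhiB.
- move=> e e0; have e2 : 0 < e / 2 by rewrite divr_gt0.
  have [[N NP] [M MP]] := (uc _ e2, vc _ e2); exists (maxn N M) => i j.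
  rewrite !geq_max => /andP[Ni Mi] /andP[Nj Mj].
  have -> : u i - v i - (u j - v j) = (u i - u j) + (v j - v i).
    by rewrite opprB [v j - u j]addrC addrACA [- v i + v j]addrC.
  have Puij := PhiB haar_mu (Pu i) (Pu j); have Pvij := PhiB haar_mu (Pv j) (Pv i).
  apply: le_lt_trans (snD haar_mu d w b0 Puij Pvij) _.
  by rewrite [ltRHS]splitr; apply: ltrD; [exact: NP|exact: MP].
move/L2_cvgP : uf => uf; move/L2_cvgP : vg => vg e e0.
have e4 : 0 < e / 4 by rewrite divr_gt0.
have [[N NP] [M MP]] := (uf _ e4, vg _ e4); exists (maxn N M) => k.
rewrite geq_max => /andP[Nk Mk].
have mu_ := Phi_cmeasurable (Pu k); have mv_ := Phi_cmeasurable (Pv k).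
have -> : u k - v k = (fun y => (u k y - f y) + (f y - v k y)).
  by apply/funext => y; rewrite addrA subrK.
apply: le_trans (N2_addl mu (cmeasurableB mu_ mf) (cmeasurableB mf mv_)) _.
have -> : e%:E = (2%:E * (e / 4)%:E + 2%:E * (e / 4)%:E)%E.
  by rewrite -!EFinM -EFinD; congr _%:E; field.
apply: leeD; apply: lee_wpmul2l; rewrite ?lee_fin //; first exact: NP.
rewrite (@N2_ae _ (fun y => g y - v k y)); [|exact: cmeasurableB|exact: cmeasurableB|].
  by rewrite N2_sym; exact: MP.
by apply: filterS fg => y ->.
Qed.

Lemma cvgn_of_cauchy (a : R^nat) :
  (forall e, 0 < e -> exists N, forall i j, (N <= i)%N -> (N <= j)%N -> `|a i - a j| < e) ->
    cvgn a.
Proof.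
move=> ac; apply/cauchy_cvgP/cauchy_ballP => e e0; have [N NP] := ac e e0.
near_simpl.
exists ([set i | (N <= i)%N], [set i | (N <= i)%N]) => /=.
  by split; exists N.
by move=> [i j] /= [Ni Nj]; apply: NP.
Qed.

Lemma hconv_cvgn beta u (x : aefun mu) : 0 <= beta -> hconv beta u x -> cvgn (fun k =>
  sn beta (u k)).
Proof.
move=> b0 [f [_ _ [Pu uc _]]]; apply: cvgn_of_cauchy => e /uc[N NP].
by exists N => i j Ni Nj; apply: le_lt_trans (NP i j Ni Nj);
  exact: (sn_dist haar_mu d w b0 (Pu i) (Pu j)).
Qed.

(** [Hnorm] selects a limit along some approximating sequence v; by [hconv_null] the norms along u
    and along v have the same limit. *)
Lemma Hnorm_cvg beta u (x : aefun mu) : 0 <= beta -> hconv beta u x ->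
  (fun k => sn beta (u k)) @ \oo --> Hnorm beta x.
Proof.
move=> b0 ux; have uc := hconv_cvgn b0 ux; rewrite /Defs.Hnorm.
case: xgetP => [l _ [f [v [xf sf av vl]]]|/(_ (limn (fun k => sn beta (u k))))]; last first.
  by case: ux => f [xf sf au] []; exists f, u; split; [exact: xf|exact: sf|exact: au|exact: uc].
have vx : hconv beta v x by exists f.
have null := hconv_null b0 ux vx.
have -> : (fun k => sn beta (u k)) = (fun k => sn beta (v k) + (sn beta (u k) - sn beta (v k))).
  by apply/funext => k; rewrite addrC subrK.
rewrite -[X in _ --> X]addr0; apply: cvgD => //; apply/cvgrPdist_le => e e0.
have [N NP] := null e e0; exists N => // k /= Nk; rewrite sub0r normrN.
apply: le_trans (NP k Nk).
exact: (sn_dist haar_mu d w b0 (hconv_Phi k ux) (hconv_Phi k vx)).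
Qed.

Lemma aefun_linE a f g : a *: aeclass mu f + aeclass mu g = aeclass mu (a *: f + g).
Proof. by rewrite aeclassD -aescale_class. Qed.

Lemma hconv_lin beta a u v (x y : aefun mu) : 0 <= beta -> hconv beta u x -> hconv beta v y ->
  hconv beta (fun k => a *: u k + v k) (a *: x + y).
Proof.
move=> b0 [f [-> /sq_integrableP[mf ff] [Pu uc uf]]] [g [-> /sq_integrableP[mg gf] [Pv vc vg]]].
have maf : cmeasurable ((fun x => a * f x) : VB -> C) by exact: cmeasurableZ.
exists (a *: f + g); split.
- exact: aefun_linE.
- apply/sq_integrableP; split; first exact: (cmeasurableD maf mg).
  apply: le_lt_trans (N2_addl mu maf mg) _; rewrite N2Z //.
  have Ff : N2 f \is a fin_num by apply: wint_fin_num => // _; exact: ler01.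
  have Fg : N2 g \is a fin_num by apply: wint_fin_num => // _; exact: ler01.
  by rewrite -(fineK Ff) -(fineK Fg) -!EFinM -EFinD ltry.
split.
- by move=> k; exact: PhiZD.
- move=> e e0; have e2 : 0 < e / 2 by rewrite divr_gt0.
  have a1 : 0 < normc a + 1 by rewrite ltr_wpDl // normc_ge0.
  have ea : 0 < e / 2 / (normc a + 1) by rewrite divr_gt0.
  have [[N NP] [M MP]] := (uc _ ea, vc _ e2); exists (maxn N M) => i j.
  rewrite !geq_max => /andP[Ni Mi] /andP[Nj Mj].
  have -> : a *: u i + v i - (a *: u j + v j) = a *: (u i - u j) + (v i - v j).
    by rewrite scalerBr opprD addrACA.
  have Puij := PhiB haar_mu (Pu i) (Pu j); have Pvij := PhiB haar_mu (Pv i) (Pv j).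
  have Paij : Phi (a *: (u i - u j)).
    have P0 : Phi (u i - u i) by exact: PhiB.
    by have := PhiZD haar_mu a Puij P0; rewrite subrr addr0.
  apply: le_lt_trans (snD haar_mu d w b0 Paij Pvij) _.
  rewrite [ltRHS]splitr; apply: ler_ltD; last exact: MP.
  rewrite (snZ haar_mu d w a b0 Puij).
  apply: (@le_trans _ _ ((normc a + 1) * (e / 2 / (normc a + 1)))).
    apply: ler_pM; [exact: normc_ge0|exact: sn_ge0|by rewrite lerDl|by apply/ltW/NP].
  by rewrite mulrC divfK // gt_eqF.
apply/L2_cvgP => e e0; move/L2_cvgP : uf => uf; move/L2_cvgP : vg => vg.
have e4 : 0 < e / 4 by rewrite divr_gt0.
have a1 : 0 < normc a ^+ 2 + 1 by rewrite ltr_wpDl // sqr_ge0.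
have ea : 0 < e / 4 / (normc a ^+ 2 + 1) by rewrite divr_gt0.
have [[N NP] [M MP]] := (uf _ ea, vg _ e4); exists (maxn N M) => k.
rewrite geq_max => /andP[Nk Mk].
have mu_ := Phi_cmeasurable (Pu k); have mv_ := Phi_cmeasurable (Pv k).
have -> : (fun x0 => ((a *: u k + v k) x0 - (a *: f + g) x0)%R) =
    (fun y => a * (u k y - f y) + (v k y - g y)).
  apply/funext => z; rewrite -[(a *: u k + v k) z]/(a * u k z + v k z).
  by rewrite -[(a *: f + g) z]/(a * f z + g z); ring.
apply: le_trans (N2_addl mu (cmeasurableZ a (cmeasurableB mu_ mf)) (cmeasurableB mv_ mg)) _.
rewrite N2Z; last exact: cmeasurableB.
have -> : e%:E = (2%:E * (e / 4)%:E + 2%:E * (e / 4)%:E)%E.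
  by rewrite -!EFinM -EFinD; congr _%:E; field.
apply: leeD; apply: lee_wpmul2l; rewrite ?lee_fin //; last exact: MP.
apply: (@le_trans _ _ ((normc a ^+ 2)%:E * (e / 4 / (normc a ^+ 2 + 1))%:E)%E).
  by apply: lee_wpmul2l; rewrite ?lee_fin ?sqr_ge0 //; exact: NP.
rewrite -EFinM lee_fin mulrCA ler_piMr ?(ltW e4) // ler_pdivrMr // mul1r lerDl //.
Qed.

Lemma hconv_cst beta phi : Phi phi -> hconv beta (fun=> phi) (aeclass mu phi).
Proof.
move=> Pf; have mf := Phi_cmeasurable Pf.
exists phi; split=> //.
  apply/sq_integrableP; split => //; apply: le_lt_trans (N2_le_sn haar_mu d w (lexx 0) Pf) _.
  exact: ltry.
split=> [//|e e0|].
  exists 0%N => i j _ _; have [N fl] := Phi_level Pf.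
  rewrite subrr -(scale0r phi) sobolevE (fourierZ haar_mu 0 fl) scale0r.
  rewrite (_ : wint _ _ = 0%E) ?sqrtr0 //; apply: integral0_eq => x _.
  by rewrite /= expr0n /= addr0 sqrtr0 expr0n mulr0.
apply/L2_cvgP => e e0; exists 0%N => k _.
rewrite (_ : wint _ _ = 0%E) ?lee_fin ?ltW //; apply: integral0_eq => x _.
by rewrite subrr /= expr0n /= addr0 sqrtr0 expr0n mulr0.
Qed.

Lemma Hnorm_le beta beta' B u v (x y : aefun mu) : 0 <= beta -> 0 <= beta' ->
  hconv beta u x -> hconv beta' v y -> (forall k, sn beta' (v k) <= B * sn beta (u k)) ->
  Hnorm beta' y <= B * Hnorm beta x.
Proof.
move=> b0 b0' ux vy uv.
have cu : (fun k => B * sn beta (u k)) @ \oo --> B * Hnorm beta x.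
  by apply: cvgMr; exact: Hnorm_cvg.
have cv := Hnorm_cvg b0' vy.
rewrite -(cvg_lim _ cu) // -(cvg_lim _ cv) //; apply: ler_lim.
- exact: cvgP cv.
- exact: cvgP cu.
- by apply: nearW.
Qed.

Lemma Hnorm_ge0 beta u (x : aefun mu) : 0 <= beta -> hconv beta u x -> 0 <= Hnorm beta x.
Proof.
move=> b0 ux; have cu := Hnorm_cvg b0 ux; rewrite -(cvg_lim _ cu) //.
by apply: limr_ge; [exact: cvgP cu|apply: nearW => k; exact: sn_ge0].
Qed.

(** Density of [Phi]: the class of u_N is represented by a constant sequence, so the difference with
    x is represented by u - u_N, whose norms are eventually below e for N large. *)
Lemma hconv_approx beta u (x : aefun mu) e : 0 <= beta -> hconv beta u x -> 0 < e ->
  exists k, Hnorm beta (x - aeclass mu (u k)) <= e.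
Proof.
move=> b0 ux e0; have Pu k : Phi (u k) by exact: hconv_Phi ux.
have [f [_ _ [_ uc _]]] := ux; have [N NP] := uc e e0; exists N.
have cv := hconv_lin (-1) b0 (hconv_cst beta (Pu N)) ux.
have -> : x - aeclass mu (u N) = -1 *: aeclass mu (u N) + x by rewrite scaleN1r addrC.
have cn := Hnorm_cvg b0 cv; rewrite -(cvg_lim _ cn) //.
apply: limr_le; first exact: cvgP cn.
exists N => // j /= Nj; rewrite scaleN1r addrC; apply/ltW/NP => //.
Qed.

(** The Sobolev norms along u tend to 0 and dominate the L^2 norms, so the L^2 limit of u is the
    class of 0. *)
Lemma Hnorm_eq0 beta u (x : aefun mu) : 0 <= beta -> hconv beta u x ->
  (forall e, 0 < e -> Hnorm beta x <= e) -> x = 0.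
Proof.
move=> b0 ux H; have cn := Hnorm_cvg b0 ux.
have hx : Hnorm beta x = 0.
  apply/eqP; rewrite eq_le (Hnorm_ge0 b0 ux) andbT; apply/ler_addgt0Pr => e /H.
  by rewrite add0r.
rewrite hx in cn; have [f [xf /sq_integrableP[mf _] [Pu _ uf]]] := ux.
have -> : 0 = aeclass mu (0 : V -> C) by rewrite /aeclass raddf0.
have mz : cmeasurable ((0 : V -> C) : VB -> C) by split; exact: measurable_cst.
rewrite xf; apply: (L2_cvg_unique _ mf mz uf); first by move=> k; exact: Phi_cmeasurable.
apply/L2_cvgP => e e0; have se : 0 < Num.sqrt e by rewrite sqrtr_gt0.
have [N _ NP] := (cvgrPdist_le _ _).1 cn _ se; exists N => k Nk.
have -> : (fun y => (u k y - (0 : V -> C) y)%R) = u k by apply/funext => y; rewrite subr0.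
apply: le_trans (N2_le_sn haar_mu d w b0 (Pu k)) _;
  rewrite lee_fin -[leRHS]sqr_sqrtr ?(ltW e0) //.
rewrite ler_sqr ?nnegrE ?sn_ge0 ?sqrtr_ge0 //.
by have := NP k Nk; rewrite sub0r normrN ger0_norm ?sn_ge0.
Qed.

End CompletionNorm.

(** * Fourier multipliers *)

Section Multiplier.
Variables (R : realType) (p : nat) (p_pr : prime p) (n : nat).
Variable mu : {measure set (BorelQp p_pr n) -> \bar R}.
Hypothesis haar_mu : haar_measure mu.
Variables (d : nat) (w : 'I_n -> nat) (M0 : nat).
Local Notation V := 'rV[Qp p_pr]_n.
Local Notation C := R[i].
Local Notation fourier := (fourier mu).
Local Notation normc := ComplexField.Normc.normc.
Local Notation wint := (@wsq_int _ (BorelQp p_pr n) R mu).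
Local Notation sn := (sobolev_norm mu d w).
Local Notation sw := (@sweight R p p_pr n d w).
Local Notation Phi := (Phi mu M0).
Local Notation hconv := (hconv d w M0).
Local Notation Hnorm := (@Hnorm _ _ _ _ mu d w M0).
Local Notation Htilde := (@Htilde _ _ _ _ mu d w M0).
Implicit Types (f g phi psi : V -> C) (u v : nat -> V -> C) (beta : R).

Variable m : V -> R.
Variables A0 A1 : R.
Hypotheses (A0_gt0 : 0 < A0) (A1_gt0 : 0 < A1).
Hypothesis m_bounds : forall xi, p%:R ^+ M0 <= Qp_norm R xi ->
  A0 * Xi R d w xi <= m xi <= A1 * Xi R d w xi.
Hypothesis m_loc_const : forall xi, p%:R ^+ M0 < Qp_norm R xi ->
  exists k, forall h, cball (p%:Q ^- k) h -> m (xi + h) = m xi.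

Lemma Qp_norm_cball N (xi : V) : Qp_norm R xi <= p%:R ^+ N <-> cball (p%:Q ^+ N) xi.
Proof.
have pN : ratr (p%:Q ^+ N) = p%:R ^+ N :> R by rewrite rmorphXn /= ratr_int.
rewrite -pN; split=> [H i|H].
  rewrite -(ler_rat R); apply: le_trans H;
    exact: (@le_bigmax _ _ _ 0 (fun i => Qp_abs R (xi 0 i)) i).
apply: bigmax_le => [|i _]; last by rewrite ler_rat; exact: H.
by rewrite ler0q exprn_ge0 // ltW // (pQ_gt0 p_pr).
Qed.

(** A coordinate larger than p^M0 >= 1 contributes a power with nonnegative exponent. On the region
    that carries the transforms of [Phi], max (1, Xi) can thus be replaced by Xi. *)
Lemma Xi_ge1 (xi : V) : p%:R ^+ M0 < Qp_norm R xi -> 1 <= Xi R d w xi.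
Proof.
move=> xiM; have : ~ cball (p%:Q ^+ M0) xi by move=> /Qp_norm_cball; rewrite leNgt xiM.
move=> /existsNP[i /negP]; rewrite -ltNge => xi1.
rewrite /Xi (bigD1 i) //= ler_wpDr //; first by apply: sumr_ge0 => j _; exact: powR_ge0.
rewrite -[leLHS](powRr0 (Qp_abs R (xi 0 i))); apply: ler_powR; rewrite ?divr_ge0 //.
rewrite -(rmorph1 (@ratr R)) ler_rat; apply: le_trans (ltW xi1).
by rewrite exprn_ege1 // ltW // (pQ_gt1 p_pr).
Qed.

Lemma m_gt0 xi : p%:R ^+ M0 < Qp_norm R xi -> 0 < m xi.
Proof.
move=> xiM; have /andP[lo _] := m_bounds (ltW xiM); apply: lt_le_trans lo.
by rewrite mulr_gt0 // (lt_le_trans _ (Xi_ge1 xiM)).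
Qed.

Definition mfourier (s : R) phi : V -> C := fun xi => (m xi `^ s)%:C%C * fourier phi xi.

(** In the ball where the transform of phi vanishes, small translations stay in the ball, whatever m
    does there; outside, m is locally constant. The scale of constancy then becomes uniform by
    compactness of the support. *)
Lemma mfourier_level s phi : Phi phi -> exists N, level N (mfourier s phi).
Proof.
move=> Pf; apply: schwartz_bruhat_level.
have [N fl] := Phi_fourier_level haar_mu Pf; split=> [xi|]; last first.
  by apply: (compact_support (N := N)) => xi /fl.1 f0; rewrite /mfourier f0 mulr0.
apply/nbhs_QpV; have [xiM|xiM] := leP (Qp_norm R xi) (p%:R ^+ M0).
  exists 0%N => h h0; rewrite /mfourier !Pf.2 ?mulr0 //.
  apply/Qp_norm_cball; apply: cballD; first exact/Qp_norm_cball.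
  by apply: cball_mono h0; exact: (pexpV_le_pexp p_pr).
have [k kP] := m_loc_const xiM; exists (maxn k N) => h hh; rewrite /mfourier kP; last first.
  by apply: cball_mono hh; apply: (pexpV_le p_pr); rewrite leq_maxl.
rewrite fl.2 //; apply: cball_mono hh; apply: (pexpV_le p_pr); rewrite leq_maxr //.
Qed.

(* F^3 is the inverse Fourier transform. *)
Definition mult (s : R) phi : V -> C := fourier (fourier (fourier (mfourier s phi))).

Lemma mult_fourierE s phi x : Phi phi -> mult s phi x = fourier (mfourier s phi) (- x).
Proof.
move=> /(mfourier_level s)[N ml]; rewrite /mult.
exact: (fourier_inversion haar_mu _ (level_fourier haar_mu ml)).
Qed.

Lemma fourier_mult s phi : Phi phi -> fourier (mult s phi) = mfourier s phi.
Proof.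
move=> /(mfourier_level s)[N ml]; have fl := level_fourier haar_mu ml.
apply/funext => xi; rewrite /mult.
rewrite (fourier_inversion haar_mu _ (level_fourier haar_mu fl)).
by rewrite (fourier_inversion haar_mu _ ml) opprK.
Qed.

Lemma mult_Phi s phi : Phi phi -> Phi (mult s phi).
Proof.
move=> Pf; have [N ml] := mfourier_level s Pf; split=> [|xi xiM].
  by apply: (level_schwartz_bruhat (N := N)); do 3!apply: (level_fourier haar_mu).
by rewrite fourier_mult // /mfourier Pf.2 // mulr0.
Qed.

Lemma fourier_inj phi psi : Phi phi -> Phi psi -> fourier phi = fourier psi -> phi = psi.
Proof.
move=> /Phi_level[N fl] /Phi_level[M gl] E; apply/funext => x.
have := fourier_inversion haar_mu (- x) fl; rewrite opprK => <-.
have := fourier_inversion haar_mu (- x) gl; rewrite opprK => <-.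
by rewrite E.
Qed.

Lemma Phi_fourier_lin a phi psi : Phi phi -> Phi psi ->
  fourier (a *: phi + psi) = a *: fourier phi + fourier psi.
Proof.
move=> Pf Pg; have [N [fl gl]] := level_common (Phi_level Pf) (Phi_level Pg).
by rewrite (fourierD haar_mu (levelZ a fl) gl) (fourierZ haar_mu _ fl).
Qed.

Lemma mult_lin s a phi psi : Phi phi -> Phi psi ->
  mult s (a *: phi + psi) = a *: mult s phi + mult s psi.
Proof.
move=> Pf Pg; have Pfg := PhiZD haar_mu a Pf Pg.
apply: fourier_inj; [exact: mult_Phi|by apply: PhiZD => //; exact: mult_Phi|].
rewrite (fourier_mult s Pfg) (Phi_fourier_lin a (mult_Phi s Pf) (mult_Phi s Pg)).
rewrite [in X in _ = X + _](fourier_mult s Pf) [in X in _ = _ + X](fourier_mult s Pg).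
apply/funext => xi.
rewrite -[RHS]/(a * ((m xi `^ s)%:C%C * fourier phi xi) + (m xi `^ s)%:C%C * fourier psi xi).
rewrite /mfourier (Phi_fourier_lin a Pf Pg) -[(_ + _ : V ->
  C) xi]/(a * fourier phi xi + fourier psi xi).
by ring.
Qed.

Lemma multB s phi psi : Phi phi -> Phi psi -> mult s (phi - psi) = mult s phi - mult s psi.
Proof.
move=> Pf Pg; have -> : phi - psi = -1 *: psi + phi by rewrite scaleN1r addrC.
by rewrite mult_lin // scaleN1r addrC.
Qed.

Lemma multK s phi : Phi phi -> mult (- s) (mult s phi) = phi.
Proof.
move=> Pf; have Pm := mult_Phi s Pf.
apply: fourier_inj; [exact: mult_Phi|exact: Pf|].
rewrite (fourier_mult (- s) Pm) /mfourier (fourier_mult s Pf); apply/funext => xi;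
  rewrite /mfourier.
have [xiM|xiM] := leP (Qp_norm R xi) (p%:R ^+ M0); first by rewrite Pf.2 // !mulr0.
rewrite mulrA -rmorphM /= -powRD; last by rewrite (gt_eqF (m_gt0 xiM)) implybT.
by rewrite addNr powRr0 mul1r.
Qed.

(** One constant for both signs of s: A1^s is the relevant term for s >= 0, and A0^s for s < 0. *)
Definition mbound s : R := A0 `^ s + A1 `^ s.

Lemma mbound_ge0 s : 0 <= mbound s.
Proof. by rewrite addr_ge0 ?powR_ge0. Qed.

Lemma m_powR_le s xi : p%:R ^+ M0 < Qp_norm R xi -> m xi `^ s <= mbound s * Xi R d w xi `^ s.
Proof.
move=> xiM; have /andP[lo hi] := m_bounds (ltW xiM).
have X0 : 0 < Xi R d w xi by rewrite (lt_le_trans _ (Xi_ge1 xiM)).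
have m0 := m_gt0 xiM.
rewrite /mbound mulrDl -!powRM ?(ltW A0_gt0) ?(ltW A1_gt0) ?(ltW X0) //.
have [s0|s0] := leP 0 s.
  apply: ler_wpDl; first exact: powR_ge0.
  apply: ge0_ler_powR; rewrite ?nnegrE ?mulr_ge0 ?(ltW m0) ?(ltW A1_gt0) ?(ltW X0) //.
apply: ler_wpDr; first exact: powR_ge0.
have [r r0 ->] : exists2 r, 0 <= r & s = - r by exists (- s); rewrite ?opprK ?oppr_ge0 ?(ltW s0).
rewrite !powRN lef_pV2 ?posrE ?powR_gt0 ?mulr_gt0 //.
by apply: ge0_ler_powR; rewrite ?nnegrE ?mulr_ge0 ?(ltW m0) ?(ltW A0_gt0) ?(ltW X0).
Qed.

(** Where the transform of phi does not vanish, the weight is a power of Xi, and m^(2 s) is at most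
    a constant times Xi^(2 s); this factor turns the weight of index beta - s into that of index
    beta. *)
Lemma mult_bound s beta phi : 0 <= beta -> 0 <= beta - s -> Phi phi ->
  sn (beta - s) (mult s phi) <= mbound s * sn beta phi.
Proof.
move=> b0 bs0 Pf; have mfu := Phi_fourier_cmeasurable haar_mu Pf.
have [N ml] := mfourier_level s Pf.
have fin := Phi_wint_lty haar_mu d w b0 Pf.
have B2 : 0 <= mbound s ^+ 2 by exact: sqr_ge0.
have E := wintM (W' := fun xi => mbound s ^+ 2 * sw beta xi) mu (@sweight_ge0 _ _ _ _ d w beta)
  (measurable_sweight _ _ _) mfu B2 (fun=> erefl).
rewrite (sobolevE mu d w beta phi) -[mbound s]ger0_norm ?mbound_ge0 // -sqrtr_sqr -sqrtrM //.
rewrite sobolevE (fourier_mult s Pf); apply: ler_wsqrtr.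
have F0 : wint (sw beta) (fourier phi) \is a fin_num.
  by apply: wint_fin_num => //; exact: sweight_ge0.
have -> : mbound s ^+ 2 * fine (wint (sw beta) (fourier phi)) =
    fine (wint (fun xi => mbound s ^+ 2 * sw beta xi) (fourier phi)).
  by rewrite E fineM.
apply: fine_le.
- apply: wint_fin_num; first exact: sweight_ge0.
  exact: (level_wint_lty haar_mu d w bs0 ml).
- by rewrite E fin_numM.
apply: le_wint.
- exact: sweight_ge0.
- exact: measurable_sweight.
- by apply: measurable_funM; [exact: measurable_cst|exact: measurable_sweight].
- exact: (level_cmeasurable ml).
- exact: mfu.
move=> xi; have [xiM|xiM] := leP (Qp_norm R xi) (p%:R ^+ M0).
  by rewrite /mfourier Pf.2 // mulr0 /= expr0n /= addr0 sqrtr0 expr0n /= !mulr0.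
rewrite /mfourier ComplexField.Normc.normcM exprMn mulrA ler_wpM2r ?sqr_ge0 //.
have -> : normc (m xi `^ s)%:C%C = m xi `^ s.
  by rewrite /= expr0n /= addr0 sqrtr_sqr ger0_norm // powR_ge0.
have X1 := Xi_ge1 xiM; have X0 : 0 < Xi R d w xi by rewrite (lt_le_trans _ X1).
rewrite /sweight max_r //.
have Xs : Xi R d w xi `^ (2 * beta) = Xi R d w xi `^ (2 * (beta - s)) * (Xi R d w xi `^ s) ^+ 2.
  rewrite -powR_mulrn ?powR_ge0 // -powRrM -powRD ?(gt_eqF X0) ?implybT //.
  by congr (_ `^ _); ring.
rewrite Xs [leRHS]mulrCA -exprMn; apply: ler_wpM2l; first exact: powR_ge0.
rewrite ler_sqr ?nnegrE ?powR_ge0 ?mulr_ge0 ?mbound_ge0 ?powR_ge0 //.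
exact: m_powR_le.
Qed.

Lemma hconv_zero beta u (x : aefun mu) : 0 <= beta -> hconv beta u x ->
  (forall e, 0 < e -> exists N, forall k, (N <= k)%N -> sn beta (u k) <= e) -> x = 0.
Proof.
move=> b0 ux u0; apply: (Hnorm_eq0 haar_mu b0 ux) => e /u0[N NP].
have cn := Hnorm_cvg haar_mu b0 ux; rewrite -(cvg_lim _ cn) //.
by apply: limr_le; [exact: cvgP cn|exists N => // k; exact: NP].
Qed.

(** The index max (0, s) is the least nonnegative one from which the multiplier lands in a
    nonnegative index, which gives the largest domain; the image is recorded only as an L^2
    class. *)
Definition Tmul (s : R) (x : aefun mu) : aefun mu :=
  xget 0 [set y | exists u, hconv (Num.max 0 s) u x /\ hconv 0 (fun k => mult s (u k)) y].

(** The multiplier can be computed along any sequence. Its image sequence is Cauchy by [mult_bound];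
    the sequence v used by the definition is asymptotic to u at index max (0, s), by closability,
    hence both images have the same L^2 limit. *)
Lemma Tmul_hconv s gamma u (x : aefun mu) : 0 <= gamma -> 0 <= gamma - s ->
  hconv gamma u x -> hconv (gamma - s) (fun k => mult s (u k)) (Tmul s x).
Proof.
move=> g0 gs0 ux; have Pu k : Phi (u k) := hconv_Phi k ux.
have B1 : 0 < mbound s + 1 by rewrite ltr_wpDl // mbound_ge0.
have cauchy : sn_cauchy mu d w (gamma - s) (fun k => mult s (u k)).
  move=> e e0; have [f [_ _ [_ uc _]]] := ux.
  have [N NP] := uc _ (divr_gt0 e0 B1); exists N => i j Ni Nj.
  rewrite -(multB s (Pu i) (Pu j)); have Pij := PhiB haar_mu (Pu i) (Pu j).
  apply: le_lt_trans (mult_bound g0 gs0 Pij) _.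
  apply: (@le_lt_trans _ _ ((mbound s + 1) * sn gamma (u i - u j))).
    by apply: ler_wpM2r; [exact: sn_ge0|rewrite lerDl].
  by rewrite mulrC -ltr_pdivlMr //; exact: NP.
have [y0 y0P] := sn_cauchy_cvg haar_mu gs0 (fun k => mult_Phi s (Pu k)) cauchy.
have y00 := hconv_mono haar_mu (lexx 0) gs0 y0P.
pose s' := Num.max 0 s.
have s'0 : 0 <= s' by rewrite /s' le_max lexx.
have s's : 0 <= s' - s by rewrite subr_ge0 /s' le_max lexx orbT.
have s'g : s' <= gamma by rewrite /s' ge_max g0 -subr_ge0.
have us' := hconv_mono haar_mu s'0 s'g ux.
rewrite /Tmul; case: xgetP => [y _ [v [vx vy]]|/(_ y0) []]; last first.
  by exists u; split; [exact: us'|exact: y00].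
have Pv k : Phi (v k) := hconv_Phi k vx.
suff -> : y = y0 by exact: y0P.
apply/eqP; rewrite -subr_eq0; apply/eqP.
have := hconv_lin haar_mu (-1) (lexx 0) y00 vy; rewrite scaleN1r addrC => hl.
apply: (hconv_zero (lexx 0) hl) => e e0.
have [N NP] := hconv_null haar_mu s'0 vx us' (divr_gt0 e0 B1).
exists N => k Nk; rewrite scaleN1r addrC -(multB s (Pv k) (Pu k)).
have Pvu := PhiB haar_mu (Pv k) (Pu k).
apply: le_trans (sn_mono haar_mu d w (lexx 0) s's (mult_Phi s Pvu)) _.
apply: le_trans (mult_bound s'0 s's Pvu) _.
apply: (@le_trans _ _ ((mbound s + 1) * sn s' (v k - u k))).
  by apply: ler_wpM2r; [exact: sn_ge0|rewrite lerDl].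
by rewrite mulrC -ler_pdivlMr //; exact: NP.
Qed.

Lemma Tmul_Htilde s gamma x : 0 <= gamma -> 0 <= gamma - s ->
  Htilde gamma x -> Htilde (gamma - s) (Tmul s x).
Proof.
move=> g0 gs0 /HtildeP[u ux]; apply/HtildeP.
by exists (fun k => mult s (u k)); exact: Tmul_hconv.
Qed.

Lemma Tmul_bounded s gamma x : 0 <= gamma -> 0 <= gamma - s -> Htilde gamma x ->
  Hnorm (gamma - s) (Tmul s x) <= mbound s * Hnorm gamma x.
Proof.
move=> g0 gs0 /HtildeP[u ux].
apply: (Hnorm_le haar_mu g0 gs0 ux (Tmul_hconv g0 gs0 ux)) => k.
by apply: mult_bound => //; exact: hconv_Phi ux.
Qed.

Lemma Tmul_class s phi : Phi phi -> Tmul s (aeclass mu phi) = aeclass mu (mult s phi).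
Proof.
move=> Pf; have s0 : 0 <= Num.max 0 s by rewrite le_max lexx.
have ss : 0 <= Num.max 0 s - s by rewrite subr_ge0 le_max lexx orbT.
have := Tmul_hconv s0 ss (hconv_cst haar_mu d w (Num.max 0 s) Pf).
move=> /(hconv_unique (hconv_cst haar_mu d w 0 (mult_Phi s Pf))); exact: esym.
Qed.

Lemma Tmul_linear s gamma : 0 <= gamma -> 0 <= gamma - s -> linear_on (Htilde gamma) (Tmul s).
Proof.
move=> g0 gs0 a x y /HtildeP[u ux] /HtildeP[v vy].
have := hconv_lin haar_mu a gs0 (Tmul_hconv g0 gs0 ux) (Tmul_hconv g0 gs0 vy).
have := Tmul_hconv g0 gs0 (hconv_lin haar_mu a g0 ux vy).
have -> : (fun k => mult s (a *: u k + v k)) = (fun k => a *: mult s (u k) + mult s (v k)).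
  by apply/funext => k; exact: (mult_lin s a (hconv_Phi k ux) (hconv_Phi k vy)).
exact: hconv_unique.
Qed.

Lemma TmulK s gamma x : 0 <= gamma -> 0 <= gamma - s -> Htilde gamma x ->
  Tmul (- s) (Tmul s x) = x.
Proof.
move=> g0 gs0 /HtildeP[u ux]; have tx := Tmul_hconv g0 gs0 ux.
have g' : 0 <= gamma - s - - s by rewrite opprK subrK.
have := Tmul_hconv gs0 g' tx.
have -> : (fun k => mult (- s) (mult s (u k))) = u.
  by apply/funext => k; apply: multK; exact: hconv_Phi ux.
by move=> /hconv_unique /(_ ux).
Qed.

End Multiplier.

(** * Extensions by density *)

Section Extension.
Variables (R : realType) (p : nat) (p_pr : prime p) (n : nat).
Variable mu : {measure set (BorelQp p_pr n) -> \bar R}.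
Hypothesis haar_mu : haar_measure mu.
Variables (d : nat) (w : 'I_n -> nat) (M0 : nat).
Local Notation V := 'rV[Qp p_pr]_n.
Local Notation C := R[i].
Local Notation fourier := (fourier mu).
Local Notation Phi := (Phi mu M0).
Local Notation sn := (sobolev_norm mu d w).
Local Notation Hnorm := (@Hnorm _ _ _ _ mu d w M0).
Local Notation Htilde := (@Htilde _ _ _ _ mu d w M0).
Local Notation Htilde_oo := (@Htilde_oo _ _ _ _ mu d w M0).
Implicit Types (phi : V -> C) (beta : R) (T : aefun mu -> aefun mu).

Lemma Htilde_mono beta beta' : 0 <= beta -> beta <= beta' -> Htilde beta' `<=` Htilde beta.
Proof.
by move=> b0 bb x /HtildeP[u ux]; apply/HtildeP; exists u; exact: (hconv_mono haar_mu b0 bb).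
Qed.

Lemma Hnorm_mono beta beta' x : 0 <= beta -> beta <= beta' -> Htilde beta' x ->
  Hnorm beta x <= Hnorm beta' x.
Proof.
move=> b0 bb /HtildeP[u ux]; have ux' := hconv_mono haar_mu b0 bb ux.
rewrite -[leRHS]mul1r; apply: (Hnorm_le haar_mu (le_trans b0 bb) b0 ux ux') => k.
by rewrite mul1r; apply: (sn_mono haar_mu d w b0 bb); exact: hconv_Phi ux.
Qed.

Lemma Htilde_lin beta a x y : 0 <= beta -> Htilde beta x -> Htilde beta y ->
  Htilde beta (a *: x + y).
Proof.
move=> b0 /HtildeP[u ux] /HtildeP[v vy]; apply/HtildeP.
by exists (fun k => a *: u k + v k); exact: (hconv_lin haar_mu).
Qed.

Lemma HtildeB beta x y : 0 <= beta -> Htilde beta x -> Htilde beta y -> Htilde beta (x - y).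
Proof.
move=> b0 hx hy; have -> : x - y = -1 *: y + x by rewrite scaleN1r addrC.
exact: Htilde_lin.
Qed.

Lemma HnormB_le beta x y : 0 <= beta -> Htilde beta x -> Htilde beta y ->
  Hnorm beta (x - y) <= Hnorm beta x + Hnorm beta y.
Proof.
move=> b0 /HtildeP[u ux] /HtildeP[v vy].
have cl := Hnorm_cvg haar_mu b0 (hconv_lin haar_mu (-1) b0 vy ux).
have cs : (fun k => sn beta (u k) + sn beta (v k)) @ \oo --> Hnorm beta x + Hnorm beta y.
  by apply: cvgD; exact: (Hnorm_cvg haar_mu b0).
have -> : x - y = -1 *: y + x by rewrite scaleN1r addrC.
rewrite -(cvg_lim _ cs) // -(cvg_lim _ cl) //.
apply: ler_lim; [exact: cvgP cl|exact: cvgP cs|apply: nearW => k].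
have Pu := hconv_Phi k ux; have Pv := hconv_Phi k vy.
rewrite scaleN1r addrC; have -> : u k - v k = u k + (-1) *: v k by rewrite scaleN1r.
have PNv : Phi (-1 *: v k).
  by have := PhiZD haar_mu (-1) Pv (PhiB haar_mu Pv Pv); rewrite subrr addr0.
apply: le_trans (snD haar_mu d w b0 Pu PNv) _; rewrite lerD2l (snZ haar_mu d w _ b0 Pv).
by rewrite /= oppr0 expr0n /= addr0 sqrtr_sqr normrN normr1 mul1r.
Qed.

(** With gamma = alpha, both maps are bounded from index alpha to index 0. They agree on the classes
    of [Phi], which are dense at index alpha, and the norm of index 0 separates points. *)
Lemma extension_unique F alpha T T' : 0 <= alpha ->
  is_extension d w M0 F alpha T -> is_extension d w M0 F alpha T' ->
  forall x, Htilde alpha x -> T x = T' x.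
Proof.
move=> a0 [Tp Tl /(_ _ (lexx alpha))[TH [B TB]]] [Tp' Tl' /(_ _ (lexx alpha))[TH' [B' TB']]] x hx.
rewrite subrr in TH TB TH' TB'.
have hD : Htilde 0 (T x - T' x) by apply: HtildeB; [exact: lexx|exact: TH|exact: TH'].
have [u ux] := (HtildeP d w M0 _ x).1 hx.
have [v vD] := (HtildeP d w M0 _ _).1 hD.
apply/eqP; rewrite -subr_eq0; apply/eqP; apply: (Hnorm_eq0 haar_mu (lexx 0) vD) => e e0.
have B0 : 0 < `|B| + `|B'| + 1 by rewrite ltr_wpDl // addr_ge0.
have [k ke] := hconv_approx haar_mu a0 ux (divr_gt0 e0 B0).
have hk : Htilde alpha (aeclass mu (u k)).
  apply/HtildeP; exists (fun=> u k); apply: (hconv_cst haar_mu); exact: hconv_Phi ux.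
have hz := HtildeB a0 hx hk; set z := x - _ in hz ke.
have zE : z = -1 *: aeclass mu (u k) + x by rewrite scaleN1r addrC.
(* The common values of the two maps at the class of u_k cancel. *)
have -> : T x - T' x = T z - T' z.
  rewrite zE (Tl _ _ _ hk hx) (Tl' _ _ _ hk hx) Tp ?Tp';
    [|exact: hconv_Phi ux|exact: hconv_Phi ux].
  by rewrite [X in _ = _ - X]addrC [X in _ = X - _]addrC opprD addrACA subrr addr0.
apply: le_trans (HnormB_le (lexx 0) (TH _ hz) (TH' _ hz)) _.
apply: le_trans (lerD (TB _ hz) (TB' _ hz)) _; rewrite -mulrDl.
have [v' v'z] := (HtildeP d w M0 _ _).1 hz.
have z0 := Hnorm_ge0 haar_mu a0 v'z.
apply: (@le_trans _ _ ((`|B| + `|B'| + 1) * Hnorm alpha z)).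
  apply: ler_wpM2r => //; rewrite ler_wpDr // lerD // ler_norm //.
by rewrite mulrC -ler_pdivlMr.
Qed.

Lemma linear_continuous_oo T : linear_on Htilde_oo T ->
  (forall beta : nat, exists (k : nat) (B : R), forall z, Htilde_oo z ->
     Hnorm beta%:R (T z) <= B * Hnorm k%:R z) ->
  continuous_on_Htilde_oo d w M0 T.
Proof.
move=> Tl Tb x hx beta e e0; have [k [B TB]] := Tb beta.
have B1 : 0 < `|B| + 1 by rewrite ltr_wpDl.
exists [:: k], (e / (`|B| + 1)); split; first exact: divr_gt0.
move=> y hy /(_ k (mem_head _ _)) yx.
have hz : Htilde_oo (y - x) by move=> b; apply: HtildeB; [exact: ler0n|exact: hy|exact: hx].
have -> : T y - T x = T (y - x).
  have -> : y - x = -1 *: x + y by rewrite scaleN1r addrC.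
  by rewrite Tl // scaleN1r addrC.
apply: le_lt_trans (TB _ hz) _.
have [u uz] := (HtildeP d w M0 _ _).1 (hz k).
have z0 := Hnorm_ge0 haar_mu (ler0n R k) uz.
apply: (@le_lt_trans _ _ ((`|B| + 1) * Hnorm k%:R (y - x))).
  by apply: ler_wpM2r => //; rewrite ler_wpDr // ler_norm.
by rewrite mulrC -ltr_pdivlMr.
Qed.

Lemma nat_above (r : R) : exists k : nat, r <= k%:R.
Proof.
by exists (Num.bound `|r|); apply: le_trans (ler_norm r) (ltW (archi_boundP (normr_ge0 r))).
Qed.

(** * The operator with symbol F as a multiplier *)

Variable m : V -> R.
Variables A0 A1 : R.
Hypotheses (A0_gt0 : 0 < A0) (A1_gt0 : 0 < A1).
Hypothesis m_bounds : forall xi, p%:R ^+ M0 <= Qp_norm R xi ->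
  A0 * Xi R d w xi <= m xi <= A1 * Xi R d w xi.
Hypothesis m_loc_const : forall xi, p%:R ^+ M0 < Qp_norm R xi ->
  exists k, forall h, cball (p%:Q ^- k) h -> m (xi + h) = m xi.
Variable F : V -> V -> Qp p_pr.
Hypothesis F_m : forall xi x, p%:R ^+ M0 < Qp_norm R xi -> Qp_abs R (F xi x) = m xi.
Variable alpha : R.
Hypothesis alpha_gt0 : 0 < alpha.
Local Notation mult := (mult mu m).
Local Notation Tmul := (@Tmul _ _ _ _ mu d w M0 m).

(** Where |F| might differ from m, the transform of phi vanishes, so the dependence of the symbol on
    x disappears; what remains is an inverse Fourier integral, a transform evaluated at -x. *)
Lemma psdo_mult phi : Phi phi -> psdo mu F alpha phi = mult alpha phi.
Proof.
move=> Pf; apply/funext => x.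
rewrite (mult_fourierE haar_mu m_loc_const alpha x Pf) /psdo /Defs.fourier; congr cintegral.
apply/funext => xi; rewrite dotpNr opprK [dotp x xi]dotpC -mulrA; congr (_ * _).
have [xiM|xiM] := leP (Qp_norm R xi) (p%:R ^+ M0); last by rewrite F_m.
by rewrite -/(fourier phi xi) /mfourier Pf.2 // !mulr0.
Qed.

Lemma Tmul_extension : is_extension d w M0 F alpha (Tmul alpha).
Proof.
have a0 := ltW alpha_gt0; split.
- move=> phi Pf; rewrite psdo_mult //.
  exact: (Tmul_class haar_mu A0_gt0 A1_gt0 m_bounds m_loc_const).
- apply: (Tmul_linear haar_mu A0_gt0 A1_gt0 m_bounds m_loc_const) => //.
  by rewrite subrr.
move=> gamma ag; have g0 := le_trans a0 ag; have ga0 : 0 <= gamma - alpha by rewrite subr_ge0.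
split=> [x|]; first exact: (Tmul_Htilde haar_mu A0_gt0 A1_gt0 m_bounds m_loc_const).
exists (mbound A0 A1 alpha) => x.
exact: (Tmul_bounded haar_mu A0_gt0 A1_gt0 m_bounds m_loc_const).
Qed.

(** T lowers the index by alpha, so reaching the natural index beta takes the index beta + alpha,
    rounded up to a natural number k. The inverse raises the index by alpha, so for it the norm of
    index beta already controls the norm of index beta. *)
Lemma extension_bicontinuous T : is_extension d w M0 F alpha T ->
  bicontinuous_isomorphism d w M0 T.
Proof.
move=> Te; have a0 := ltW alpha_gt0.
have oo beta : 0 <= beta -> Htilde_oo `<=` Htilde beta.
  move=> b0 x hx; have [k bk] := nat_above beta; exact: (Htilde_mono b0 bk (hx k)).
have TE x : Htilde_oo x -> T x = Tmul alpha x.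
  by move=> /(oo _ a0); exact: (extension_unique a0 Te Tmul_extension).
have [_ Tl Tb] := Te.
have addK beta : beta + alpha - alpha = beta by rewrite addrK.
have NK beta : beta - - alpha = beta + alpha by rewrite opprK.
have Too x : Htilde_oo x -> Htilde_oo (T x).
  move=> hx beta; have b0 : 0 <= beta%:R :> R by exact: ler0n.
  have [TH _] := Tb (beta%:R + alpha) ltac:(by rewrite lerDr).
  by rewrite -(addK beta%:R); apply: TH; apply: oo => //; rewrite addr_ge0.
have Soo x : Htilde_oo x -> Htilde_oo (Tmul (- alpha) x).
  move=> hx beta; have b0 : 0 <= beta%:R :> R by exact: ler0n.
  have ba0 : 0 <= beta%:R - - alpha by rewrite NK addr_ge0.
  have := Tmul_Htilde haar_mu A0_gt0 A1_gt0 m_bounds m_loc_const b0 ba0 (hx beta).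
  by apply: Htilde_mono => //; rewrite NK lerDl.
have Tloo : linear_on Htilde_oo T.
  by move=> a x y /(oo _ a0) hx /(oo _ a0) hy; exact: Tl.
have Sl : linear_on Htilde_oo (Tmul (- alpha)).
  move=> a x y /(oo _ (lexx 0)) hx /(oo _ (lexx 0)) hy.
  apply: (Tmul_linear haar_mu A0_gt0 A1_gt0 m_bounds m_loc_const (lexx 0) _ _ hx hy).
  by rewrite sub0r opprK.
split; [exact: Too|exact: Tloo| |].
  apply: (linear_continuous_oo Tloo) => beta; have b0 : 0 <= beta%:R :> R by exact: ler0n.
  have [k bk] := nat_above (beta%:R + alpha).
  have [_ [B TB]] := Tb (beta%:R + alpha) ltac:(by rewrite lerDr).
  have ba0 : 0 <= beta%:R + alpha by rewrite addr_ge0.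
  exists k, `|B| => z hz; rewrite -(addK beta%:R).
  apply: le_trans (TB z (oo _ ba0 _ hz)) _.
  have [u uz] := (HtildeP d w M0 _ _).1 (oo _ ba0 _ hz).
  apply: (@le_trans _ _ (`|B| * Hnorm (beta%:R + alpha) z)).
    by apply: ler_wpM2r; [exact: (Hnorm_ge0 haar_mu ba0 uz)|exact: ler_norm].
  by apply: ler_wpM2l; [exact: normr_ge0|exact: (Hnorm_mono ba0 bk (hz k))].
exists (Tmul (- alpha)); split; [exact: Soo| | |].
- move=> x hx; rewrite (TE _ hx).
  apply: (TmulK haar_mu A0_gt0 A1_gt0 m_bounds m_loc_const a0 _ (oo _ a0 _ hx)).
  by rewrite subrr.
- move=> x hx; rewrite (TE _ (Soo _ hx)) -{1}[alpha]opprK.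
  apply: (TmulK haar_mu A0_gt0 A1_gt0 m_bounds m_loc_const (lexx 0) _ (oo _ (lexx 0) _ hx)).
  by rewrite sub0r opprK.
apply: (linear_continuous_oo Sl) => beta; have b0 : 0 <= beta%:R :> R by exact: ler0n.
have ba0 : 0 <= beta%:R - - alpha by rewrite NK addr_ge0.
exists beta, (mbound A0 A1 (- alpha)) => z hz.
apply: le_trans (Tmul_bounded haar_mu A0_gt0 A1_gt0 m_bounds m_loc_const b0 ba0 (hz beta)).
apply: Hnorm_mono; [exact: b0|by rewrite NK lerDl|].
exact: (Tmul_Htilde haar_mu A0_gt0 A1_gt0 m_bounds m_loc_const b0 ba0 (hz beta)).
Qed.

End Extension.

(** * Semi-quasielliptic symbols *)

Import (coercions, canonicals) mpoly.

Section Symbol.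
Variables (p : nat) (p_pr : prime p) (n : nat).
Local Notation K := (Qp p_pr).
Local Notation V := 'rV[Qp p_pr]_n.
Local Notation pabs := (@pabs p p_pr).

Definition padic_cont (g : V -> K) := forall x (e : rat), 0 < e ->
  exists k, forall h, cball (p%:Q ^- k) h -> pabs (g (x + h) - g x) < e.

Lemma padic_cont_cst a : padic_cont (fun=> a).
Proof. by move=> x e e0; exists 0%N => h _; rewrite subrr pabs0. Qed.

Lemma padic_cont_coord i : padic_cont (fun x => x 0 i).
Proof.
move=> x e /(pexp_small p_pr)[k ke]; exists k => h hk.
by rewrite mxE addrAC subrr add0r; apply: le_lt_trans ke; exact: hk.
Qed.

Lemma pabsD_lt (x y : K) e : pabs x < e -> pabs y < e -> pabs (x + y) < e.
Proof. by move=> xe ye; apply: le_lt_trans (pabsD _ _) _; rewrite gt_max xe. Qed.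

Lemma padic_contD f g : padic_cont f -> padic_cont g -> padic_cont (fun x => f x + g x).
Proof.
move=> cf cg x e e0; have [[k kP] [l lP]] := (cf x e e0, cg x e e0).
exists (maxn k l) => h hh; rewrite opprD addrACA; apply: pabsD_lt.
  by apply: kP; apply: cball_mono hh; apply: (pexpV_le p_pr); rewrite leq_maxl.
by apply: lP; apply: cball_mono hh; apply: (pexpV_le p_pr); rewrite leq_maxr.
Qed.

Lemma padic_contM f g : padic_cont f -> padic_cont g -> padic_cont (fun x => f x * g x).
Proof.
move=> cf cg x e e0.
pose b := 1 + pabs (f x) + pabs (g x).
have b1 : 1 <= b by rewrite /b -addrA lerDl addr_ge0 ?pabs_ge0.
have b0 : 0 < b by exact: lt_le_trans b1.
have eb : 0 < Num.min 1 (e / b) by rewrite lt_min ltr01 divr_gt0.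
have [[k kP] [l lP]] := (cf x _ eb, cg x _ eb).
exists (maxn k l) => h hh.
have := kP h (cball_mono (pexpV_le p_pr (leq_maxl k l)) hh); rewrite lt_min => /andP[f1 fe].
have := lP h (cball_mono (pexpV_le p_pr (leq_maxr k l)) hh); rewrite lt_min => /andP[g1 ge].
have -> : f (x + h) * g (x + h) - f x * g x =
    (f (x + h) - f x) * g (x + h) + f x * (g (x + h) - g x) by ring.
have gb : pabs (g (x + h)) <= b.
  rewrite -[g (x + h)](subrK (g x)); apply: pabsD_le; first by rewrite (le_trans (ltW g1)).
  by rewrite /b lerDr addr_ge0 // pabs_ge0.
have fb : pabs (f x) <= b by rewrite /b addrAC lerDr addr_ge0 // pabs_ge0.
apply: pabsD_lt; rewrite pabsM.
  by apply: le_lt_trans (ler_wpM2l (pabs_ge0 _) gb) _; rewrite -ltr_pdivlMr.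
by apply: le_lt_trans (ler_wpM2r (pabs_ge0 _) fb) _; rewrite mulrC -ltr_pdivlMr.
Qed.

Lemma padic_cont_sum (I : Type) (r : seq I) (P : pred I) (F : I -> V -> K) :
  (forall i, P i -> padic_cont (F i)) -> padic_cont (fun x => \sum_(i <- r | P i) F i x).
Proof.
move=> cF; elim: r => [|i r IH].
  by under [X in padic_cont X]eq_fun do rewrite big_nil; exact: padic_cont_cst.
have [Pi|/negbTE Pi] := boolP (P i).
  under [X in padic_cont X]eq_fun do rewrite big_cons Pi.
  by apply: padic_contD => //; exact: cF.
by under [X in padic_cont X]eq_fun do rewrite big_cons Pi.
Qed.

Lemma padic_cont_prod (I : Type) (r : seq I) (P : pred I) (F : I -> V -> K) :
  (forall i, P i -> padic_cont (F i)) -> padic_cont (fun x => \prod_(i <- r | P i) F i x).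
Proof.
move=> cF; elim: r => [|i r IH].
  by under [X in padic_cont X]eq_fun do rewrite big_nil; exact: padic_cont_cst.
have [Pi|/negbTE Pi] := boolP (P i).
  under [X in padic_cont X]eq_fun do rewrite big_cons Pi.
  by apply: padic_contM => //; exact: cF.
by under [X in padic_cont X]eq_fun do rewrite big_cons Pi.
Qed.

Lemma padic_contX f k : padic_cont f -> padic_cont (fun x => f x ^+ k).
Proof.
move=> cf; elim: k => [|k IH]; first by under [X in padic_cont X]eq_fun do rewrite expr0;
  exact: padic_cont_cst.
by under [X in padic_cont X]eq_fun do rewrite exprS; exact: padic_contM.
Qed.

Lemma meval_cont (f : mpoly.mpoly n K) : padic_cont (fun x => mpoly.meval (x 0) f).
Proof.
under [X in padic_cont X]eq_fun do rewrite mpoly.mevalE.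
apply: padic_cont_sum => k _; apply: padic_contM; first exact: padic_cont_cst.
by apply: padic_cont_prod => i _; apply: padic_contX; exact: padic_cont_coord.
Qed.

Lemma pabs_loc_const f x : padic_cont f -> f x != 0 ->
  exists k, forall h, cball (p%:Q ^- k) h -> pabs (f (x + h)) = pabs (f x).
Proof.
move=> cf; rewrite -pabs_gt0 => /(cf x)[k kP]; exists k => h /kP fh.
by rewrite -[f (x + h)](subrKC (f x)) pabsD_eq.
Qed.

(** With e = (j + 1) w, the exponent on the right is j + 1 times the weighted degree of the
    monomial. *)
Lemma pabs_monomial_le (xi : 'I_n -> K) (b : rat) (e : 'I_n -> nat) (k : 'I_n -> nat) :
  (forall i, pabs (xi i) <= b ^+ e i) ->
  pabs (\prod_(i < n) xi i ^+ k i) <= b ^+ (\sum_(i < n) k i * e i).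
Proof.
move=> xb; rewrite pabs_prod -prodrXr; apply: ler_prod => i _.
by rewrite pabs_ge0 /= pabsX mulnC exprM lerXn2r ?nnegrE ?pabs_ge0 ?(le_trans _ (xb i)) //
  pabs_ge0.
Qed.

(** * Bounds on a quasielliptic polynomial *)

Variables (f : mpoly.mpoly n K) (d : nat) (w : 'I_n -> nat).
Hypothesis qe_f : quasielliptic f d w.
Local Notation ev xi := (mpoly.meval (xi 0) f).

Lemma ev_le1 (xi : V) : cball 1 xi -> pabs (ev xi) <= 1.
Proof.
move=> xi1; rewrite mpoly.mevalE; apply: pabs_sum_le => // k _.
rewrite pabsM -[leRHS]mulr1; apply: ler_pM; rewrite ?pabs_ge0 ?(qe_integral qe_f) //.
have xi0 i : pabs (xi 0 i) <= 1 ^+ 0 by rewrite expr0; exact: xi1.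
by have := pabs_monomial_le k xi0; rewrite expr1n.
Qed.

Lemma ev_eq0 (xi : V) : ev xi = 0 -> xi = 0.
Proof. by move=> /(qe_zero qe_f) E; apply/rowP => i; rewrite E mxE. Qed.

(** Compactness of the unit ball: |f| is locally constant near a point where f does not vanish, and
    the only other point is 0, near which no coordinate exceeds p^-w_i. *)
Lemma ev_lower : exists N, forall xi : V, cball 1 xi ->
  (exists i, p%:Q ^- w i < pabs (xi 0 i)) -> p%:Q ^- N <= pabs (ev xi).
Proof.
have := @cball_compact p p_pr n 0; rewrite expr0 compact_near_coveringP.
move=> /(_ nat \oo (fun N xi => (exists i, p%:Q ^- w i < pabs (xi 0 i)) ->
  p%:Q ^- N <= pabs (ev xi))) [].
  move=> x _; have [x0|x0] := eqVneq (ev x) 0.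
    have -> := ev_eq0 x0.
    exists (cball (p%:Q ^- (\max_(i < n) w i)), setT) => /=.
      split; last exact: filterT.
      by apply/nbhs_QpV; exists (\max_(i < n) w i)%N => h; rewrite add0r.
    move=> [y N] /= [yw _].
    case=> i; rewrite ltNge => /negP[]; apply: le_trans (yw i) _.
    by apply: (pexpV_le p_pr); exact: leq_bigmax.
  have [k kP] := pabs_loc_const (meval_cont f) x0.
  have [N Nx] : exists N, p%:Q ^- N < pabs (ev x) by apply: (pexp_small p_pr); rewrite pabs_gt0.
  exists ([set y : V | cball (p%:Q ^- k) (y - x)], [set M | (N <= M)%N]) => /=.
    split; last by exists N.
    by apply/nbhs_QpV; exists k => h hk /=; rewrite addrAC subrr add0r.
  move=> [y M] /= [yx NM] _; have := kP _ yx; rewrite subrKC => ->.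
  by apply: le_trans (ltW Nx); exact: (pexpV_le p_pr).
by move=> N _ /(_ N (leqnn N)) /= H; exists N => xi /H; apply.
Qed.

(** j + 1 is the least exponent for which the scaling of each xi_i by p^((j + 1) w_i) brings xi into
    the unit ball; by minimality the scaled point lies in the region of [ev_lower]. Such exponents
    exist because the weights are positive. *)
Lemma scale_exponent (xi : V) : ~ cball 1 xi -> exists j,
  (forall i, pabs (xi 0 i) <= p%:Q ^+ (j.+1 * w i)) /\
  exists i, p%:Q ^+ (j * w i) < pabs (xi 0 i).
Proof.
move=> xi1; pose P j := [forall i, pabs (xi 0 i) <= p%:Q ^+ (j * w i)].
have exP : exists j, P j.
  have [N xiN] := cball_bound xi; exists N; apply/forallP => i; apply: le_trans (xiN i) _.
  by apply: (pexp_le p_pr); rewrite leq_pmulr // (qe_weights qe_f).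
case: (ex_minnP exP) => [[|j] /forallP Pj jmin].
  by case: xi1 => i; have := Pj i; rewrite mul0n expr0.
exists j; split => //; have : ~ forall i, pabs (xi 0 i) <= p%:Q ^+ (j * w i).
  by move=> /forallP /jmin; rewrite ltnn.
by move=> /existsNP[i /negP]; rewrite -ltNge; exists i.
Qed.

(** Scaling with l = p^(j + 1) moves xi to the region where |f| lies between p^-N and 1, and by
    homogeneity it multiplies |f (xi)| by |l|^d = p^-((j + 1) d). *)
Lemma ev_scaled N (xi : V) j :
  (forall xi : V, cball 1 xi -> (exists i, p%:Q ^- w i < pabs (xi 0 i)) ->
    p%:Q ^- N <= pabs (ev xi)) ->
  (forall i, pabs (xi 0 i) <= p%:Q ^+ (j.+1 * w i)) ->
  (exists i, p%:Q ^+ (j * w i) < pabs (xi 0 i)) ->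
  p%:Q ^+ (j.+1 * d) * p%:Q ^- N <= pabs (ev xi) <= p%:Q ^+ (j.+1 * d).
Proof.
move=> HN up [i0 lo]; pose l : K := p%:R ^+ j.+1.
have l0 : l != 0 by rewrite expf_neq0 // natp_neq0.
pose xi' : V := \row_i (l ^+ w i * xi 0 i).
have pl k : pabs (l ^+ k) = p%:Q ^- (j.+1 * k).
  by rewrite pabsX pabsX pabs_natp exprVn exprVn -exprM.
have pp k : 0 < p%:Q ^+ k by rewrite exprn_gt0 // (pQ_gt0 p_pr).
have xiE i : pabs (xi' 0 i) = pabs (xi 0 i) / p%:Q ^+ (j.+1 * w i).
  by rewrite mxE pabsM pl mulrC.
have b1 : cball 1 xi' by move=> i; rewrite xiE ler_pdivrMr // mul1r.
have b2 : exists i, p%:Q ^- w i < pabs (xi' 0 i).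
  by exists i0; rewrite xiE ltr_pdivlMr // mulSn exprD mulKf // gt_eqF.
have E : ev xi' = l ^+ d * ev xi.
  rewrite -(qe_homog qe_f (xi 0) l0); congr (mpoly.meval _ f).
  by apply/funext => i; rewrite mxE.
have := HN _ b1 b2; have := ev_le1 b1; rewrite E pabsM pl mulrC => u v.
by rewrite [X in X <= _]mulrC -ler_pdivlMr // v /= -[leRHS]mul1r -ler_pdivrMr.
Qed.

Variable R : realType.

Lemma ratr_pexp k : ratr (p%:Q ^+ k) = p%:R ^+ k :> R.
Proof. by rewrite rmorphXn /= ratr_int. Qed.

Lemma pR_gt0 : 0 < p%:R :> R. Proof. by rewrite ltr0n prime_gt0. Qed.

Lemma powR_weight j i : (p%:R ^+ (j * w i) : R) `^ (d%:R / (w i)%:R) = p%:R ^+ (j * d).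
Proof.
have w0 : (w i)%:R != 0 :> R by rewrite pnatr_eq0 -lt0n (qe_weights qe_f).
rewrite -!powR_mulrn ?(ltW pR_gt0) // -powRrM; congr (_ `^ _).
by rewrite !natrM; field.
Qed.

(** The exponents d / w_i turn p^(j w_i) into p^(j d), the same for all coordinates, so that [Xi] is
    controlled by the same j as |f| in [ev_scaled]. *)
Lemma Xi_scaled (xi : V) j :
  (forall i, pabs (xi 0 i) <= p%:Q ^+ (j.+1 * w i)) ->
  (exists i, p%:Q ^+ (j * w i) < pabs (xi 0 i)) ->
  p%:R ^+ (j * d) <= Xi R d w xi <= n%:R * p%:R ^+ (j.+1 * d).
Proof.
move=> up [i0 lo]; have e0 i : 0 <= d%:R / (w i)%:R :> R by rewrite divr_ge0.
apply/andP; split.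
  rewrite /Xi (bigD1 i0) //= ler_wpDr //; first by apply: sumr_ge0 => i _; exact: powR_ge0.
  rewrite -(powR_weight j i0); apply: ge0_ler_powR; rewrite ?nnegrE ?exprn_ge0 ?Qp_abs_ge0 //.
  by rewrite -ratr_pexp ler_rat ltW.
apply: (@le_trans _ _ (\sum_(i < n) p%:R ^+ (j.+1 * d))); last first.
  by rewrite sumr_const card_ord mulr_natl.
apply: ler_sum => i _; rewrite -(powR_weight j.+1 i).
apply: ge0_ler_powR; rewrite ?nnegrE ?exprn_ge0 ?Qp_abs_ge0 //.
by rewrite -ratr_pexp ler_rat.
Qed.

Variable c : mpoly.multinom n -> V -> K.
Hypothesis bounded_c : bounded_coefs R d w c.

Lemma coefs_bound : exists L, forall (k : mpoly.bmultinom n d) x,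
  (wdeg w (mpoly.bmnm k) <= d - 1)%N -> pabs (c (mpoly.bmnm k) x) <= p%:Q ^+ L.
Proof.
have /boolp.choice[L LP] : forall k : mpoly.bmultinom n d, exists L, forall x,
    (wdeg w (mpoly.bmnm k) <= d - 1)%N -> pabs (c (mpoly.bmnm k) x) <= p%:Q ^+ L.
  move=> k; have [kd|] := boolP (wdeg w (mpoly.bmnm k) <= d - 1)%N; last by exists 0%N.
  have [B BP] := bounded_c kd; have [M BM] := nat_above B; exists M => x _.
  rewrite -(ler_rat R) ratr_pexp; apply: le_trans (BP x) _; apply: le_trans BM _.
  by rewrite -natrX ler_nat ltnW // ltn_expl // prime_gt1.
exists (\max_(k : mpoly.bmultinom n d) L k)%N => k x kd; apply: le_trans (LP k x kd) _.
by apply: (pexp_le p_pr); exact: leq_bigmax.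
Qed.

(** A large norm forces j > N + L. The terms of lower weighted degree are at most p^(L + (j + 1) (d
    - 1)), which is then smaller than the lower bound p^((j + 1) d - N) of |f|, uniformly in x. *)
Lemma symbol_dominated : exists M0 : nat, exists A0 A1 : R, [/\ 0 < A0, 0 < A1 &
  forall xi : V, p%:R ^+ M0 <= Qp_norm R xi ->
    [/\ ev xi != 0, forall x, Qp_abs R (symbol f d w c xi x) = Qp_abs R (ev xi) &
     A0 * Xi R d w xi <= Qp_abs R (ev xi) <= A1 * Xi R d w xi]].
Proof.
have [N NP] := ev_lower; have [L LP] := coefs_bound.
(* If j <= N + L, all the coordinates of xi are bounded by p^((N + L + 1) W); the final successor
   makes M0 exclude this case even on the sphere of radius p^M0. *)
pose W := (\sum_(i < n) w i)%N; pose M0 := ((N + L).+1 * W).+1.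
(* The n coordinates of [Xi] cost a factor n, replaced by n + 1 to be positive; p^d is the ratio of
   the upper bound p^((j + 1) d) of |f| to the lower bound p^(j d) of [Xi]. *)
exists M0, (p%:R ^- N / n.+1%:R), (p%:R ^+ d).
have pR k : 0 < p%:R ^+ k :> R by rewrite exprn_gt0 // pR_gt0.
split; [by rewrite divr_gt0 ?invr_gt0 // ltr0n|exact: pR|] => xi xiM.
have big k : (k < M0)%N -> ~ cball (p%:Q ^+ k) xi.
  move=> kM /(Qp_norm_cball R) H; have := le_trans xiM H.
  by rewrite ler_eXn2l ?ltr1n ?prime_gt1 // leqNgt kM.
have xi1 : ~ cball 1 xi by rewrite -(expr0 p%:Q); exact: big.
have [j [up lo]] := scale_exponent xi1.
have /andP[evlo evup] := ev_scaled NP up lo.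
have /andP[Xlo Xup] := Xi_scaled up lo.
have pQ k : 0 < p%:Q ^+ k by rewrite exprn_gt0 // (pQ_gt0 p_pr).
have ev0 : 0 < pabs (ev xi) by apply: lt_le_trans evlo; rewrite mulr_gt0 ?invr_gt0.
have jNL : (N + L < j)%N.
  rewrite ltnNge; apply/negP => jNL; apply: (big ((N + L).+1 * W)%N) => [|i]; first exact: leqnn.
  apply: le_trans (up i) _; apply: (pexp_le p_pr); apply: leq_mul => //.
  by rewrite /W (bigD1 i) //= leq_addr.
split; first by rewrite -pabs_gt0.
- move=> x; rewrite /symbol /Qp_abs pabsD_eq //.
  suff sum_lt (I : finType) (P : pred I) (F : I -> K) : (forall i, P i ->
    pabs (F i) < pabs (ev xi)) ->
      pabs (\sum_(i | P i) F i) < pabs (ev xi).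
    (* The index type bounds the degree of k strictly by d, so d > 0 and d - 1 is a true
       predecessor. *)
    apply: sum_lt => k kd; have d0 : (0 < d)%N by apply: leq_ltn_trans (mpoly.bmdeg k).
    rewrite pabsM; apply: lt_le_trans evlo.
    apply: (@le_lt_trans _ _ (p%:Q ^+ L * p%:Q ^+ (j.+1 * (d - 1)))).
      apply: ler_pM; rewrite ?pabs_ge0 ?LP //.
      apply: le_trans (pabs_monomial_le _ up) _; apply: (pexp_le p_pr).
      under eq_bigr => i _ do rewrite mulnCA.
      by rewrite -big_distrr /= leq_mul2l; apply/orP; right.
    rewrite ltr_pdivlMr // -!exprD ltr_eXn2l ?(pQ_gt1 p_pr) //.
    by case: (d) d0 => // d' _; rewrite subn1 /= mulnS; lia.
  by move=> FP; elim/big_ind : _ => [|y z|//]; [rewrite pabs0|exact: pabsD_lt].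
have evloR : p%:R ^+ (j.+1 * d) * p%:R ^- N <= Qp_abs R (ev xi).
  by rewrite -!ratr_pexp -fmorphV -rmorphM ler_rat.
have evupR : Qp_abs R (ev xi) <= p%:R ^+ (j.+1 * d) by rewrite -ratr_pexp ler_rat.
apply/andP; split.
  apply: le_trans evloR; rewrite mulrAC ler_pdivrMr ?ltr0n // [X in _ <= X * _]mulrC -mulrA.
  apply: ler_wpM2l; first by rewrite invr_ge0 ltW.
  by apply: le_trans Xup _; rewrite mulrC; apply: ler_wpM2l; rewrite ?ler_nat // ltW.
apply: le_trans evupR _; rewrite mulSn exprD.
by apply: ler_wpM2l => //; exact: ltW.
Qed.

End Symbol.

Theorem theorem7p5 (R : realType) (p : nat) (p_pr : prime p) (n : nat)
  (mu : {measure set (BorelQp p_pr n) -> \bar R}) (haar_mu : haar_measure mu)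
  (f : mpoly.mpoly n (Qp p_pr)) (d : nat) (w : 'I_n -> nat)
  (qe_f : quasielliptic f d w)
  (c : mpoly.multinom n -> 'rV[Qp p_pr]_n -> Qp p_pr)
  (bounded_c : bounded_coefs R d w c) :
  exists M0 : nat,
    (exists A0 A1 : R, 0 < A0 /\ 0 < A1 /\
      forall x xi : 'rV[Qp p_pr]_n, p%:R ^+ M0 <= Qp_norm R xi ->
        A0 * Xi R d w xi <= Qp_abs R (symbol f d w c xi x) <= A1 * Xi R d w xi) /\
    forall alpha : R, 0 < alpha ->
      (exists T : aefun mu -> aefun mu, is_extension d w M0 (symbol f d w c) alpha T) /\
      forall T : aefun mu -> aefun mu, is_extension d w M0 (symbol f d w c) alpha T ->
        bicontinuous_isomorphism d w M0 T.
Proof.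
have [M0 [A0 [A1 [A0_gt0 A1_gt0 H]]]] := symbol_dominated qe_f bounded_c.
pose m (xi : 'rV[Qp p_pr]_n) := Qp_abs R (mpoly.meval (xi 0) f).
have m_bounds xi : p%:R ^+ M0 <= Qp_norm R xi -> A0 * Xi R d w xi <= m xi <= A1 * Xi R d w xi.
  by move=> /H[].
have m_loc_const xi : p%:R ^+ M0 < Qp_norm R xi ->
    exists k, forall h, cball (p%:Q ^- k) h -> m (xi + h) = m xi.
  move=> /ltW /H[ev0 _ _]; have [k kP] := pabs_loc_const (meval_cont f) ev0.
  by exists k => h /kP E; rewrite /m /Qp_abs E.
have F_m xi x : p%:R ^+ M0 < Qp_norm R xi -> Qp_abs R (symbol f d w c xi x) = m xi.
  by move=> /ltW /H[_ E _]; exact: E.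
exists M0; split.
  exists A0, A1; split; [exact: A0_gt0|split; [exact: A1_gt0|]] => x xi xiM.
  by have [_ -> b] := H xi xiM.
move=> alpha alpha_gt0; split.
  exists (Tmul d w M0 m alpha).
  exact: (Tmul_extension haar_mu A0_gt0 A1_gt0 m_bounds m_loc_const F_m alpha_gt0).
move=> T; exact: (extension_bicontinuous haar_mu A0_gt0 A1_gt0 m_bounds m_loc_const F_m
  alpha_gt0).
Qed.
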